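(* Let $G$ be a benzenoid system with boundary cycle $Z$. Then the Mostar index $Mo(G)$ can be computed in $O(|Z|)$ time.
   Context: A benzenoid system is the graph induced by the vertices and edges of the hexagonal (graphite) lattice lying on a cycle $Z$ of the lattice (its boundary cycle) or in its interior; the system is given by its boundary cycle $Z$. For a connected graph $H$ and an edge $e=uv$, $N_u(e|H)=\{x\in V(H): d_H(x,u)<d_H(x,v)\}$ ($d_H$ the shortest-path distance), symmetrically for $v$, and the Mostar index is $Mo(H)=\sum_{e=uv\in E(H)}|\,|N_u(e|H)|-|N_v(e|H)|\,|$. Arithmetic operations are counted as unit-time operations. *)

(* Defs.v *)
From Stdlib Require Import Relation_Operators.
From mathcomp Require Import all_boot all_order all_algebra finmap.

Set Implicit Arguments.
Unset Strict Implicit.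
Unset Printing Implicit Defensive.

Import GRing.Theory Num.Theory.
Local Open Scope ring_scope.

Section Mostar.
Variables (T : finType) (e : rel T).

(* The least length of a walk from x to y; the value #|T| is only reached when
   x and y are not connected. *)
Definition dist (x y : T) : nat :=
  find (fun n => [exists p : n.-tuple T, path e x p && (last x p == y)])
       (iota 0 #|T|).

Definition closer (u v : T) : {set T} := [set x | (dist x u < dist x v)%N].

(* Comparing enumeration ranks selects exactly one orientation of each edge. *)
Definition mostar : nat :=
  (\sum_(uv : T * T | e uv.1 uv.2 && (enum_rank uv.1 < enum_rank uv.2))
     `|#|closer uv.1 uv.2|%:Z - #|closer uv.2 uv.1|%:Z|)%N.

End Mostar.

(* Coordinates on the hexagonal lattice.  Orthogonal projection along (1,1,1)
   maps the points of Z^3 with x + y + z in {-1, 0, 1} bijectively onto a planar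
   triangular lattice.  The points with sum 0 or 1 are the vertices of a regular
   hexagonal lattice, two of them being joined by an edge when they are at unit
   distance in Z^3; the points with sum -1 are the centres of its hexagonal
   faces.  The six corners of the face with centre c are c + e_i and
   c + e_i + e_j (i <> j), that is, the vertices in c + {0,1}^3. *)
Definition point : Type := (int * int * int)%type.

Definition coordx (p : point) : int := p.1.1.
Definition coordy (p : point) : int := p.1.2.
Definition coordz (p : point) : int := p.2.
Definition coord_sum (p : point) : int := coordx p + coordy p + coordz p.

Definition hvertex (p : point) : bool :=
  (coord_sum p == 0) || (coord_sum p == 1).

Definition hadj (u v : point) : bool :=
  [&& hvertex u, hvertex v &
      `|coordx u - coordx v| + `|coordy u - coordy v| + `|coordz u - coordz v|
        == 1].

Definition hface (c : point) : bool := coord_sum c == -1.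

Definition corner (c v : point) : bool :=
  [&& hface c, hvertex v,
      0 <= coordx v - coordx c <= 1,
      0 <= coordy v - coordy c <= 1 &
      0 <= coordz v - coordz c <= 1].

(* The bound on the size excludes the degenerate closed walk u, v, u. *)
Definition lattice_cycle (Z : seq point) : Prop :=
  ucycle hadj Z /\ (2 < size Z)%N.

Definition cycle_edge (Z : seq point) (u v : point) : bool :=
  [&& u \in Z, v \in Z & (next Z u == v) || (next Z v == u)].

Definition face_step (Z : seq point) (c d : point) : Prop :=
  exists u v : point,
    [/\ hadj u v, ~~ cycle_edge Z u v,
        corner c u && corner c v & corner d u && corner d v].

(* A connected component of the plane minus Z is determined by the faces it
   contains, two faces being in the same component when one can pass from one to
   the other across edges that are not on Z.  The interior of Z is the bounded
   component. *)
Definition interior_face (Z : seq point) (c : point) : Prop :=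
  hface c /\
  exists N : int, forall d : point,
    clos_refl_trans point (face_step Z) c d ->
    [/\ `|coordx d| <= N, `|coordy d| <= N & `|coordz d| <= N].

(* A vertex (resp. edge) that is not on Z lies in the open region interior to Z
   when the faces around it do. *)
Definition vertex_on_or_inside (Z : seq point) (v : point) : Prop :=
  hvertex v /\
  (v \in Z \/ forall c : point, corner c v -> interior_face Z c).

Definition edge_on_or_inside (Z : seq point) (u v : point) : Prop :=
  hadj u v /\
  (cycle_edge Z u v \/
   forall c : point, corner c u -> corner c v -> interior_face Z c).

(* The graph with vertex set V and adjacency relation e is the benzenoid system
   with boundary cycle Z.  It need not be an induced subgraph of the lattice: an
   edge joining two vertices of Z may lie outside Z. *)
Record benzenoid (Z : seq point) (V : {fset point}) (e : rel V) : Prop :=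
  Benzenoid {
    benzenoid_cycle : lattice_cycle Z;
    benzenoid_vertices : forall v : point, v \in V <-> vertex_on_or_inside Z v;
    benzenoid_edges : forall u v : V, e u v <-> edge_on_or_inside Z (val u) (val v)
  }.

(* The unit-cost random access machine, as a structured language.  A state has
   registers and an indirectly addressable memory, both holding integers. *)
Inductive binop := OpAdd | OpSub | OpMul | OpDiv | OpEq | OpLt.

Inductive expr :=
| Const of int
| Reg of nat
| Read of expr
| Bin of binop & expr & expr.

Inductive cmd :=
| Skip
| Assign of nat & expr
| Write of expr & expr
| Seq of cmd & cmd
| If of expr & cmd & cmd
| While of expr & cmd.

Record state := State { regs : nat -> int; memory : int -> int }.

Definition eval_binop (o : binop) (a b : int) : int :=
  match o with
  | OpAdd => a + b
  | OpSub => a - b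
  | OpMul => a * b
  | OpDiv => (a %/ b)%Z
  | OpEq => if a == b then 1 else 0
  | OpLt => if a < b then 1 else 0
  end.

Fixpoint eval (a : expr) (s : state) : int :=
  match a with
  | Const k => k
  | Reg r => regs s r
  | Read b => memory s (eval b s)
  | Bin o b c => eval_binop o (eval b s) (eval c s)
  end.

(* Every constant, register access, memory access and operation costs one. *)
Fixpoint ecost (a : expr) : nat :=
  match a with
  | Const _ | Reg _ => 1
  | Read b => (ecost b).+1
  | Bin _ b c => (ecost b + ecost c).+1
  end.

Definition set_reg (s : state) (r : nat) (k : int) : state :=
  State (fun r' => if r' == r then k else regs s r') (memory s).

Definition set_memory (s : state) (i k : int) : state :=
  State (regs s) (fun j => if j == i then k else memory s j).

(* exec c s t s': started in state s, c halts in state s' after t time units. *)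
Inductive exec : cmd -> state -> nat -> state -> Prop :=
| ExecSkip s : exec Skip s 1 s
| ExecAssign r a s :
    exec (Assign r a) s (ecost a).+1 (set_reg s r (eval a s))
| ExecWrite a b s :
    exec (Write a b) s (ecost a + ecost b).+1 (set_memory s (eval a s) (eval b s))
| ExecSeq c1 c2 s1 s2 s3 t1 t2 :
    exec c1 s1 t1 s2 -> exec c2 s2 t2 s3 ->
    exec (Seq c1 c2) s1 (t1 + t2)%N s3
| ExecIfTrue b c1 c2 s s' t :
    eval b s != 0 -> exec c1 s t s' ->
    exec (If b c1 c2) s (ecost b + t).+1 s'
| ExecIfFalse b c1 c2 s s' t :
    eval b s = 0 -> exec c2 s t s' ->
    exec (If b c1 c2) s (ecost b + t).+1 s'
| ExecWhileTrue b c s1 s2 s3 t1 t2 :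
    eval b s1 != 0 -> exec c s1 t1 s2 -> exec (While b c) s2 t2 s3 ->
    exec (While b c) s1 (ecost b + t1 + t2).+1 s3
| ExecWhileFalse b c s :
    eval b s = 0 -> exec (While b c) s (ecost b).+1 s.

(* Z is stored as the list of the coordinates of its successive vertices, from
   address 0 on. *)
Definition encode (Z : seq point) : seq int :=
  flatten [seq [:: coordx p; coordy p; coordz p] | p <- Z].

(* Register 0 holds |Z|; everything else outside the input is 0. *)
Definition input_state (Z : seq point) : state :=
  State (fun r => if r == 0%N then (size Z)%:Z else 0)
        (fun i => match i with Posz k => nth 0 (encode Z) k | Negz _ => 0 end).

Definition output (s : state) : int := regs s 0.

(* Main.v *)
(* An edge uv of a benzenoid system lies on a unique straight cut, which crosses Z in
   exactly two edges; removing the edges of the cut leaves two sides, and the vertices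
   closer to u than to v are those on the side of u.  So Mo(G) is the sum over the |Z|/2
   cuts of the number of edges of the cut times the difference of the numbers of
   vertices on its two sides.  By a discrete Green formula, the number of vertices on a
   side is a sum, over the boundary arc that bounds it, of weights depending only on
   three consecutive vertices of Z, hence a difference of two prefix sums along Z.  The
   two ends of a cut are neighbours among the edges of Z in a row of the lattice, and
   are found by a bucket sort of the edges of Z.  This is done for one direction of
   cuts; the two others follow by rotating the coordinates.

   Interior and exterior of Z are separated by winding numbers: they change by one
   across the edges of Z only, and the faces to the left of Z (resp. to its right) are
   all connected to each other.  Sides of a cut are separated by the winding number of
   the arc closed by the cut, computed on faces halved along the cut line. *)
From Stdlib Require Import Relation_Operators.
From mathcomp Require Import all_boot all_order all_algebra finmap.
From mathcomp Require Import zify.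
Require Import Defs.

Set Implicit Arguments.
Unset Strict Implicit.
Unset Printing Implicit Defensive.

Import Order.TTheory GRing.Theory Num.Theory.
Local Open Scope ring_scope.

(** * The hexagonal lattice *)

(* The faces of row a follow each other by increasing b; face a (b - 1) and face a b
   are separated by the edge from vlo a b to vhi (a + 1) b. *)
Definition face (a b : int) : point := (a, b, - 1 - a - b).

(* Position on the zigzag path of the vertices with a given first coordinate. *)
Definition zigzag_pos (p : point) : int := coordy p - coordx p - coordz p.

Definition vlo (a b : int) : point := (a, b, - a - b).
Definition vhi (a b : int) : point := (a, b, 1 - a - b).

Variant step_spec : point -> point -> Prop :=
| StepXup a b : step_spec (vlo a b) (vhi (a + 1) b)
| StepXdown a b : step_spec (vhi (a + 1) b) (vlo a b)
| StepYup a b : step_spec (vlo a b) (vhi a (b + 1))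
| StepYdown a b : step_spec (vhi a (b + 1)) (vlo a b)
| StepZup a b : step_spec (vlo a b) (vhi a b)
| StepZdown a b : step_spec (vhi a b) (vlo a b).

Ltac unfold_lattice :=
  rewrite ?/hadj ?/corner ?/hface ?/hvertex ?/coord_sum ?/face ?/vlo ?/vhi
    ?/coordx ?/coordy ?/coordz /=.

Lemma hadjP (u v : point) : reflect (step_spec u v) (hadj u v).
Proof.
apply: (iffP idP); last by case=> a b; unfold_lattice; lia.
case: u v => [[a b] c] [[a' b'] c']; unfold_lattice => h.
have [h1|h1] : (a + b + c = 0 \/ a + b + c = 1) by lia.
- have -> : c = - a - b by lia.
  have -> : c' = 1 - a' - b' by lia.
  have [[-> ->]|[[-> ->]|[-> ->]]] : (a' = a + 1 /\ b' = b) \/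
    (a' = a /\ b' = b + 1) \/ (a' = a /\ b' = b) by lia.
  + exact: StepXup.
  + exact: StepYup.
  + exact: StepZup.
- have -> : c' = - a' - b' by lia.
  have -> : c = 1 - a - b by lia.
  have [[-> ->]|[[-> ->]|[-> ->]]] : (a = a' + 1 /\ b = b') \/
    (a = a' /\ b = b' + 1) \/ (a = a' /\ b = b') by lia.
  + exact: StepXdown.
  + exact: StepYdown.
  + exact: StepZdown.
Qed.

Lemma eq_lo_lo a b a' b' : (vlo a b == vlo a' b') = (a == a') && (b == b').
Proof. by rewrite /vlo !xpair_eqE; lia. Qed.

Lemma eq_hi_hi a b a' b' : (vhi a b == vhi a' b') = (a == a') && (b == b').
Proof. by rewrite /vhi !xpair_eqE; lia. Qed.

Lemma eq_lo_hi a b a' b' : (vlo a b == vhi a' b') = false.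
Proof. by rewrite /vlo /vhi !xpair_eqE; lia. Qed.

Lemma eq_hi_lo a b a' b' : (vhi a b == vlo a' b') = false.
Proof. by rewrite /vlo /vhi !xpair_eqE; lia. Qed.

Definition eq_vertex := (eq_lo_lo, eq_hi_hi, eq_lo_hi, eq_hi_lo).

Lemma hvertexP (p : point) :
  reflect (exists a b, p = vlo a b \/ p = vhi a b) (hvertex p).
Proof.
case: p => [[a b] c]; unfold_lattice; apply: (iffP idP) => [h|[a' [b' h]]].
  exists a, b; have [h1|h1] : (a + b + c = 0 \/ a + b + c = 1) by lia.
  - by left; congr (_, _); lia.
  - by right; congr (_, _); lia.
by case: h => -[-> -> ->]; lia.
Qed.

(* Signed crossing of the step from s to t with the ray that starts at face a b and
   runs through the next faces of its row. *)
Definition crossing (a b : int) (s t : point) : int :=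
  if (coordx s + coordx t == 2 * a + 1) && (b < coordy s)
  then coordx t - coordx s else 0.

Definition traversal (u v s t : point) : int :=
  Posz ((s == u) && (t == v)) - Posz ((s == v) && (t == u)).

Definition beyond (a m : int) (p : point) : int :=
  Posz ((coordx p == a) && (m <= zigzag_pos p)).

(* Both sides telescope along a walk, so on a closed walk the winding numbers of
   the two faces at a zigzag edge differ by the net traversal of that edge. *)
Lemma crossing_zigzag (u v s t : point) :
  hadj u v -> hadj s t -> coordx u = coordx v ->
  zigzag_pos v = zigzag_pos u + 1 ->
  crossing (coordx u) (coordy v - 1) s t - crossing (coordx u - 1) (coordy u) s t
  = traversal u v s t
    - (beyond (coordx u) (zigzag_pos v) t - beyond (coordx u) (zigzag_pos v) s).
Proof.
move=> /hadjP uv /hadjP st; case: uv => a b; case: st => c d;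
  rewrite /traversal !eq_vertex /crossing /beyond /zigzag_pos; unfold_lattice;
  try lia; move=> _ _; by do 2 case: ifP; lia.
Qed.

Lemma crossing_xedge (a b : int) (s t : point) : hadj s t ->
  crossing a (b - 1) s t - crossing a b s t
  = traversal (vlo a b) (vhi (a + 1) b) s t.
Proof.
move=> /hadjP[] c d; rewrite /traversal !eq_vertex /crossing; unfold_lattice;
  by do 2 case: ifP; lia.
Qed.

Lemma eq_face a b a' b' : (face a b == face a' b') = (a == a') && (b == b').
Proof. by rewrite /face !xpair_eqE; lia. Qed.

Lemma hface_face a b : hface (face a b).
Proof. by unfold_lattice; lia. Qed.

Lemma hfaceE c : hface c -> c = face (coordx c) (coordy c).
Proof.
case: c => [[a b] c]; unfold_lattice => h; congr (_, _); lia.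
Qed.

Lemma corner_lo c a b : corner c (vlo a b) =
  [|| c == face a b, c == face a (b - 1) | c == face (a - 1) b].
Proof.
case: c => [[x y] t]; rewrite /face !xpair_eqE; unfold_lattice; lia.
Qed.

Lemma corner_hi c a b : corner c (vhi a b) =
  [|| c == face (a - 1) b, c == face (a - 1) (b - 1) | c == face a (b - 1)].
Proof.
case: c => [[x y] t]; rewrite /face !xpair_eqE; unfold_lattice; lia.
Qed.

(* The face to the left of the directed edge from u to v. *)
Definition lface (u v : point) : point :=
  if coordx u < coordx v then face (coordx u) (coordy u - 1)
  else if coordx v < coordx u then face (coordx v) (coordy v)
  else if zigzag_pos u < zigzag_pos v then face (coordx u) (coordy v - 1)
  else face (coordx u - 1) (coordy v).

Lemma lface_Xup a b : lface (vlo a b) (vhi (a + 1) b) = face a (b - 1).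
Proof. by rewrite /lface /coordx /= ifT //; lia. Qed.

Lemma lface_Xdown a b : lface (vhi (a + 1) b) (vlo a b) = face a b.
Proof. by rewrite /lface /coordx /= ifF ?ifT //; lia. Qed.

Lemma lface_Yup a b : lface (vlo a b) (vhi a (b + 1)) = face a b.
Proof.
rewrite /lface /zigzag_pos /coordx /coordy /coordz /= ltxx ifT; last lia.
by congr face; lia.
Qed.

Lemma lface_Ydown a b : lface (vhi a (b + 1)) (vlo a b) = face (a - 1) b.
Proof.
by rewrite /lface /zigzag_pos /coordx /coordy /coordz /= ltxx ifF; last lia.
Qed.

Lemma lface_Zup a b : lface (vlo a b) (vhi a b) = face (a - 1) b.
Proof.
by rewrite /lface /zigzag_pos /coordx /coordy /coordz /= ltxx ifF; last lia.
Qed.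

Lemma lface_Zdown a b : lface (vhi a b) (vlo a b) = face a (b - 1).
Proof.
by rewrite /lface /zigzag_pos /coordx /coordy /coordz /= ltxx ifT; last lia.
Qed.

Definition lfaceE :=
  (lface_Xup, lface_Xdown, lface_Yup, lface_Ydown, lface_Zup, lface_Zdown).

Lemma hface_lface u v : hface (lface u v).
Proof. by rewrite /lface; repeat case: ifP => _; apply: hface_face. Qed.

Lemma hadj_sym u v : hadj u v = hadj v u.
Proof.
by apply/hadjP/hadjP => -[] a b; constructor.
Qed.

Lemma corner_edge c u v : hadj u v ->
  corner c u && corner c v = (c == lface u v) || (c == lface v u).
Proof.
move=> uv; case: (boolP (hface c)) => [/hfaceE ->|hc]; last first.
  rewrite {1}/corner (negbTE hc) /=; apply/esym/negbTE; rewrite negb_or.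
  by apply/andP; split; apply: contraNneq hc => ->; apply: hface_lface.
move: (coordx c) (coordy c) => x y; move/hadjP: uv; case=> a b;
  rewrite !corner_lo !corner_hi !lfaceE !eq_face; lia.
Qed.

Lemma corner_lface u v : hadj u v -> corner (lface u v) u && corner (lface u v) v.
Proof. by move=> h; rewrite corner_edge // eqxx. Qed.

Lemma hadj_lo a b v : hadj (vlo a b) v =
  [|| v == vhi (a + 1) b, v == vhi a (b + 1) | v == vhi a b].
Proof.
case: v => [[x y] t]; rewrite /vhi !xpair_eqE; unfold_lattice; lia.
Qed.

Lemma hadj_hi a b v : hadj (vhi a b) v =
  [|| v == vlo (a - 1) b, v == vlo a (b - 1) | v == vlo a b].
Proof.
case: v => [[x y] t]; rewrite /vlo !xpair_eqE; unfold_lattice; lia.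
Qed.

Lemma turn_lface s m q : hadj s m -> hadj m q -> s != q ->
  lface s m = lface m q \/
  exists2 n, [&& hadj m n, n != s & n != q] &
    corner (lface s m) n && corner (lface m q) n.
Proof.
move=> sm mq; have : hvertex m by case/and3P: mq.
case/hvertexP=> a [b [mE|mE]]; subst m; move: sm mq; rewrite hadj_sym.
  rewrite !hadj_lo => /or3P[]/eqP-> /or3P[]/eqP->; rewrite ?eqxx // => _;
  rewrite !lfaceE; try (by left);
  [right; exists (vhi a (b + 1))|right; exists (vhi a b)|
   right; exists (vhi (a + 1) b)];
  rewrite ?hadj_lo ?corner_hi ?eq_face ?eq_vertex; lia.
have [c ->] : exists c, a = c + 1 by exists (a - 1); lia.
have [d ->] : exists d, b = d + 1 by exists (b - 1); lia.
rewrite !hadj_hi !addrK => /or3P[]/eqP-> /or3P[]/eqP->; rewrite ?eqxx // => _;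
  rewrite !lfaceE; try (by left; rewrite ?addrK);
  [right; exists (vlo (c + 1) d)|right; exists (vlo (c + 1) (d + 1))|
   right; exists (vlo c (d + 1))];
  rewrite ?hadj_hi ?addrK ?corner_lo ?eq_face ?eq_vertex; lia.
Qed.

Lemma corner_share c d p : corner c p -> corner d p -> c != d ->
  exists2 n, hadj p n & corner c n && corner d n.
Proof.
move=> cp dp cd; have : hvertex p by case/and3P: cp.
case/hvertexP=> a [b [pE|pE]]; subst p; move: cp dp cd.
  rewrite !corner_lo => /or3P[]/eqP-> /or3P[]/eqP->; rewrite ?eqxx // => _;
  [exists (vhi (a + 1) b)|exists (vhi a (b + 1))|exists (vhi (a + 1) b)|
   exists (vhi a b)|exists (vhi a (b + 1))|exists (vhi a b)];
  rewrite ?hadj_lo ?corner_hi ?eq_face ?eq_vertex; lia.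
rewrite !corner_hi => /or3P[]/eqP-> /or3P[]/eqP->; rewrite ?eqxx // => _;
[exists (vlo (a - 1) b)|exists (vlo a b)|exists (vlo (a - 1) b)|
 exists (vlo a (b - 1))|exists (vlo a b)|exists (vlo a (b - 1))];
rewrite ?hadj_hi ?corner_lo ?eq_face ?eq_vertex; lia.
Qed.

Definition face_crossing (c s t : point) := crossing (coordx c) (coordy c) s t.

Lemma face_crossing_edge u v : hadj u v -> exists h : point -> int,
  forall s t, hadj s t ->
    face_crossing (lface u v) s t - face_crossing (lface v u) s t
    = traversal u v s t - (h t - h s).
Proof.
have tN x y s t : traversal y x s t = - traversal x y s t.
  by rewrite /traversal opprB.
move=> uv; move: (uv) => /hadjP[] a b;
  rewrite !lfaceE /face_crossing /coordx /coordy /=.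
- by exists (fun=> 0) => s t st; rewrite crossing_xedge // subrr subr0.
- exists (fun=> 0) => s t st.
  by rewrite -opprB crossing_xedge // subrr subr0 -tN.
- exists (beyond a (zigzag_pos (vhi a (b + 1)))) => s t st.
  have h : hadj (vlo a b) (vhi a (b + 1)) by apply/hadjP; constructor.
  have := crossing_zigzag h st erefl.
  have z1 : zigzag_pos (vhi a (b + 1)) = zigzag_pos (vlo a b) + 1.
    by rewrite /zigzag_pos; unfold_lattice; lia.
  by move=> /(_ z1); rewrite /coordx /coordy /= addrK.
- exists (fun p => - beyond a (zigzag_pos (vhi a (b + 1))) p) => s t st.
  have h : hadj (vlo a b) (vhi a (b + 1)) by apply/hadjP; constructor.
  rewrite tN; have := crossing_zigzag h st erefl.
  have z1 : zigzag_pos (vhi a (b + 1)) = zigzag_pos (vlo a b) + 1.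
    by rewrite /zigzag_pos; unfold_lattice; lia.
  move=> /(_ z1); rewrite /coordx /coordy /= addrK; lia.
- exists (fun p => - beyond a (zigzag_pos (vlo a b)) p) => s t st.
  have h : hadj (vhi a b) (vlo a b) by apply/hadjP; constructor.
  rewrite tN; have := crossing_zigzag h st erefl.
  have z1 : zigzag_pos (vlo a b) = zigzag_pos (vhi a b) + 1.
    by rewrite /zigzag_pos; unfold_lattice; lia.
  move=> /(_ z1); rewrite /coordx /coordy /=; lia.
- exists (beyond a (zigzag_pos (vlo a b))) => s t st.
  have h : hadj (vhi a b) (vlo a b) by apply/hadjP; constructor.
  have := crossing_zigzag h st erefl.
  have z1 : zigzag_pos (vlo a b) = zigzag_pos (vhi a b) + 1.
    by rewrite /zigzag_pos; unfold_lattice; lia.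
  by move=> /(_ z1); rewrite /coordx /coordy /=.
Qed.

(** * Jordan curve theorem for lattice cycles *)

Definition cvertex (Z : seq point) (k : nat) : point :=
  nth (0, 0, 0) Z (k %% size Z).

Definition winding (Z : seq point) (c : point) : int :=
  \sum_(0 <= k < size Z) face_crossing c (cvertex Z k) (cvertex Z k.+1).

Definition face_conn (Z : seq point) := clos_refl_trans point (face_step Z).

Definition xedge (Z : seq point) (a b : int) : bool :=
  cycle_edge Z (vlo a b) (vhi (a + 1) b).

Lemma eqn_modSS k l d : (k.+1 == l.+1 %[mod d])%N = (k == l %[mod d])%N.
Proof. by rewrite -(addn1 k) -(addn1 l) eqn_modDr. Qed.

Lemma eqn_mod_window i d k m : (i <= k < i + d)%N -> (i <= m < i + d)%N ->
  (k == m %[mod d])%N = (k == m).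
Proof.
move=> /andP[ik kd] /andP[im md]; rewrite -(subnKC ik) -(subnKC im).
by rewrite eqn_modDl eqn_add2l !modn_small // ltn_subLR.
Qed.

Section Cycle.
Variable Z : seq point.
Hypothesis Zcyc : lattice_cycle Z.
Local Notation n := (size Z).
Local Notation z := (cvertex Z).
Local Notation wind := (winding Z).
Local Notation conn := (face_conn Z).

Lemma size_gt2 : (2 < n)%N. Proof. by case: Zcyc. Qed.

Lemma size_gt0 : (0 < n)%N. Proof. by have := size_gt2; lia. Qed.

Lemma cycle_uniq : uniq Z. Proof. by case: Zcyc => /andP[]. Qed.

Lemma cvertex_in k : z k \in Z.
Proof. by apply: mem_nth; rewrite ltn_mod size_gt0. Qed.

Lemma cvertexD k : z (k + n) = z k.
Proof. by rewrite /cvertex modnDr. Qed.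

Lemma cvertex_inj k l : (z k == z l) = (k == l %[mod n]).
Proof. by rewrite nth_uniq ?ltn_mod ?size_gt0 ?cycle_uniq. Qed.

Lemma cvertexP p : reflect (exists2 k, (k < n)%N & z k = p) (p \in Z).
Proof.
apply: (iffP idP) => [pZ|[k kn <-]]; last exact: cvertex_in.
exists (index p Z); first by rewrite index_mem.
by rewrite /cvertex modn_small ?index_mem // nth_index.
Qed.

Lemma next_cvertex k : next Z (z k) = z k.+1.
Proof.
rewrite next_nth cvertex_in.
have kn : (k %% n < n)%N by rewrite ltn_mod size_gt0.
rewrite {2}/cvertex index_uniq ?cycle_uniq // /cvertex.
rewrite -(addn1 k) -modnDml addn1; move: kn.
case: Z (k %% size Z)%N => [|y s] //= m; rewrite ltnS leq_eqVlt.
case/orP=> [/eqP->|ms]; first by rewrite modnn nth_default.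
by rewrite modn_small //=; apply: set_nth_default.
Qed.

Lemma cvertex_step k : hadj (z k) (z k.+1).
Proof.
by rewrite -next_cvertex; apply: next_cycle (cvertex_in k); case: Zcyc => /andP[].
Qed.

Lemma cycle_edgeP u v :
  reflect (exists2 k, (k < n)%N & (z k = u /\ z k.+1 = v) \/ (z k = v /\ z k.+1 = u))
          (cycle_edge Z u v).
Proof.
apply: (iffP and3P) => [[/cvertexP[k kn <-] /cvertexP[l ln <-]]|].
  rewrite !next_cvertex => /orP[]/eqP <-.
  - by exists k => //; left.
  - by exists l => //; right.
by case=> k kn [[<- <-]|[<- <-]]; rewrite !cvertex_in !next_cvertex eqxx ?orbT.
Qed.

Lemma cycle_edge_cvertex k : cycle_edge Z (z k) (z k.+1).
Proof. by rewrite /cycle_edge !cvertex_in next_cvertex eqxx. Qed.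

Lemma cycle_edge_sym u v : cycle_edge Z u v = cycle_edge Z v u.
Proof. by rewrite /cycle_edge andbCA orbC. Qed.

Lemma traversal_cvertex m k :
  traversal (z m) (z m.+1) (z k) (z k.+1) = Posz (k == m %[mod n]).
Proof.
rewrite /traversal !cvertex_inj.
rewrite eqn_modSS andbb; case: (boolP (k == m.+1 %[mod n])) => /=; last by rewrite subr0.
rewrite -addn1 -(addn1 k) => km.
have -> : (k + 1 == m %[mod n]) = false; last by rewrite subr0.
apply/negP => km2; have : (m + 2 == m + 0 %[mod n]).
  rewrite addn0 -(eqP km2) -(modnDml k) (eqP km) modnDml -addnA; exact: eqxx.
by rewrite eqn_modDl !modn_small ?size_gt2 // size_gt0.
Qed.

Lemma traversal_noncycle u v k : ~~ cycle_edge Z u v ->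
  traversal u v (z k) (z k.+1) = 0.
Proof.
move=> nc; rewrite /traversal.
case: eqP => [ku|_] /=; last case: eqP => [kv|_] //=.
  case: eqP => [k1v|_] /=; first by rewrite -ku -k1v cycle_edge_cvertex in nc.
  case: eqP => //= kv; case: eqP => //= k1u.
  by rewrite -kv -k1u cycle_edge_sym cycle_edge_cvertex in nc.
case: eqP => //= k1u.
by rewrite -kv -k1u cycle_edge_sym cycle_edge_cvertex in nc.
Qed.

Lemma winding_edge u v : hadj u v ->
  wind (lface u v) - wind (lface v u)
  = \sum_(0 <= k < n) traversal u v (z k) (z k.+1).
Proof.
move=> /face_crossing_edge[h hE]; rewrite /winding -sumrB.
under eq_bigr => k _ do rewrite hE ?cvertex_step //.
rewrite sumrB (telescope_sumr (fun k => h (z k))) //.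
by rewrite -(cvertexD 0) add0n subrr subr0.
Qed.

Lemma winding_noncycle u v : hadj u v -> ~~ cycle_edge Z u v ->
  wind (lface u v) = wind (lface v u).
Proof.
move=> uv nc; apply/eqP; rewrite -subr_eq0 winding_edge //.
by rewrite big1 // => k _; rewrite traversal_noncycle.
Qed.

Lemma sum_mod_index i j m : (i <= m < i + n)%N -> (j <= i + n)%N ->
  \sum_(i <= k < j) Posz (k == m %[mod n]) = Posz (m < j)%N.
Proof.
move=> /andP[im mn] jn.
rewrite (eq_big_nat _ _ (F2 := fun k => Posz (k == m))); last first.
  by move=> k /andP[ik kj]; rewrite (@eqn_mod_window i) ?im ?ik ?(leq_trans kj).
case: (ltnP m j) => [mj|jm]; last first.
  rewrite big_nat_cond big1 // => k /andP[/andP[ik kj] _].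
  by rewrite ltn_eqF // (leq_trans kj).
rewrite (bigD1_seq m) /=; last 2 first.
- by rewrite mem_index_iota im.
- exact: iota_uniq.
by rewrite eqxx big1 // => k /negbTE ->.
Qed.

Lemma winding_cycle m : wind (lface (z m) (z m.+1)) = wind (lface (z m.+1) (z m)) + 1.
Proof.
apply/eqP; rewrite addrC -subr_eq winding_edge ?cvertex_step //; apply/eqP.
under eq_bigr => k _ do rewrite traversal_cvertex -(modn_mod m).
by rewrite sum_mod_index ?add0n // ltn_mod ?size_gt0.
Qed.

Lemma face_step_sym c d : face_step Z c d -> face_step Z d c.
Proof. by case=> u [v [? ? ? ?]]; exists u, v. Qed.

Lemma conn_sym c d : conn c d -> conn d c.
Proof.
elim=> [x y /face_step_sym h|x|x y w _ h1 _ h2]; first exact: rt_step.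
  exact: rt_refl.
exact: rt_trans h2 h1.
Qed.

Lemma face_step_cases c d : face_step Z c d -> exists u v,
  [/\ hadj u v, ~~ cycle_edge Z u v, c = lface u v \/ c = lface v u
    & d = lface u v \/ d = lface v u].
Proof.
case=> u [v [uv nc]]; rewrite !corner_edge // => /orP hc /orP hd.
exists u, v; split => //.
- by case: hc => /eqP; [left|right].
- by case: hd => /eqP; [left|right].
Qed.

Lemma conn_winding c d : conn c d -> wind c = wind d.
Proof.
elim=> [{}c {}d|//|x y w _ -> _ -> //].
case/face_step_cases => u [v [uv nc hc hd]].
by case: hc => ->; case: hd => -> //; rewrite (winding_noncycle uv nc).
Qed.

Lemma conn_hface c d : conn c d -> hface c -> hface d.
Proof.
elim=> [x y|x|x y w _ h1 _ h2 hx]; [|by []|exact: h2 (h1 hx)].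
by case=> u [v [_ _ _ /andP[/andP[-> _] _]]].
Qed.

Lemma conn_edge u v : hadj u v -> ~~ cycle_edge Z u v -> conn (lface u v) (lface v u).
Proof.
move=> uv nc; apply: rt_step; exists u, v; split => //.
  exact: corner_lface.
by rewrite andbC corner_lface // hadj_sym.
Qed.

Lemma conn_lface k : conn (lface (z k) (z k.+1)) (lface (z k.+1) (z k.+2)).
Proof.
have h02 : z k != z k.+2.
  rewrite cvertex_inj -addn2 -{1}(addn0 k) eqn_modDl !modn_small ?size_gt2 //.
  exact: size_gt0.
case: (turn_lface (cvertex_step k) (cvertex_step k.+1) h02) => [->|]; first exact: rt_refl.
case=> m /and3P[km m0 m2] /andP[c1 c2]; apply: rt_step; exists (z k.+1), m.
have /andP[_ d1] := corner_lface (cvertex_step k).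
have /andP[d2 _] := corner_lface (cvertex_step k.+1).
split; rewrite ?c1 ?c2 ?d1 ?d2 //.
rewrite /cycle_edge cvertex_in next_cvertex /= (eq_sym _ m) (negbTE m2) /=.
apply/negP => /andP[/cvertexP[l _ lm]]; subst m; rewrite next_cvertex.
move: m0; rewrite !cvertex_inj eqn_modSS => h1 h2; by rewrite h2 in h1.
Qed.

Lemma conn_rface k : conn (lface (z k.+1) (z k)) (lface (z k.+2) (z k.+1)).
Proof.
have h02 : z k.+2 != z k.
  rewrite cvertex_inj -addn2 -{2}(addn0 k) eqn_modDl !modn_small ?size_gt2 //.
  exact: size_gt0.
have s1 := cvertex_step k; have s2 := cvertex_step k.+1.
rewrite hadj_sym in s1; rewrite hadj_sym in s2.
apply: conn_sym.
case: (turn_lface s2 s1 h02) => [->|]; first exact: rt_refl.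
case=> m /and3P[km m0 m2] /andP[c1 c2]; apply: rt_step; exists (z k.+1), m.
have /andP[_ d1] := corner_lface s2.
have /andP[d2 _] := corner_lface s1.
split; rewrite ?c1 ?c2 ?d1 ?d2 //.
rewrite /cycle_edge cvertex_in next_cvertex /= (eq_sym _ m) (negbTE m0) /=.
apply/negP => /andP[/cvertexP[l _ lm]]; subst m; rewrite next_cvertex.
move: m2; rewrite !cvertex_inj eqn_modSS => h1 h2; by rewrite h2 in h1.
Qed.

Lemma conn_lface_all k l : conn (lface (z k) (z k.+1)) (lface (z l) (z l.+1)).
Proof.
have h m : conn (lface (z 0) (z 1)) (lface (z m) (z m.+1)).
  elim: m => [|m IH]; [exact: rt_refl|exact: rt_trans IH (conn_lface m)].
exact: rt_trans (conn_sym (h k)) (h l).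
Qed.

Lemma conn_rface_all k l : conn (lface (z k.+1) (z k)) (lface (z l.+1) (z l)).
Proof.
have h m : conn (lface (z 1) (z 0)) (lface (z m.+1) (z m)).
  elim: m => [|m IH]; [exact: rt_refl|exact: rt_trans IH (conn_rface m)].
exact: rt_trans (conn_sym (h k)) (h l).
Qed.
End Cycle.

Definition escapes (Z : seq point) (c : point) : Prop :=
  exists a b, forall b' : int, b <= b' -> face_conn Z c (face a b').

(* 1 when Z is run through counterclockwise, -1 when it is clockwise. *)
Definition orientation (Z : seq point) : int :=
  2 * winding Z (lface (cvertex Z 0) (cvertex Z 1)) - 1.

Lemma seq_bounded (s : seq point) : exists2 N : int, 0 <= N &
  forall p, p \in s -> [&& `|coordx p| <= N, `|coordy p| <= N & `|coordz p| <= N].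
Proof.
elim: s => [|p s [N N0 IH]]; first by exists 0.
exists (N + `|coordx p| + `|coordy p| + `|coordz p|); first lia.
move=> q; rewrite inE => /orP[/eqP->|/IH]; lia.
Qed.

Lemma first_int (P : pred int) (b c : int) :
  (forall b' : int, c < b' -> ~~ P b') ->
  (forall b' : int, b < b' -> ~~ P b') \/
  exists b' : int, [/\ b < b', P b' & forall b'' : int, b < b'' < b' -> ~~ P b''].
Proof.
move=> Pc; case: (boolP (has (fun i : nat => P (b + 1 + i%:Z)) (iota 0 (absz (c - b)%R)))).
  move=> /hasP ex; right.
  have {}ex : exists i : nat, P (b + 1 + i%:Z) by case: ex => i _ h; exists i.
  case: (ex_minnP ex) => i Pi imin; exists (b + 1 + i%:Z); split => //; first lia.
  move=> b'' hb; apply/negP => Pb; have := imin (absz (b'' - (b + 1))%R).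
  have -> : b + 1 + (absz (b'' - (b + 1))%R) = b'' by lia.
  by move=> /(_ Pb); lia.
move=> /hasPn nP; left => b' bb'; case: (ltP c b') => [/Pc //|b'c].
have := nP (absz (b' - (b + 1))%R); rewrite mem_iota => /(_ ltac:(lia)).
by have -> : b + 1 + (absz (b' - (b + 1))%R) = b' by lia.
Qed.

Section Jordan.
Variable Z : seq point.
Hypothesis Zcyc : lattice_cycle Z.
Local Notation n := (size Z).
Local Notation z := (cvertex Z).
Local Notation wind := (winding Z).
Local Notation conn := (face_conn Z).
Local Notation xedge := (xedge Z).

Lemma hadj_xedge a b : hadj (vlo a b) (vhi (a + 1) b).
Proof. by apply/hadjP; constructor. Qed.

Lemma xedge_bounded : exists2 N : int, 0 <= N & forall a b, xedge a b -> `|b| <= N.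
Proof.
have [N N0 hN] := seq_bounded Z; exists N => // a b /and3P[aZ _ _].
by have /and3P[] := hN _ aZ.
Qed.

Lemma next_xedge a b :
  (forall b' : int, b < b' -> ~~ xedge a b') \/
  exists b' : int, [/\ b < b', xedge a b' & forall b'' : int, b < b'' < b' -> ~~ xedge a b''].
Proof.
have [N _ hN] := xedge_bounded; apply: (@first_int _ _ N) => b' Nb.
by apply/negP => /hN; lia.
Qed.

Lemma conn_right a b : ~~ xedge a b -> conn (face a (b - 1)) (face a b).
Proof. by move=> nx; have := conn_edge (hadj_xedge a b) nx; rewrite !lfaceE. Qed.

Lemma conn_run a b b' : b <= b' -> (forall b'' : int, b < b'' <= b' -> ~~ xedge a b'') ->
  conn (face a b) (face a b').
Proof.
move=> bb'; have {bb'} -> : b' = b + (absz (b' - b)%R) by lia.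
elim: (absz (b' - b)%R) => [|m IH] nx; first by rewrite addr0; apply: rt_refl.
apply: rt_trans (IH _) _ => [b'' hb|]; first by apply: nx; lia.
have := @conn_right a (b + m.+1%:Z).
have -> : b + m.+1%:Z - 1 = b + m%:Z by lia.
by apply; apply: nx; lia.
Qed.

Lemma xedge_index a b : xedge a b -> exists2 k, (k < n)%N &
  (z k = vlo a b /\ z k.+1 = vhi (a + 1) b) \/
  (z k = vhi (a + 1) b /\ z k.+1 = vlo a b).
Proof. by move=> /(cycle_edgeP Zcyc). Qed.

Lemma last_xedge a b : xedge a b ->
  exists2 b' : int, xedge a b' & forall b'' : int, b' < b'' -> ~~ xedge a b''.
Proof.
have [N N0 hN] := xedge_bounded; have [m] := ubnP (absz (N - b)%R).
elim: m => // m IH in b * => bm xb.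
have [no|[b' [bb' xb' _]]] := next_xedge a b; first by exists b.
apply: (IH b') => //; have := hN _ _ xb; have := hN _ _ xb'; lia.
Qed.

Lemma crossing_xedge_exists a b k : crossing a b (z k) (z k.+1) != 0 ->
  exists2 b' : int, b < b' & xedge a b'.
Proof.
rewrite /crossing /xedge; case: ifP => // /andP[/eqP] + + _.
have := cycle_edge_cvertex Zcyc k.
move: (cvertex_step Zcyc k) => /hadjP[] c d; rewrite /coordx /coordy /=; try lia.
- by move=> h1 h2 h3; exists d => //; have -> : a = c by lia.
- by rewrite cycle_edge_sym => h1 h2 h3; exists d => //; have -> : a = c by lia.
Qed.

Lemma winding_far a b : (forall b' : int, b < b' -> ~~ xedge a b') -> wind (face a b) = 0.
Proof.
move=> no; rewrite /winding big1 // => k _; apply/eqP; apply: contraT.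
by move=> /crossing_xedge_exists[b' /no /negbTE->].
Qed.

Lemma escapes_run a b : (forall b' : int, b < b' -> ~~ xedge a b') -> escapes Z (face a b).
Proof.
move=> no; exists a, b => b' bb'; apply: conn_run => // b'' /andP[h _].
exact: no.
Qed.

Lemma conn_escapes c d : conn c d -> escapes Z d -> escapes Z c.
Proof.
by move=> cd [a [b h]]; exists a, b => b' /h; apply: rt_trans.
Qed.

Lemma escapes_winding c : escapes Z c -> wind c = 0.
Proof.
case=> a [b h]; have [N N0 hN] := xedge_bounded.
have /(conn_winding Zcyc) -> : conn c (face a (b + `|b| + N)) by apply: h; lia.
by apply: winding_far => b' hb; apply/negP => /hN; lia.
Qed.

Lemma xedge_faces a b : xedge a b -> exists k,
  (face a (b - 1) = lface (z k) (z k.+1) /\ face a b = lface (z k.+1) (z k)) \/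
  (face a (b - 1) = lface (z k.+1) (z k) /\ face a b = lface (z k) (z k.+1)).
Proof.
case/xedge_index=> k _ [] [h1 h2]; exists k; rewrite h1 h2 !lfaceE.
- by left.
- by right.
Qed.

Lemma face_trichotomy c : hface c ->
  [\/ escapes Z c, exists k, conn c (lface (z k) (z k.+1)) |
      exists k, conn c (lface (z k.+1) (z k))].
Proof.
move=> /hfaceE ->; move: (coordx c) (coordy c) => a b.
have [no|[b' [bb' xb' no]]] := next_xedge a b.
  by constructor 1; apply: escapes_run.
have h : conn (face a b) (face a (b' - 1)).
  by apply: conn_run => [|b'' hb]; [lia|apply: no; lia].
have [k [] [hk _]] := xedge_faces xb'.
- by constructor 2; exists k; rewrite -hk.
- by constructor 3; exists k; rewrite -hk.
Qed.

Lemma winding_neq0_xedge c : wind c != 0 -> exists b, xedge (coordx c) b.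
Proof.
move=> w; case: (boolP [exists k : 'I_n, face_crossing c (z k) (z k.+1) != 0]).
  by case/existsP=> k /crossing_xedge_exists[b' _]; exists b'.
rewrite negb_exists => /forallP h; case/negP: w; apply/eqP.
rewrite /winding big_mkord big1 // => k _; apply/eqP; have := h k.
by rewrite negbK.
Qed.

Lemma boundary_escapes :
  (forall k, escapes Z (lface (z k) (z k.+1))) \/
  (forall k, escapes Z (lface (z k.+1) (z k))).
Proof.
have [a [b xb]] : exists a b, xedge a b.
  have := winding_cycle Zcyc 0.
  case: (eqVneq (wind (lface (z 1) (z 0))) 0) => [-> w|w _].
    have /winding_neq0_xedge[b xb] : wind (lface (z 0) (z 1)) != 0 by rewrite w.
    by exists (coordx (lface (z 0) (z 1))), b.
  by have [b xb] := winding_neq0_xedge w; exists (coordx (lface (z 1) (z 0))), b.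
have [b' xb' no] := last_xedge xb; have /escapes_run e := no.
have [k [] [_ hk]] := xedge_faces xb'; rewrite hk in e.
- by right=> l; apply: conn_escapes e; apply: conn_rface_all.
- by left=> l; apply: conn_escapes e; apply: conn_lface_all.
Qed.

Lemma orientation_lface k : 2 * wind (lface (z k) (z k.+1)) = orientation Z + 1.
Proof.
by rewrite /orientation (conn_winding Zcyc (conn_lface_all Zcyc k 0)) addrNK.
Qed.

Lemma orientation_rface k : 2 * wind (lface (z k.+1) (z k)) = orientation Z - 1.
Proof.
have := winding_cycle Zcyc k; have := orientation_lface k; lia.
Qed.

Lemma orientation_cases : orientation Z = 1 \/ orientation Z = - 1.
Proof.
case: boundary_escapes => /(_ 0%N)/escapes_winding w.
- by right; have := orientation_lface 0; rewrite w; lia.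
- by left; have := orientation_rface 0; rewrite w; lia.
Qed.

Lemma winding_cases c : hface c -> wind c = 0 \/ wind c = orientation Z.
Proof.
case/face_trichotomy => [/escapes_winding|[k ck]|[k ck]]; last 2 first.
- rewrite (conn_winding Zcyc ck).
  have := orientation_lface k; have := orientation_cases; lia.
- rewrite (conn_winding Zcyc ck).
  have := orientation_rface k; have := orientation_cases; lia.
- by left.
Qed.

Lemma winding0_escapes c : hface c -> wind c = 0 -> escapes Z c.
Proof.
move=> hc w; case: (face_trichotomy hc) => [//|[k ck]|[k ck]];
  apply: (conn_escapes ck); move/(conn_winding Zcyc): ck; rewrite w => wk.
- case: boundary_escapes => [//|/(_ k)/escapes_winding w0].
  by have := winding_cycle Zcyc k; rewrite w0 -wk.
- case: boundary_escapes => [/(_ k)/escapes_winding w0|//].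
  by have := winding_cycle Zcyc k; rewrite w0 -wk.
Qed.

Lemma winding_left (a b : int) : (forall k, b < coordy (z k)) -> wind (face a b) = 0.
Proof.
move=> hb; pose h k := Posz (a < coordx (z k))%R.
rewrite /winding (eq_bigr (fun k => h k.+1 - h k)).
  by rewrite telescope_sumr // /h -(cvertexD Z 0) add0n subrr.
move=> k _; rewrite /face_crossing /crossing /h hb andbT.
move: (cvertex_step Zcyc k) => /hadjP[] c d; rewrite /coordx /=; case: ifP; lia.
Qed.

Lemma winding_bounded : exists2 N : int, 0 <= N & forall c, hface c -> wind c != 0 ->
  [/\ `|coordx c| <= N, `|coordy c| <= N & `|coordz c| <= N].
Proof.
have [N N0 hN] := seq_bounded Z; exists (2 * N + 4); first lia.
move=> c /hfaceE ->; move: (coordx c) (coordy c) => a b w.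
have [b' ab'] := winding_neq0_xedge w.
have aN : `|a| <= N by move: ab' => /and3P[/hN/and3P[]].
have b_lt : b < N.
  rewrite ltNge; apply: contra w => Nb; apply/eqP; apply: winding_far => b'' hb.
  by apply/negP => /and3P[/hN/and3P[_ + _] _ _]; rewrite /coordy /=; lia.
have b_ge : - N - 1 <= b.
  rewrite leNgt; apply: contra w => Nb; apply/eqP; apply: winding_left => k.
  by have /and3P[_ + _] := hN _ (cvertex_in Zcyc k); lia.
by rewrite /coordx /coordy /coordz /=; split; lia.
Qed.

Lemma interior_winding c : hface c -> interior_face Z c <-> wind c = orientation Z.
Proof.
move=> hc; split=> [[_ [N hN]]|w].
  case: (winding_cases hc) => // /(winding0_escapes hc)[a [b h]].
  have /hN[_ + _] : conn c (face a (b + `|b| + `|N| + 1)) by apply: h; lia.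
  by rewrite /coordy /=; lia.
split=> //; have [N N0 hN] := winding_bounded; exists N => d cd.
have /hN := conn_hface cd hc; rewrite -(conn_winding Zcyc cd) w; apply.
by have := orientation_cases; lia.
Qed.
End Jordan.

(** * Counting vertices on a side *)

Definition inner (Z : seq point) (c : point) : bool :=
  hface c && (winding Z c == orientation Z).

Definition vfaces (p : point) : seq point :=
  let: (x, y, _) := p in
  if coord_sum p == 0 then [:: face x y; face x (y - 1); face (x - 1) y]
  else [:: face (x - 1) y; face (x - 1) (y - 1); face x (y - 1)].

(* The face after the edge at p that changes the first coordinate, in the row of that
   edge. *)
Definition right_face (p : point) : point :=
  face (coordx p - coord_sum p) (coordy p).

(* Each face is cut along its line into a lower half, whose corners have the
   first coordinate of the face, and an upper half; true denotes the latter. *)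
Definition half (c p : point) : bool := coordx p != coordx c.

Lemma vlo_sum a b : coord_sum (vlo a b) = 0.
Proof. by unfold_lattice; lia. Qed.

Lemma vhi_sum a b : coord_sum (vhi a b) = 1.
Proof. by unfold_lattice; lia. Qed.

Lemma corner_vfaces c p : hvertex p -> corner c p = (c \in vfaces p).
Proof.
case/hvertexP=> a [b [->|->]].
- by rewrite corner_lo /vfaces {1}/vlo vlo_sum eqxx !inE.
- by rewrite corner_hi /vfaces {1}/vhi vhi_sum !inE.
Qed.

Lemma corner_hvertex c p : corner c p -> hvertex p.
Proof. by case/and3P. Qed.

Lemma corner_hface c p : corner c p -> hface c.
Proof. by case/and3P. Qed.

Lemma corner_right_face p : hvertex p -> corner (right_face p) p.
Proof.
case/hvertexP=> a [b [->|->]]; rewrite /right_face ?vlo_sum ?vhi_sum.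
- by rewrite corner_lo subr0 eqxx.
- by rewrite corner_hi eqxx.
Qed.

Section Inner.
Variable Z : seq point.
Hypothesis Zcyc : lattice_cycle Z.
Local Notation n := (size Z).
Local Notation z := (cvertex Z).
Local Notation wind := (winding Z).
Local Notation eps := (orientation Z).

Lemma interior_inner c : interior_face Z c <-> inner Z c.
Proof.
rewrite /inner; case: (boolP (hface c)) => [hc|hc] /=.
  by rewrite (interior_winding Zcyc hc); split=> /eqP.
by split=> // -[]; rewrite (negbTE hc).
Qed.

Lemma inner_neg c : hface c -> ~~ inner Z c -> wind c = 0.
Proof.
rewrite /inner => hc; rewrite hc /= => /eqP w.
by case: (winding_cases Zcyc hc).
Qed.

Lemma inner_lface k : inner Z (lface (z k) (z k.+1)) = (eps == 1).
Proof.
rewrite /inner hface_lface /=; have := orientation_lface Zcyc k; lia.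
Qed.

Lemma inner_rface k : inner Z (lface (z k.+1) (z k)) = (eps == - 1).
Proof.
rewrite /inner hface_lface /=; have := orientation_rface Zcyc k; lia.
Qed.

Lemma inner_share c d p : corner c p -> corner d p -> c != d ->
  inner Z c -> inner Z d ->
  exists q, [/\ hadj p q, ~~ cycle_edge Z p q &
    (c = lface p q /\ d = lface q p) \/ (c = lface q p /\ d = lface p q)].
Proof.
move=> cp dp cd /andP[_ /eqP wc] /andP[_ /eqP wd].
have [q pq /andP[cq dq]] := corner_share cp dp cd; exists q.
have := corner_edge c pq; rewrite cp cq => /esym/orP hc.
have := corner_edge d pq; rewrite dp dq => /esym/orP hd.
have hcd : (c = lface p q /\ d = lface q p) \/ (c = lface q p /\ d = lface p q).
  move: cd; case: hc => /eqP->; case: hd => /eqP->; rewrite ?eqxx // => _; auto.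
split=> //; apply/negP => /(cycle_edgeP Zcyc)[k _ hk].
have := winding_cycle Zcyc k.
by case: hk => -[hp hq]; rewrite hp hq;
  case: hcd => -[h1 h2]; rewrite -h1 -h2 wc wd; lia.
Qed.

Lemma vertex_inner p :
  vertex_on_or_inside Z p <-> exists2 c, corner c p & inner Z c.
Proof.
split=> [[hp [/(cvertexP Zcyc)[k _ <-]|h]]|[c cp ci]].
- have /andP[h1 _] := corner_lface (cvertex_step Zcyc k).
  have := cvertex_step Zcyc k; rewrite hadj_sym => /corner_lface/andP[_ h2].
  case: (orientation_cases Zcyc) => h.
  + by exists (lface (z k) (z k.+1)) => //; rewrite inner_lface h.
  + by exists (lface (z k.+1) (z k)) => //; rewrite inner_rface h.
- exists (right_face p); first exact: corner_right_face.
  by apply/interior_inner/h/corner_right_face.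
split; first exact: corner_hvertex cp.
case: (boolP (p \in Z)) => pZ; [by left|right=> d dp]; apply/interior_inner.
case: (eqVneq c d) => [<-//|cd].
have [q pq /andP[cq dq]] := corner_share cp dp cd.
have /(conn_winding Zcyc) : face_conn Z c d.
  apply: rt_step; exists p, q; split; rewrite ?cp ?cq ?dp ?dq //.
  by rewrite /cycle_edge (negbTE pZ).
by move: ci; rewrite /inner (corner_hface dp) => /andP[_ /eqP-> <-]; rewrite eqxx.
Qed.

Lemma edge_inner u v : edge_on_or_inside Z u v <->
  hadj u v /\ (inner Z (lface u v) || inner Z (lface v u)).
Proof.
rewrite /edge_on_or_inside; case: (boolP (hadj u v)) => uv; last by split=> -[].
case: (boolP (cycle_edge Z u v)) => [ce|nc].
  split=> _; split=> //; last by left.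
  case/(cycle_edgeP Zcyc): (ce) => k _ [[<- <-]|[<- <-]];
  by rewrite inner_lface inner_rface; have := orientation_cases Zcyc; lia.
have w := winding_noncycle Zcyc uv nc; split=> -[_ h]; split=> //.
  case: h => // h; apply/orP; left; apply/interior_inner.
  by have /andP[h1 h2] := corner_lface uv; apply: h.
have {}h : inner Z (lface u v) && inner Z (lface v u).
  by move: h; rewrite /inner !hface_lface w orbb => ->.
right=> c cu cv; apply/interior_inner.
have := corner_edge c uv; rewrite cu cv => /esym/orP.
by case/andP: h => h1 h2 [] /eqP->.
Qed.
End Inner.

Definition centred_range (M : nat) : seq int :=
  [seq k%:Z - M%:Z | k <- iota 0 (2 * M)].

Lemma mem_centred_range M x : (x \in centred_range M) = (- M%:Z <= x < M%:Z).
Proof.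
apply/mapP/idP => [[k]|h]; first by rewrite mem_iota => h ->; lia.
by exists (absz (x + M%:Z)%R); [rewrite mem_iota|]; lia.
Qed.

Lemma centred_range_uniq M : uniq (centred_range M).
Proof. by rewrite map_inj_uniq ?iota_uniq // => k l; lia. Qed.

Lemma sum_centred_range_lt M (y : int) : `|y| <= M%:Z ->
  \sum_(b <- centred_range M) Posz (b < y)%R = y + M%:Z.
Proof.
move=> hy; rewrite big_map.
have -> : y + M%:Z = Posz (absz (y + M%:Z)%R) by lia.
rewrite (eq_bigr (fun k => Posz (k < absz (y + M%:Z)%R)%N)); last first.
  by move=> k _; congr Posz; lia.
have : (absz (y + M%:Z)%R <= 2 * M)%N by lia.
elim: (2 * M)%N (absz (y + M%:Z)%R) => [|m IH] w.
  by rewrite big_nil; case: w.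
rewrite -(addn1 m) iotaD big_cat /= big_seq1 add0n leq_eqVlt => /orP[/eqP->|wm].
  rewrite addn1 ltnSn (eq_big_seq (fun k => Posz (k < m)%N)).
    by rewrite IH //; lia.
  by move=> k; rewrite mem_iota => km; congr Posz; lia.
rewrite addn1 ltnS in wm; rewrite IH // ltnNge wm; lia.
Qed.

Lemma sum_centred_range_eq M (a c : int) : - M%:Z <= a < M%:Z ->
  \sum_(b <- centred_range M) (if b == a then c else 0) = c.
Proof.
move=> h; rewrite (bigD1_seq a) ?centred_range_uniq ?mem_centred_range //= eqxx.
by rewrite big1 ?addr0 // => b /negbTE->.
Qed.

Lemma sum_crossing M s t : hadj s t ->
  `|coordx s| < M%:Z -> `|coordx t| < M%:Z -> `|coordy s| <= M%:Z ->
  \sum_(a <- centred_range M) \sum_(b <- centred_range M) crossing a b s t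
  = (coordx t - coordx s) * (coordy s + M%:Z).
Proof.
move=> st xs xt ys.
pose m := Num.min (coordx s) (coordx t).
rewrite (eq_bigr (fun a => if a == m then
  (coordx t - coordx s) * (coordy s + M%:Z) else 0)).
  by rewrite sum_centred_range_eq // /m minElt; case: ifP; lia.
move=> a _; have aE : coordx s != coordx t ->
    (coordx s + coordx t == 2 * a + 1) = (a == m).
  by move/hadjP: st; rewrite /m minElt; case=> c d; unfold_lattice; case: ifP; lia.
case: (eqVneq (coordx s) (coordx t)) => [xE|/aE {}aE].
  rewrite xE subrr mul0r if_same big1 // => b _; rewrite /crossing ifF //.
  by apply/negbTE; rewrite negb_and; apply/orP; left; lia.
rewrite /crossing aE; case: eqP => _ /=; last by rewrite big1.
rewrite -sum_centred_range_lt // mulr_sumr; apply: eq_bigr => b _.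
by case: ifP => _; rewrite ?mulr1 ?mulr0.
Qed.

Record embeds (Z : seq point) (T : finType) (e : rel T) (pos : T -> point) : Prop :=
  Embeds {
    embeds_cycle : lattice_cycle Z;
    embeds_inj : injective pos;
    embeds_vertex : forall p, vertex_on_or_inside Z p <-> exists x, pos x = p;
    embeds_edge : forall u v, e u v <-> edge_on_or_inside Z (pos u) (pos v)
  }.

Definition turn (s m q : point) : int :=
  let d := coordx q - coordx s in
  d + (1 - d ^+ 2) * (coordy q - coordy s) * (2 * coord_sum m - 1).

(* Twice the number of vertices on one side of a cut, minus the length of its
   boundary arc, is the sum of the vertex weights along that arc, up to the sign given
   by the orientation of Z. *)
Definition vweight (s m q : point) : int :=
  2 * (coordx q - coordx s) * coordy m + turn s m q.

Lemma right_face_turn s m q : hadj s m -> hadj m q -> s != q ->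
  (turn s m q = - 1 /\ (right_face m = lface s m \/ right_face m = lface m q)) \/
  (turn s m q = 1 /\ (right_face m = lface m s \/ right_face m = lface q m)).
Proof.
have faceE a b a' b' : a = a' -> b = b' -> face a b = face a' b' by move=> -> ->.
move=> sm mq; have : hvertex m by case/and3P: mq.
case/hvertexP=> a [b [mE|mE]]; subst m; move: sm mq; rewrite hadj_sym.
  rewrite !hadj_lo => /or3P[]/eqP-> /or3P[]/eqP->; rewrite ?eqxx // => _;
  rewrite !lfaceE /turn /right_face vlo_sum /coordx /coordy /=;
  (left; split; [lia|by [left; apply: faceE; lia|right; apply: faceE; lia]]) ||
  (right; split; [lia|by [left; apply: faceE; lia|right; apply: faceE; lia]]).
have [c ->] : exists c, a = c + 1 by exists (a - 1); lia.
have [d ->] : exists d, b = d + 1 by exists (b - 1); lia.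
rewrite !hadj_hi !addrK => /or3P[]/eqP-> /or3P[]/eqP->; rewrite ?eqxx // => _;
  rewrite !lfaceE /turn /right_face vhi_sum /coordx /coordy /=;
  (left; split; [lia|by [left; apply: faceE; lia|right; apply: faceE; lia]]) ||
  (right; split; [lia|by [left; apply: faceE; lia|right; apply: faceE; lia]]).
Qed.

(* The value of a side function on a half-face tells on which side of a
   separating curve it lies: orientation Z on one side, 0 on the other and
   outside Z. *)
Record side_function (Z : seq point) (S : point -> bool -> int) : Prop :=
  SideFunction {
    side_values : forall c t, hface c -> S c t = 0 \/ S c t = orientation Z;
    side_outer : forall c t, hface c -> winding Z c = 0 -> S c t = 0;
    side_edge : forall p q, hadj p q -> ~~ cycle_edge Z p q ->
      S (lface p q) (half (lface p q) p) = S (lface q p) (half (lface q p) p)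
  }.

Definition side (Z : seq point) (S : point -> bool -> int) (p : point) : bool :=
  has (fun c => S c (half c p) == orientation Z) (vfaces p).

Lemma sum_period (f : nat -> int) d i : (forall k, f (k + d)%N = f k) ->
  \sum_(i <= k < i + d) f k = \sum_(0 <= k < d) f k.
Proof.
move=> fd; elim: i => [|i IH]; first by rewrite add0n.
rewrite -IH; case: d fd {IH} => [|d] fd; first by rewrite !addn0 !big_geq.
rewrite addSn big_nat_recr /=; last by lia.
by rewrite [RHS]big_ltn ?fd; [rewrite addrC|lia].
Qed.

Lemma Posz_count (A : Type) (P : pred A) (s : seq A) :
  Posz (count P s) = \sum_(p <- s) Posz (P p).
Proof. by elim: s => [|p s IH]; rewrite ?big_nil // big_cons -IH -PoszD. Qed.

Section Counting.
Variables (Z : seq point) (T : finType) (e : rel T) (pos : T -> point).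
Hypothesis emb : embeds Z e pos.
Local Notation n := (size Z).
Local Notation z := (cvertex Z).
Local Notation wind := (winding Z).
Local Notation eps := (orientation Z).

Let Zcyc : lattice_cycle Z := embeds_cycle emb.

Section Side.
Variable S : point -> bool -> int.
Hypothesis HS : side_function Z S.

Lemma side_inner c p : corner c p -> inner Z c ->
  side Z S p = (S c (half c p) == eps).
Proof.
move=> cp ci; have hp := corner_hvertex cp.
apply/hasP/idP => [[d]|h]; last by exists c => //; rewrite -corner_vfaces.
rewrite -corner_vfaces // => dp Sd; have hd := corner_hface dp.
have di : inner Z d.
  apply: contraT => /(inner_neg Zcyc hd) wd.
  by move: Sd; rewrite (side_outer HS) //; have := orientation_cases Zcyc; lia.
case: (eqVneq c d) => [->//|cd].
have [q [pq nc [] [cE dE]]] := inner_share Zcyc cp dp cd ci di.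
- by rewrite cE (side_edge HS) // -dE.
- by rewrite cE -(side_edge HS) // -dE.
Qed.

Lemma side_vertex p : hvertex p -> side Z S p -> vertex_on_or_inside Z p.
Proof.
move=> hp /hasP[c]; rewrite -corner_vfaces // => cp Sc.
apply/(vertex_inner Zcyc); exists c => //; apply: contraT => ni.
move: Sc; rewrite (side_outer HS) ?(inner_neg Zcyc) ?(corner_hface cp) //.
by have := orientation_cases Zcyc; lia.
Qed.

Let pts : seq point := [seq pos x | x <- enum T].

Let pts_uniq : uniq pts.
Proof. by rewrite map_inj_uniq ?enum_uniq //; apply: embeds_inj emb. Qed.

Let mem_pts p : p \in pts <-> vertex_on_or_inside Z p.
Proof.
rewrite (embeds_vertex emb); split=> [/mapP[x _ ->]|[x <-]]; first by exists x.
by rewrite map_f ?mem_enum.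
Qed.

Let card_pts (P : pred point) : #|[set x | P (pos x)]| = count P pts.
Proof.
rewrite /pts count_map enumT -size_filter cardsE cardE /enum_mem.
by congr size; apply: eq_filter.
Qed.

Lemma count_outer : count (fun p => side Z S p && ~~ inner Z (right_face p)) pts
  = count (fun p => side Z S p && ~~ inner Z (right_face p)) Z.
Proof.
rewrite -!size_filter; apply: perm_size; apply: uniq_perm.
- by rewrite filter_uniq.
- by rewrite filter_uniq // cycle_uniq.
move=> p; rewrite !mem_filter; case: (boolP (side Z S p)) => //= sp.
case: (boolP (inner Z (right_face p))) => //= ri; apply/idP/idP.
  case/mem_pts => hp [//|h]; case/negP: ri; apply/(interior_inner Zcyc)/h.
  exact: corner_right_face.
case/(cvertexP Zcyc)=> k _ <-; apply/mem_pts; split; last by left; apply: cvertex_in.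
by have /and3P[] := cvertex_step Zcyc k.
Qed.

Lemma count_inner (M : nat) :
  (forall c, inner Z c -> (`|coordx c| < M%:Z) && (`|coordy c| < M%:Z)) ->
  Posz (count (fun p => side Z S p && inner Z (right_face p)) pts) =
  \sum_(a <- centred_range M) \sum_(b <- centred_range M)
    eps * (S (face a b) false + S (face a b) true).
Proof.
move=> hM; pose r := centred_range M.
pose P p := S (right_face p) (half (right_face p) p) == eps.
have Pi p : P p -> inner Z (right_face p).
  rewrite /P => h; apply: contraT => ni; move: h.
  rewrite (side_outer HS) ?(inner_neg Zcyc) ?hface_face //.
  by have := orientation_cases Zcyc; lia.
pose box := [seq vlo a b | a <- r, b <- r] ++ [seq vhi (a + 1) b | a <- r, b <- r].
have -> : count (fun p => side Z S p && inner Z (right_face p)) pts = count P box.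
  rewrite -!size_filter; apply: perm_size; apply: uniq_perm.
  - by rewrite filter_uniq.
  - rewrite filter_uniq // cat_uniq !allpairs_uniq ?centred_range_uniq //=.
    + rewrite andbT; apply/hasPn => p /allpairsP[[a b] [_ _ ->]] /=.
      by apply/allpairsP => -[[c d] [_ _ /eqP]]; rewrite eq_vertex.
    + move=> [a b] [c d] _ _ /= /eqP; rewrite eq_vertex => h.
      by congr (_, _); lia.
    + move=> [a b] [c d] _ _ /= /eqP; rewrite eq_vertex => /andP[/eqP-> /eqP->] //.
  move=> p; rewrite !mem_filter; apply/idP/idP.
  - case/andP=> /andP[sp ri] /mem_pts[hp _].
    have cr := corner_right_face hp.
    rewrite (side_inner cr ri) in sp; rewrite /P sp /=.
    move: ri => /hM; rewrite mem_cat; case/hvertexP: hp => a [b [->|->]];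
    rewrite /right_face ?vlo_sum ?vhi_sum /coordx /coordy /= => ri; apply/orP.
    + left; apply/allpairsP; exists (a, b).
      by rewrite !mem_centred_range /=; split=> //; lia.
    + right; apply/allpairsP; exists (a - 1, b).
      by rewrite !mem_centred_range /= subrK; split=> //; lia.
  - case/andP=> Pp pb; have ri := Pi p Pp.
    have hp : hvertex p.
      move: pb; rewrite mem_cat => /orP[]/allpairsP[[a b] [_ _ ->]] /=.
      * by apply/hvertexP; exists a, b; left.
      * by apply/hvertexP; exists (a + 1), b; right.
    have cr := corner_right_face hp.
    have sp : side Z S p by rewrite (side_inner cr ri).
    by rewrite sp ri /=; apply/mem_pts/side_vertex.
rewrite count_cat PoszD.
have cE s : Posz (count P s) = \sum_(p <- s) eps * S (right_face p) (half (right_face p) p).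
  rewrite Posz_count; apply: eq_bigr => p _; rewrite /P.
  have := @side_values _ _ HS (right_face p) (half (right_face p) p) (hface_face _ _).
  by case=> ->; have [] := orientation_cases Zcyc => ->.
rewrite !cE !big_allpairs_dep -big_split /=; apply: eq_bigr => a _.
rewrite -big_split /=; apply: eq_bigr => b _.
rewrite /right_face vlo_sum vhi_sum mulrDr subr0 /half /coordx /coordy /= addrK eqxx.
by congr (_ + _ * S _ _); lia.
Qed.

Lemma card_side (M : nat) :
  (forall c, inner Z c -> (`|coordx c| < M%:Z) && (`|coordy c| < M%:Z)) ->
  Posz #|[set x | side Z S (pos x)]| =
  \sum_(a <- centred_range M) \sum_(b <- centred_range M)
    eps * (S (face a b) false + S (face a b) true)
  + \sum_(0 <= k < n) Posz (side Z S (z k) && ~~ inner Z (right_face (z k))).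
Proof.
move=> hM; rewrite card_pts -(count_inner hM).
have -> : \sum_(0 <= k < n) Posz (side Z S (z k) && ~~ inner Z (right_face (z k)))
    = Posz (count (fun p => side Z S p && ~~ inner Z (right_face p)) Z).
  rewrite Posz_count [RHS](big_nth (0, 0, 0)); apply: eq_big_nat => k /andP[_ kn].
  by rewrite /cvertex modn_small.
rewrite -count_outer -PoszD; congr Posz.
elim: pts => //= p s ->; case: (side Z S p); case: (inner Z (right_face p)) => /=; lia.
Qed.
End Side.

Lemma right_face_cycle k :
  2 * Posz (~~ inner Z (right_face (z k.+1))) = 1 + eps * turn (z k) (z k.+1) (z k.+2).
Proof.
have h02 : z k != z k.+2.
  rewrite cvertex_inj // -addn2 -{1}(addn0 k) eqn_modDl !modn_small ?size_gt2 //.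
  exact: size_gt0.
have := right_face_turn (cvertex_step Zcyc k) (cvertex_step Zcyc k.+1) h02.
by case=> -[->] [] ->; rewrite ?inner_lface ?inner_rface //;
  case: (orientation_cases Zcyc) => ->.
Qed.

Lemma xstep_y k : (coordx (z k.+1) - coordx (z k)) * coordy (z k.+1)
  = (coordx (z k.+1) - coordx (z k)) * coordy (z k).
Proof.
by case/hadjP: (cvertex_step Zcyc k) => a b; rewrite /coordx /coordy /=; lia.
Qed.

Lemma card_vertices : 2 * Posz #|T| =
  \sum_(0 <= k < n) (1 + eps * vweight (z k) (z k.+1) (z k.+2)).
Proof.
pose S c (t : bool) := wind c.
have HS : side_function Z S.
  split=> [c t /(winding_cases Zcyc) //|//|p q pq nc].
  exact: winding_noncycle.
have sT p : vertex_on_or_inside Z p -> side Z S p.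
  by case/(vertex_inner Zcyc)=> c cp ci; rewrite (side_inner HS cp ci); case/andP: ci.
have -> : #|T| = #|[set x | side Z S (pos x)]|.
  rewrite -cardsT; congr #|pred_of_set _|; apply/setP => x; rewrite !inE.
  by rewrite sT //; apply/(embeds_vertex emb); exists x.
have [N N0 hN] := winding_bounded Zcyc; have [N' N0' hN'] := seq_bounded Z.
pose M := absz (N + N' + 1)%R.
rewrite (@card_side S HS M) => [|c /andP[hc /eqP wc]]; last first.
  have [|] := hN c hc; first by rewrite wc; have := orientation_cases Zcyc; lia.
  by rewrite /M; lia.
have -> : \sum_(a <- centred_range M) \sum_(b <- centred_range M)
    eps * (S (face a b) false + S (face a b) true)
  = eps * (2 * \sum_(0 <= k < n) (coordx (z k.+1) - coordx (z k)) * coordy (z k)).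
  under eq_bigr => a _ do rewrite -mulr_sumr.
  rewrite -mulr_sumr; congr (_ * _).
  under eq_bigr => a _ do under eq_bigr => b _ do rewrite /S -mulr2n -mulr_natl.
  under eq_bigr => a _ do rewrite -mulr_sumr.
  rewrite -mulr_sumr; congr (_ * _).
  under eq_bigr => a _ do rewrite exchange_big /=.
  rewrite exchange_big /=.
  under eq_bigr => k _.
    rewrite /face_crossing /= sum_crossing ?cvertex_step //.
    - rewrite mulrDr; over.
    - by have /and3P[] := hN' _ (cvertex_in Zcyc k); rewrite /M; lia.
    - by have /and3P[] := hN' _ (cvertex_in Zcyc k.+1); rewrite /M; lia.
    - by have /and3P[] := hN' _ (cvertex_in Zcyc k); rewrite /M; lia.
  rewrite big_split /= -[RHS]addr0; congr (_ + _).
  rewrite -mulr_suml (telescope_sumr (fun k => coordx (z k))) //.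
  by rewrite -(cvertexD Z 0) add0n subrr mul0r.
have -> : \sum_(0 <= k < n) Posz (side Z S (z k) && ~~ inner Z (right_face (z k)))
  = \sum_(0 <= k < n) Posz (~~ inner Z (right_face (z k.+1))).
  rewrite -(@sum_period (fun k => Posz (side Z S (z k) && ~~ inner Z (right_face (z k)))) n 1).
    rewrite add1n big_add1 /=; apply: eq_bigr => k _.
    rewrite sT //; split; last by left; apply: cvertex_in.
    by have /and3P[] := cvertex_step Zcyc k.+1.
  by move=> k; rewrite cvertexD.
set A := \sum_(0 <= k < n) _ * _; set B := \sum_(0 <= k < n) Posz _.
have hB : 2 * B = \sum_(0 <= k < n) (1 + eps * turn (z k) (z k.+1) (z k.+2)).
  by rewrite mulr_sumr; apply: eq_bigr => k _; rewrite right_face_cycle.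
have hA : 2 * A = \sum_(0 <= k < n) (coordx (z k.+2) - coordx (z k)) * coordy (z k.+1).
  pose f k := (coordx (z k.+1) - coordx (z k)) * coordy (z k).
  have -> : 2 * A = \sum_(0 <= k < n) f k.+1 + \sum_(0 <= k < n) f k.
    rewrite mulr_natl mulr2n; congr (_ + _).
    rewrite /A -/f -(@sum_period f n 1); last by move=> k; rewrite /f -addSn !cvertexD.
    by rewrite add1n big_add1.
  rewrite -big_split; apply: eq_bigr => k _ /=; rewrite /f.
  by have := xstep_y k; lia.
have -> : \sum_(0 <= k < n) (1 + eps * vweight (z k) (z k.+1) (z k.+2))
    = eps * 2 * (2 * A) + 2 * B.
  rewrite hA hB mulr_sumr -big_split; apply: eq_bigr => k _ /=.
  by rewrite /vweight; lia.
lia.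
Qed.
End Counting.

(** * Cuts *)

Definition xend (t : bool) (a b : int) : point := if t then vhi (a + 1) b else vlo a b.

(* The cut crosses the edges of row a from b1 to b2.  The boundary arc
   i+1, ..., j joins its two ends on the side selected by the boolean
   orientation Z == -1 in xend. *)
Record cut (Z : seq point) (i j : nat) (a b1 b2 : int) : Prop :=
  Cut {
    cut_order : (i < j < i + size Z)%N;
    cut_lt : b1 < b2;
    cut_left : cvertex Z i = xend (orientation Z == 1) a b1;
    cut_leftS : cvertex Z i.+1 = xend (orientation Z == - 1) a b1;
    cut_right : cvertex Z j = xend (orientation Z == - 1) a b2;
    cut_rightS : cvertex Z j.+1 = xend (orientation Z == 1) a b2;
    cut_free : forall b, b1 < b < b2 -> ~~ xedge Z a b
  }.

Definition arc_side (Z : seq point) (i j : nat) (a b1 b2 : int) (c : point) (t : bool) : int :=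
  \sum_(i.+1 <= k < j) face_crossing c (cvertex Z k) (cvertex Z k.+1)
  + (if [&& coordx c == a, b1 <= coordy c, coordy c < b2
         & t == (orientation Z == - 1)] then orientation Z else 0).

Lemma mod_window i d m : (0 < d)%N ->
  exists2 m', (i <= m' < i + d)%N & m' == m %[mod d].
Proof.
move=> d0; exists (i + (m + (d - i %% d)) %% d)%N.
  by rewrite leq_addr ltn_add2l ltn_mod.
rewrite modnDmr addnCA {1}(divn_eq i d) -addnA subnKC; last by rewrite ltnW // ltn_mod.
by rewrite -mulSnr addnC modnMDl.
Qed.

Section Cut.
Variables (Z : seq point) (i j : nat) (a b1 b2 : int).
Hypotheses (Zcyc : lattice_cycle Z) (C : cut Z i j a b1 b2).
Local Notation n := (size Z).
Local Notation z := (cvertex Z).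
Local Notation wind := (winding Z).
Local Notation eps := (orientation Z).
Local Notation tau := (orientation Z == - 1).
Local Notation S := (arc_side Z i j a b1 b2).

Lemma cut_orientation :
  (eps = 1 /\ [/\ z i = vhi (a + 1) b1, z i.+1 = vlo a b1,
                  z j = vlo a b2 & z j.+1 = vhi (a + 1) b2]) \/
  (eps = - 1 /\ [/\ z i = vlo a b1, z i.+1 = vhi (a + 1) b1,
                  z j = vhi (a + 1) b2 & z j.+1 = vlo a b2]).
Proof.
case: C => _ _ -> -> -> -> _.
by case: (orientation_cases Zcyc) => ->; [left|right].
Qed.

Lemma xedge_cut_left : xedge Z a b1.
Proof.
have := cycle_edge_cvertex Zcyc i; rewrite /xedge.
by case: cut_orientation => -[_ [-> -> _ _]]; rewrite // cycle_edge_sym.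
Qed.

Lemma xedge_cut_right : xedge Z a b2.
Proof.
have := cycle_edge_cvertex Zcyc j; rewrite /xedge.
by case: cut_orientation => -[_ [_ _ -> ->]]; rewrite // cycle_edge_sym.
Qed.

Lemma cut_winding_right : wind (face a (b2 - 1)) = eps /\ wind (face a b2) = 0.
Proof.
have := orientation_lface Zcyc j; have := orientation_rface Zcyc j.
by case: cut_orientation => -[-> [_ _ -> ->]]; rewrite !lfaceE; lia.
Qed.

Lemma cut_winding_left : wind (face a (b1 - 1)) = 0.
Proof.
have := orientation_lface Zcyc i; have := orientation_rface Zcyc i.
by case: cut_orientation => -[-> [-> -> _ _]]; rewrite !lfaceE; lia.
Qed.

Lemma cut_winding b : b1 <= b < b2 -> wind (face a b) = eps.
Proof.
move=> hb; rewrite -(cut_winding_right.1); apply: (conn_winding Zcyc).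
by apply: conn_run => [|b' hb']; [lia|apply: (cut_free C); lia].
Qed.

Lemma arc_side_xedge a' b' t : ~ (a' = a /\ (b' = b1 \/ b' = b2)) ->
  S (face a' (b' - 1)) t - S (face a' b') t
  = \sum_(i.+1 <= k < j) traversal (vlo a' b') (vhi (a' + 1) b') (z k) (z k.+1).
Proof.
move=> h; rewrite /arc_side.
have -> : \sum_(i.+1 <= k < j) traversal (vlo a' b') (vhi (a' + 1) b') (z k) (z k.+1)
  = \sum_(i.+1 <= k < j) face_crossing (face a' (b' - 1)) (z k) (z k.+1)
  - \sum_(i.+1 <= k < j) face_crossing (face a' b') (z k) (z k.+1).
  rewrite -sumrB; apply: eq_bigr => k _.
  by rewrite /face_crossing /= -crossing_xedge ?cvertex_step.
rewrite opprD addrACA -[RHS]addr0; congr (_ + _).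
rewrite /coordx /coordy /=; case: (_ == tau); rewrite !(andbT, andbF) ?subrr //.
by have := cut_lt C; case: ifP; case: ifP; lia.
Qed.

Lemma arc_side_zigzag u v : hadj u v -> coordx u = coordx v ->
  zigzag_pos v = zigzag_pos u + 1 ->
  S (face (coordx u) (coordy v - 1)) false - S (face (coordx u - 1) (coordy u)) true
  = \sum_(i.+1 <= k < j) traversal u v (z k) (z k.+1).
Proof.
move=> uv xuv zuv; rewrite /arc_side opprD addrACA -sumrB.
rewrite (eq_bigr (fun k => traversal u v (z k) (z k.+1)
    - (beyond (coordx u) (zigzag_pos v) (z k.+1)
       - beyond (coordx u) (zigzag_pos v) (z k)))); last first.
  by move=> k _; rewrite -crossing_zigzag ?cvertex_step.
rewrite sumrB (telescope_sumr (fun k => beyond (coordx u) (zigzag_pos v) (z k))); last first.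
  by have := cut_order C; lia.
rewrite -[RHS]addr0 -addrA; congr (_ + _).
have := cut_lt C; rewrite /beyond.
case: cut_orientation => -[-> [_ -> -> _]];
move/hadjP: uv xuv zuv; case=> c d; rewrite /zigzag_pos; unfold_lattice; try lia;
  move=> _ _; rewrite ?andbF ?andbT; by case: ifP; lia.
Qed.

Lemma traversalN u v s t : traversal v u s t = - traversal u v s t.
Proof. by rewrite /traversal opprB. Qed.

Lemma arc_side_edge u v p : hadj u v -> p \in [:: u; v] ->
  (forall b, u = vlo a b -> v = vhi (a + 1) b -> (b != b1) && (b != b2)) ->
  (forall b, v = vlo a b -> u = vhi (a + 1) b -> (b != b1) && (b != b2)) ->
  S (lface u v) (half (lface u v) p) - S (lface v u) (half (lface v u) p)
  = \sum_(i.+1 <= k < j) traversal u v (z k) (z k.+1).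
Proof.
have sumN x y : \sum_(i.+1 <= k < j) traversal x y (z k) (z k.+1)
    = - \sum_(i.+1 <= k < j) traversal y x (z k) (z k.+1).
  by rewrite -sumrN; apply: eq_bigr => k _; rewrite traversalN.
have zY c d : zigzag_pos (vhi c (d + 1)) = zigzag_pos (vlo c d) + 1.
  by rewrite /zigzag_pos; unfold_lattice; lia.
have zZ c d : zigzag_pos (vlo c d) = zigzag_pos (vhi c d) + 1.
  by rewrite /zigzag_pos; unfold_lattice; lia.
move=> /hadjP uv; rewrite !inE => pE h1 h2.
have half_x c d e : half (face c e) p = half (face c d) p by [].
case: uv pE h1 h2 => c d pE h1 h2; rewrite !lfaceE.
- rewrite (half_x c d (d - 1)) arc_side_xedge // => -[ca hd]; subst c.
  by have := h1 d erefl erefl; case: hd => ->; rewrite eqxx ?andbF.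
- rewrite (half_x c d (d - 1)) -opprB arc_side_xedge => [|[ca hd]]; first by rewrite -sumN.
  subst c; by have := h2 d erefl erefl; case: hd => ->; rewrite eqxx ?andbF.
- have -> : half (face c d) p = false by rewrite /half; case/orP: pE => /eqP->; rewrite eqxx.
  have -> : half (face (c - 1) d) p = true.
    by rewrite /half /coordx; case/orP: pE => /eqP-> /=; lia.
  rewrite -(arc_side_zigzag _ _ (zY c d)) //; last by apply/hadjP; constructor.
  by rewrite /coordx /coordy /= addrK.
- have -> : half (face c d) p = false by rewrite /half; case/orP: pE => /eqP->; rewrite eqxx.
  have -> : half (face (c - 1) d) p = true.
    by rewrite /half /coordx; case/orP: pE => /eqP-> /=; lia.
  rewrite sumN -(arc_side_zigzag _ _ (zY c d)) //; last by apply/hadjP; constructor.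
  by rewrite opprB /coordx /coordy /= addrK.
- have -> : half (face c (d - 1)) p = false.
    by rewrite /half; case/orP: pE => /eqP->; rewrite eqxx.
  have -> : half (face (c - 1) d) p = true.
    by rewrite /half /coordx; case/orP: pE => /eqP-> /=; lia.
  rewrite sumN -(arc_side_zigzag _ _ (zZ c d)) //; last by apply/hadjP; constructor.
  by rewrite opprB /coordx /coordy /=.
- have -> : half (face c (d - 1)) p = false.
    by rewrite /half; case/orP: pE => /eqP->; rewrite eqxx.
  have -> : half (face (c - 1) d) p = true.
    by rewrite /half /coordx; case/orP: pE => /eqP-> /=; lia.
  rewrite -(arc_side_zigzag _ _ (zZ c d)) //; last by apply/hadjP; constructor.
Qed.

Lemma arc_side_noncycle u v p : hadj u v -> p \in [:: u; v] -> ~~ cycle_edge Z u v ->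
  S (lface u v) (half (lface u v) p) = S (lface v u) (half (lface v u) p).
Proof.
move=> uv pE nc; apply/eqP; rewrite -subr_eq0 arc_side_edge //.
- by rewrite big1 // => k _; rewrite traversal_noncycle.
- move=> b uE vE; rewrite uE vE in nc.
  by apply/andP; split; apply: contraNneq nc => ->;
    [exact: xedge_cut_left|exact: xedge_cut_right].
- move=> b uE vE; rewrite uE vE cycle_edge_sym in nc.
  by apply/andP; split; apply: contraNneq nc => ->;
    [exact: xedge_cut_left|exact: xedge_cut_right].
Qed.

Lemma cvertex_edge_inj m k :
  (z m = z k /\ z m.+1 = z k.+1) \/ (z m = z k.+1 /\ z m.+1 = z k) -> m == k %[mod n].
Proof.
case=> -[h1 h2]; first by rewrite -cvertex_inj // h1.
have := traversal_cvertex Zcyc k m.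
have -> : traversal (z k) (z k.+1) (z m) (z m.+1) = - 1.
  rewrite /traversal h1 h2 !eqxx cvertex_inj // -addn1 -{2}(addn0 k) eqn_modDl.
  by rewrite !modn_small //; have := size_gt2 Zcyc; lia.
by case: (m == k %[mod n]).
Qed.

Lemma arc_side_cycle m p : (i < m < i + n)%N -> m != j -> p \in [:: z m; z m.+1] ->
  S (lface (z m) (z m.+1)) (half (lface (z m) (z m.+1)) p)
  - S (lface (z m.+1) (z m)) (half (lface (z m.+1) (z m)) p) = Posz (m < j)%N.
Proof.
move=> mi mj pE.
have Oij := cut_order C.
have notij b : (z m = vlo a b /\ z m.+1 = vhi (a + 1) b) \/
    (z m.+1 = vlo a b /\ z m = vhi (a + 1) b) -> (b != b1) && (b != b2).
  move=> h; apply/andP; split; apply/eqP => bE; subst b.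
  - have : m == i %[mod n].
      apply: cvertex_edge_inj.
      case: cut_orientation => -[_ [-> -> _ _]]; case: h => -[-> ->]; auto.
    by rewrite (@eqn_mod_window i); lia.
  - have : m == j %[mod n].
      apply: cvertex_edge_inj.
      case: cut_orientation => -[_ [_ _ -> ->]]; case: h => -[-> ->]; auto.
    by rewrite (@eqn_mod_window i); lia.
rewrite arc_side_edge ?cvertex_step //; last 2 first.
- by move=> b h1 h2; apply: notij; left.
- by move=> b h1 h2; apply: notij; right.
under eq_bigr => k _ do rewrite traversal_cvertex //.
by rewrite sum_mod_index //; lia.
Qed.

Lemma arc_side_row a' b' b'' t : b' <= b'' ->
  (forall b, b' < b <= b'' -> ~~ xedge Z a' b) ->
  S (face a' b') t = S (face a' b'') t.
Proof.
move=> bb'; have {bb'} -> : b'' = b' + absz (b'' - b')%R by lia.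
elim: (absz (b'' - b')%R) => [|m IH] nx; first by rewrite addr0.
rewrite IH => [|b hb]; last by apply: nx; lia.
have nc : ~~ xedge Z a' (b' + m.+1%:Z) by apply: nx; lia.
have := @arc_side_noncycle _ _ (xend t a' (b' + m.+1%:Z)) (hadj_xedge _ _) _ nc.
rewrite !lfaceE; have -> : b' + m.+1%:Z - 1 = b' + m%:Z by lia.
have hE b : half (face a' b) (xend t a' (b' + m.+1%:Z)) = t.
  by rewrite /half /xend; case: (t) => /=; rewrite /coordx /=; lia.
by rewrite !hE; apply; rewrite !inE /xend; case: (t); rewrite eqxx ?orbT.
Qed.

Lemma arc_side_outer c t : hface c -> wind c = 0 -> S c t = 0.
Proof.
pose w c := \sum_(i.+1 <= k < j) face_crossing c (z k) (z k.+1).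
have Sw d t' : hface d -> wind d = 0 -> S d t' = w d.
  move=> hd wd; rewrite /arc_side -/(w d) ifF ?addr0 //.
  apply/negP => /and4P[/eqP da h1 h2 _]; move: wd; rewrite (hfaceE hd) da.
  by rewrite cut_winding ?h1 ?h2 //; have := orientation_cases Zcyc; lia.
move=> hc wc; rewrite Sw //.
have inv d : face_conn Z c d -> w c = w d.
  move=> cd; suff: hface c -> wind c = 0 -> w c = w d by apply.
  elim: cd {hc wc} => [x y xy hx wx|//|x y v xy h1 yv h2 hx wx].
    have wy : wind y = 0 by rewrite -(conn_winding Zcyc (rt_step _ _ _ _ xy)).
    have hy : hface y by exact: conn_hface (rt_step _ _ _ _ xy) hx.
    case/(face_step_cases): xy => u [v [uv nc xE yE]].
    have e := arc_side_noncycle uv (mem_head _ _) nc.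
    rewrite -(Sw x (half x u) hx wx) -(Sw y (half y u) hy wy).
    by case: xE => ->; case: yE => ->; rewrite ?e.
  by rewrite h1 // h2 ?(conn_hface xy) // -(conn_winding Zcyc xy).
have [a' [b' h]] := winding0_escapes Zcyc hc wc.
have [N N0 hN] := xedge_bounded Z.
have /inv -> : face_conn Z c (face a' (b' + `|b'| + N)) by apply: h; lia.
rewrite /w big1 // => k _; apply/eqP; apply: contraT.
move=> /(crossing_xedge_exists Zcyc)[b''] hb /hN; rewrite /coordy /= in hb; lia.
Qed.

Lemma arc_side_inner_cycle c m p : (i < m < i + n)%N -> m != j ->
  p \in [:: z m; z m.+1] -> corner c (z m) -> corner c (z m.+1) -> inner Z c ->
  S c (half c p) = if (m < j)%N then eps else 0.
Proof.
move=> mi mj pE c1 c2 ci; have := arc_side_cycle mi mj pE.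
have := corner_edge c (cvertex_step Zcyc m); rewrite c1 c2 => /esym/orP.
have := orientation_lface Zcyc m; have := orientation_rface Zcyc m.
case: (orientation_cases Zcyc) => eE; rewrite eE => wr wl [] /eqP cE; subst c.
- by rewrite (@arc_side_outer (lface (z m.+1) (z m))) ?hface_lface //; [case: ifP; lia|lia].
- by case/andP: ci => _ /eqP; rewrite eE; lia.
- by case/andP: ci => _ /eqP; rewrite eE; lia.
- by rewrite (@arc_side_outer (lface (z m) (z m.+1))) ?hface_lface //; [case: ifP; lia|lia].
Qed.

Lemma arc_side_values c t : hface c -> S c t = 0 \/ S c t = eps.
Proof.
move=> hc; case: (winding_cases Zcyc hc) => [wc|]; first by left; apply: arc_side_outer.
have e0 : eps <> 0 by have := orientation_cases Zcyc; lia.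
rewrite (hfaceE hc); move: (coordx c) (coordy c) => a' b' wc {hc}.
have [no|[b'' [bb'' xb'' no]]] := next_xedge Z a' b'.
  by move: wc; rewrite winding_far // => /esym.
have h : face_conn Z (face a' b') (face a' (b'' - 1)).
  by apply: conn_run => [|b hb]; [lia|apply: no; lia].
have wc' := conn_winding Zcyc h; rewrite wc in wc'.
rewrite (@arc_side_row a' b' (b'' - 1)); [|lia|by move=> b hb; apply: no; lia].
have [m mn mE] := xedge_index Zcyc xb''.
have [m' /andP[im mi] mm] : exists2 m', (i <= m' < i + n)%N & m' == m %[mod n].
  exact: mod_window (size_gt0 Zcyc).
have mE' : (z m' = vlo a' b'' /\ z m'.+1 = vhi (a' + 1) b'') \/
    (z m' = vhi (a' + 1) b'' /\ z m'.+1 = vlo a' b'').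
  have e1 : z m' = z m by apply/eqP; rewrite cvertex_inj.
  have e2 : z m'.+1 = z m.+1 by apply/eqP; rewrite cvertex_inj // eqn_modSS.
  by rewrite e1 e2.
case: (eqVneq m' i) => [mi'|nmi].
  have [aE bE] : a' = a /\ b'' = b1.
    move: mE'; rewrite mi'; case: cut_orientation => -[_ [-> -> _ _]] [] [/eqP h1 /eqP h2];
    by move: h1 h2; rewrite !eq_vertex //; lia.
  by move: wc'; rewrite aE bE cut_winding_left => /e0.
case: (eqVneq m' j) => [mj'|nmj].
  have [-> ->] : a' = a /\ b'' = b2.
    move: mE'; rewrite mj'; case: cut_orientation => -[_ [_ _ -> ->]] [] [/eqP h1 /eqP h2];
    by move: h1 h2; rewrite !eq_vertex //; lia.
  have hc2 : S (face a b2) t = 0.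
    by apply: arc_side_outer; rewrite ?hface_face // (cut_winding_right.2).
  have := cut_lt C; move: hc2; rewrite /arc_side.
  have -> : \sum_(i.+1 <= k < j) face_crossing (face a (b2 - 1)) (z k) (z k.+1)
    = \sum_(i.+1 <= k < j) face_crossing (face a b2) (z k) (z k.+1).
    apply/eqP; rewrite -subr_eq0 -sumrB big_nat_cond big1 // => k /andP[/andP[ik kj] _].
    rewrite /face_crossing /= crossing_xedge ?cvertex_step //.
    have kjn : k == j %[mod n] = false by rewrite (@eqn_mod_window i); lia.
    have := traversal_cvertex Zcyc j k; rewrite kjn.
    case: cut_orientation => -[_ [_ _ -> ->]] //.
    by rewrite traversalN => /eqP; rewrite oppr_eq0 => /eqP.
  by rewrite /coordx /coordy /= !eqxx ltxx /= andbF addr0 => ->; rewrite add0r;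
    case: ifP; auto.
have im' : (i < m' < i + n)%N by rewrite ltn_neqAle eq_sym nmi im mi.
have ci : inner Z (face a' (b'' - 1)) by rewrite /inner hface_face /= -wc'.
have hE : half (face a' (b'' - 1)) (xend t a' b'') = t.
  by rewrite /half /xend; case: (t) => /=; rewrite /coordx /=; lia.
have := corner_edge (face a' (b'' - 1)) (hadj_xedge a' b'').
rewrite !lfaceE eqxx /= => /andP[c1 c2].
have := @arc_side_inner_cycle (face a' (b'' - 1)) m' (xend t a' b'') im' nmj.
rewrite hE => -> //; last 3 first.
- by case: mE' => -[-> ->]; rewrite !inE /xend; case: (t); rewrite eqxx ?orbT.
- by case: mE' => -[-> _].
- by case: mE' => -[_ ->].
by case: ifP; auto.
Qed.

Lemma arc_side_function : side_function Z S.
Proof.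
split; [exact: arc_side_values|exact: arc_side_outer|].
by move=> p q pq nc; apply: arc_side_noncycle; rewrite ?mem_head.
Qed.
End Cut.

Section CutSides.
Variables (Z : seq point) (T : finType) (e : rel T) (pos : T -> point).
Hypothesis emb : embeds Z e pos.
Variables (i j : nat) (a b1 b2 : int).
Hypothesis C : cut Z i j a b1 b2.
Local Notation n := (size Z).
Local Notation z := (cvertex Z).
Local Notation wind := (winding Z).
Local Notation eps := (orientation Z).
Local Notation tau := (orientation Z == - 1).
Local Notation S := (arc_side Z i j a b1 b2).
Local Notation sd := (side Z S).

Let Zcyc : lattice_cycle Z := embeds_cycle emb.
Let HS := arc_side_function Zcyc C.

Lemma half_xend t a' b b' : half (face a' b) (xend t a' b') = t.
Proof. by rewrite /half /xend; case: t => /=; rewrite /coordx /=; lia. Qed.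

Lemma corner_xend t a' b :
  corner (face a' b) (xend t a' b) && corner (face a' (b - 1)) (xend t a' b).
Proof. by rewrite /xend; case: t; rewrite ?corner_lo ?corner_hi !eq_face; lia. Qed.

Lemma arc_side_cut b t : b1 <= b < b2 -> S (face a b) t = if t == tau then eps else 0.
Proof.
move=> hb; have := arc_side_values Zcyc C tau (hface_face a b).
have := arc_side_values Zcyc C (~~ tau) (hface_face a b).
have e0 := orientation_cases Zcyc.
rewrite /arc_side /coordx /coordy /= eqxx (andP hb).1 (andP hb).2 /= eqxx.
have -> : ((~~ tau) == tau) = false by case: tau.
by case: (eqVneq t tau) => _; lia.
Qed.

Lemma side_cut b t : b1 <= b <= b2 -> sd (xend t a b) = (t == tau).
Proof.
move=> hb; have /andP[c1 c2] := corner_xend t a b.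
have e0 := orientation_cases Zcyc.
have fin x : (if x then eps else 0) == eps = x by case: x; lia.
have inn b' : b1 <= b' < b2 -> inner Z (face a b').
  by move=> h; rewrite /inner hface_face (cut_winding Zcyc C) ?eqxx.
case: (ltP b b2) => [bb2|b2b].
  by rewrite (side_inner emb HS c1) ?inn ?half_xend ?arc_side_cut ?fin //; lia.
have := cut_lt C => b12.
by rewrite (side_inner emb HS c2) ?inn ?half_xend ?arc_side_cut ?fin //; lia.
Qed.

Lemma side_noncut u v : edge_on_or_inside Z u v ->
  (forall b, b1 <= b <= b2 -> (u, v) <> (vlo a b, vhi (a + 1) b) /\
                              (v, u) <> (vlo a b, vhi (a + 1) b)) ->
  sd u = sd v.
Proof.
move=> /(edge_inner Zcyc)[uv hin] nC.
have [c ci cE] : exists2 c, inner Z c & (c == lface u v) || (c == lface v u).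
  by case/orP: hin => h; [exists (lface u v)|exists (lface v u)]; rewrite ?eqxx ?orbT.
have := corner_edge c uv; rewrite cE => /andP[cu cv].
rewrite (side_inner emb HS cu ci) (side_inner emb HS cv ci); congr (_ == _).
case: (eqVneq (half c u) (half c v)) => [-> //|hne].
have [a' [b' uvE]] : exists a' b', (u, v) = (vlo a' b', vhi (a' + 1) b') \/
   (v, u) = (vlo a' b', vhi (a' + 1) b').
  by move: hne; rewrite /half; case/hadjP: uv => a' b'; rewrite /coordx /= ?eqxx //;
    exists a', b'; auto.
have cE' : c = face a' (b' - 1) \/ c = face a' b'.
  case: uvE => -[uE vE]; move: cE; rewrite uE vE !lfaceE => /orP[]/eqP; auto.
have out : ~~ [&& coordx c == a, b1 <= coordy c & coordy c < b2].
  apply/negP => /and3P[/eqP ca h1 h2]; have ha : a' = a.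
    by rewrite -ca; case: cE' => ->.
  have hb : b1 <= b' <= b2.
    by clear -cE' h1 h2; case: cE' h1 h2 => ->; rewrite /coordy /=; lia.
  by have [] := nC b' hb; rewrite -ha; case: uvE.
rewrite /arc_side; congr (_ + _).
by rewrite !ifF //; apply/negbTE; apply: contra out => /and4P[-> -> ->].
Qed.

Lemma side_arc k : (i < k <= i + n)%N -> sd (z k) = (k <= j)%N.
Proof.
move=> ki; have Oij := cut_order C; have b12 := cut_lt C.
case: (eqVneq k j) => [->|kj].
  by rewrite leqnn (cut_right C) side_cut ?eqxx //; lia.
case: (eqVneq k (i + n)%N) => [->|kin].
  rewrite cvertexD (cut_left C) side_cut; last lia.
  by have := orientation_cases Zcyc; lia.
have ki' : (i < k < i + n)%N by lia.
have := edge_inner Zcyc (z k) (z k.+1).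
have -> : edge_on_or_inside Z (z k) (z k.+1) <-> true.
  split=> // _; split; first exact: cvertex_step.
  by left; apply: cycle_edge_cvertex.
move=> /iffLR/(_ isT)[_ hin].
have [c ci cE] : exists2 c, inner Z c &
    (c == lface (z k) (z k.+1)) || (c == lface (z k.+1) (z k)).
  by case/orP: hin => h; [exists (lface (z k) (z k.+1))|exists (lface (z k.+1) (z k))];
    rewrite ?eqxx ?orbT.
have := corner_edge c (cvertex_step Zcyc k); rewrite cE => /andP[cu cv].
rewrite (side_inner emb HS cu ci) (arc_side_inner_cycle Zcyc C ki' kj) ?mem_head //.
rewrite [in RHS]leq_eqVlt (negbTE kj) /=.
by have := orientation_cases Zcyc; case: ifP; lia.
Qed.

Lemma card_arc_side : 2 * Posz #|[set x | sd (pos x)]| =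
  \sum_(i <= k < j) (1 + eps * vweight (z k) (z k.+1) (z k.+2)).
Proof.
have Oij := cut_order C; have b12 := cut_lt C.
have [N N0 hN] := winding_bounded Zcyc; have [N' N0' hN'] := seq_bounded Z.
pose M := absz (N + N' + 1)%R.
pose f k := (coordx (z k.+1) - coordx (z k)) * coordy (z k).
have e1 : eps * eps = 1 by case: (orientation_cases Zcyc) => ->.
rewrite (@card_side _ _ _ _ emb S HS M) => [|c /andP[hc /eqP wc]]; last first.
  have [|] := hN c hc; first by rewrite wc; have := orientation_cases Zcyc; lia.
  by rewrite /M; lia.
have zN k : `|coordx (z k)| <= N' /\ `|coordy (z k)| <= N'.
  by have /and3P[] := hN' _ (cvertex_in Zcyc k).
have box_arc : \sum_(a' <- centred_range M) \sum_(b' <- centred_range M)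
    \sum_(i.+1 <= k < j) face_crossing (face a' b') (z k) (z k.+1)
    = \sum_(i.+1 <= k < j) f k.
  under eq_bigr => a' _ do rewrite exchange_big /=.
  rewrite exchange_big /=.
  under eq_bigr => k _.
    rewrite /face_crossing /= sum_crossing ?cvertex_step //.
    - rewrite mulrDr; over.
    - by have [] := zN k; rewrite /M; lia.
    - by have [] := zN k.+1; rewrite /M; lia.
    - by have [] := zN k; rewrite /M; lia.
  rewrite big_split /= -[RHS]addr0; congr (_ + _).
  rewrite -mulr_suml (telescope_sumr (fun k => coordx (z k))); last lia.
  rewrite (cut_right C) (cut_leftS C) /xend.
  by case: ifP; rewrite /coordx /= subrr mul0r.
have aN : `|a| <= N' + 1 /\ (`|b1| <= N' /\ `|b2| <= N').
  have := zN i; have := zN j; rewrite (cut_right C) (cut_left C) /xend.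
  by case: ifP; case: ifP; rewrite /coordx /coordy /=; lia.
have box_cut : \sum_(a' <- centred_range M) \sum_(b' <- centred_range M)
    (if [&& a' == a, b1 <= b' & b' < b2] then eps else 0) = eps * (b2 - b1).
  rewrite (eq_bigr (fun a' => if a' == a then eps * (b2 - b1) else 0)).
    rewrite sum_centred_range_eq //; rewrite /M.
    have := zN i; have := zN i.+1; rewrite (cut_leftS C) (cut_left C) /xend.
    by case: ifP; case: ifP; rewrite /coordx /=; have := orientation_cases Zcyc; lia.
  move=> a' _; case: eqP => _ /=; last by rewrite big1.
  have -> : b2 - b1 = (b2 + M%:Z) - (b1 + M%:Z) by lia.
  rewrite -!sum_centred_range_lt; [|rewrite /M; lia..].
  rewrite -sumrB mulr_sumr; apply: eq_bigr => b _.
  by case: ifP; lia.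
have -> : \sum_(a' <- centred_range M) \sum_(b' <- centred_range M)
    eps * (S (face a' b') false + S (face a' b') true)
  = 2 * eps * \sum_(i.+1 <= k < j) f k + (b2 - b1).
  have -> : 2 * eps * \sum_(i.+1 <= k < j) f k + (b2 - b1)
    = eps * (2 * \sum_(i.+1 <= k < j) f k + eps * (b2 - b1)).
    by rewrite [RHS]mulrDr [eps * (eps * _)]mulrA e1 mul1r mulrA (mulrC eps).
  rewrite -box_arc -box_cut !mulr_sumr -big_split /= mulr_sumr; apply: eq_bigr => a' _.
  rewrite !mulr_sumr -big_split /= mulr_sumr; apply: eq_bigr => b' _; congr (_ * _).
  rewrite /arc_side /coordx /coordy /=.
  by case: (a' == a); case: (b1 <= b'); case: (b' < b2); case: tau => /=; lia.
have per k : Posz (sd (z (k + n)) && ~~ inner Z (right_face (z (k + n))))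
   = Posz (sd (z k) && ~~ inner Z (right_face (z k))) by rewrite cvertexD.
rewrite -(@sum_period (fun k => Posz (sd (z k) && ~~ inner Z (right_face (z k)))) n i.+1 per).
rewrite [X in _ + X](big_cat_nat (n := j.+1)) /=; [|lia..].
rewrite [X in _ + (_ + X)]big_nat_cond [X in _ + (_ + X)]big1 ?addr0; last first.
  by move=> k /andP[/andP[jk kn] _]; rewrite side_arc; lia.
rewrite [X in _ + X]big_add1 /=.
have hB : 2 * \sum_(i <= k < j) Posz (sd (z k.+1) && ~~ inner Z (right_face (z k.+1)))
  = \sum_(i <= k < j) (1 + eps * turn (z k) (z k.+1) (z k.+2)).
  rewrite mulr_sumr; apply: eq_big_nat => k /andP[ik kj].
  by rewrite side_arc ?kj ?(right_face_cycle emb) //; lia.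
have fij : f i = - eps * b1 /\ f j = eps * b2.
  rewrite /f (cut_left C) (cut_leftS C) (cut_right C) (cut_rightS C) /xend.
  by case: (orientation_cases Zcyc) => ->; rewrite /coordx /coordy /=; lia.
have hA : \sum_(i <= k < j) (coordx (z k.+2) - coordx (z k)) * coordy (z k.+1)
  = 2 * \sum_(i.+1 <= k < j) f k + f i + f j.
  have -> : \sum_(i <= k < j) (coordx (z k.+2) - coordx (z k)) * coordy (z k.+1)
     = \sum_(i <= k < j) f k.+1 + \sum_(i <= k < j) f k.
    rewrite -big_split; apply: eq_bigr => k _ /=; rewrite /f.
    by have := xstep_y emb k; lia.
  have -> : \sum_(i <= k < j) f k.+1 = \sum_(i.+1 <= k < j.+1) f k by rewrite big_add1.
  rewrite big_nat_recr /=; last lia.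
  rewrite [\sum_(i <= k < j) f k]big_ltn; last lia.
  have E (x u v : int) : x + v + (u + x) = 2 * x + u + v by lia.
  exact: E.
have -> : \sum_(i <= k < j) (1 + eps * vweight (z k) (z k.+1) (z k.+2))
  = 2 * eps * (2 * \sum_(i.+1 <= k < j) f k + f i + f j) +
    2 * \sum_(i <= k < j) Posz (sd (z k.+1) && ~~ inner Z (right_face (z k.+1))).
  rewrite hB -hA mulr_sumr -big_split; apply: eq_bigr => k _ /=.
  by rewrite /vweight; lia.
have E (s F fi fj B d : int) : s * (fi + fj) = d ->
    2 * (2 * s * F + d + B) = 2 * s * (2 * F + fi + fj) + 2 * B by move=> <-; lia.
apply: E; case: fij => -> ->.
by case: (orientation_cases Zcyc) => ->; lia.
Qed.
End CutSides.

Section Distance.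
Variables (T : finType) (e : rel T).

Lemma dist_leq x p : path e x p -> (dist e x (last x p) <= size p)%N.
Proof.
move=> ep; case: (leqP #|T| (size p)) => [h|h].
  by apply: leq_trans h; rewrite -[X in (_ <= X)%N](size_iota 0); apply: find_size.
rewrite leqNgt; apply/negP => /(before_find 0%N)/negbT/negP; apply.
rewrite nth_iota // add0n /=; apply/existsP; exists (in_tuple p).
by rewrite ep eqxx.
Qed.

Lemma dist_walk x y : connect e x y ->
  exists p, [/\ path e x p, last x p = y & size p = dist e x y].
Proof.
case/connectP=> p0 /shortenP[p ep up _] yE.
have hp : (size p < #|T|)%N by have := card_uniqP up; rewrite /= => <-; apply: max_card.
pose P n := [exists q : n.-tuple T, path e x q && (last x q == y)].
have hasP : has P (iota 0 #|T|).
  apply/hasP; exists (size p); first by rewrite mem_iota.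
  by apply/existsP; exists (in_tuple p); rewrite ep yE eqxx.
have := nth_find 0%N hasP; rewrite nth_iota; last by rewrite has_find size_iota in hasP.
rewrite add0n => /existsP[q /andP[eq /eqP lq]].
by exists q; rewrite size_tuple.
Qed.

Lemma dist_triangle x y w : connect e x y -> connect e y w ->
  (dist e x w <= dist e x y + dist e y w)%N.
Proof.
move=> /dist_walk[p [ep <- <-]] /dist_walk[q [eq <- <-]].
by rewrite -last_cat -size_cat; apply: dist_leq; rewrite cat_path ep.
Qed.

Lemma path_exit (P : pred T) x p : path e x p -> P x -> ~~ P (last x p) ->
  exists q y r, [/\ p = q ++ y :: r, P (last x q) & ~~ P y].
Proof.
elim: p x => [|y p IH] x /=; first by move=> _ ->.
case/andP=> _ ep Px nl; case: (boolP (P y)) => Py; last by exists [::], y, p.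
by have [q [w [r [-> h1 h2]]]] := IH y ep Py nl; exists (y :: q), w, r.
Qed.
End Distance.

Section Metric.
Variables (Z : seq point) (T : finType) (e : rel T) (pos : T -> point).
Hypothesis emb : embeds Z e pos.
Local Notation n := (size Z).
Local Notation z := (cvertex Z).
Local Notation eps := (orientation Z).
Local Notation tau := (orientation Z == - 1).

Let Zcyc : lattice_cycle Z := embeds_cycle emb.

Lemma embeds_sym u v : e u v = e v u.
Proof.
suff h x y : e x y -> e y x by apply/idP/idP; apply: h.
move=> /(embeds_edge emb)[h1 h2]; apply/(embeds_edge emb); split.
  by rewrite hadj_sym.
by case: h2 => h2; [left; rewrite cycle_edge_sym|right=> c ? ?; apply: h2].
Qed.

Lemma embeds_face u v c : inner Z c -> corner c (pos u) -> corner c (pos v) ->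
  hadj (pos u) (pos v) -> e u v.
Proof.
move=> ci cu cv uv; apply/(embeds_edge emb)/(edge_inner Zcyc); split=> //.
have := corner_edge c uv; rewrite cu cv => /esym/orP[]/eqP <-; by rewrite ci ?orbT.
Qed.

Lemma embeds_corner c p : inner Z c -> corner c p -> exists x, pos x = p.
Proof.
by move=> ci cp; apply/(embeds_vertex emb)/(vertex_inner Zcyc); exists c.
Qed.

(* The boundary of a face is the walk through these six corners. *)
Definition face_corners (a b : int) : seq point :=
  [:: vlo a b; vhi (a + 1) b; vlo (a + 1) b; vhi (a + 1) (b + 1); vlo a (b + 1);
      vhi a (b + 1)].

Lemma mem_face_corners a b p : corner (face a b) p -> p \in face_corners a b.
Proof.
move=> h; have := corner_hvertex h; rewrite !inE => /hvertexP[c [d [pE|pE]]];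
  move: h; rewrite pE ?corner_lo ?corner_hi !eq_face !eq_vertex; lia.
Qed.

Lemma connect_face c u v : inner Z c -> corner c (pos u) -> corner c (pos v) ->
  connect e u v.
Proof.
move=> ci; have /andP[hc _] := ci; move: (ci); rewrite (hfaceE hc).
move: (coordx c) (coordy c) => a b {hc}ci.
have csym : connect_sym e by apply: sym_connect_sym => x y; apply: embeds_sym.
have all_c p : p \in face_corners a b -> corner (face a b) p.
  rewrite !inE => hp; case/orP: hp => [|hp]; last case/orP: hp => [|hp];
    last case/orP: hp => [|hp]; last case/orP: hp => [|hp]; last case/orP: hp;
  move=> /eqP->; rewrite ?corner_lo ?corner_hi !eq_face; lia.
have [x0 x0E] := embeds_corner ci (all_c (vlo a b) (mem_head _ _)).
have walk s x w : path hadj (pos x) s -> all (corner (face a b)) s ->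
    corner (face a b) (pos x) -> pos w = last (pos x) s -> connect e x w.
  elim: s x => [|p s IH] x /=; first by move=> _ _ _ /(embeds_inj emb) ->; apply: connect0.
  move=> /andP[xp ps] /andP[cp cs] cx wE; have [y yE] := embeds_corner ci cp; subst p.
  apply: connect_trans (IH y ps cs cp wE); apply: connect1.
  exact: embeds_face ci cx cp xp.
have from0 w : corner (face a b) (pos w) -> connect e x0 w.
  move=> /mem_face_corners; rewrite inE => /orP[/eqP wE|].
    by rewrite (embeds_inj emb (etrans wE (esym x0E))); apply: connect0.
  set s := _ :: _ => ws; have [k ks kE] : exists2 k, (k < size s)%N & nth (vlo a b) s k = pos w.
    by exists (index (pos w) s); rewrite ?index_mem ?nth_index.
  have sub : {subset take k.+1 s <= face_corners a b}.
    by move=> p /mem_take ps; apply: (@mem_behead _ (face_corners a b)).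
  apply: (walk (take k.+1 s)).
  - rewrite x0E; have : path hadj (vlo a b) s.
      by rewrite /s /= !(hadj_lo, hadj_hi, eq_vertex); lia.
    by rewrite -{1}(cat_take_drop k.+1 s) cat_path => /andP[].
  - by apply/allP => p /sub/all_c.
  - by rewrite x0E; apply/all_c/mem_head.
  - by rewrite x0E -nth_last size_takel // nth_take // -kE; apply: set_nth_default.
move=> cu cv; apply: connect_trans (from0 _ cv); rewrite csym; exact: from0.
Qed.

Lemma connect_row a b (m : nat) u v :
  (forall b', b <= b' < b + m%:Z -> inner Z (face a b')) ->
  pos u = vlo a b -> pos v = vlo a (b + m%:Z) -> connect e u v.
Proof.
elim: m v => [|m IH] v hin uE vE.
  by rewrite addr0 -uE in vE; rewrite (embeds_inj emb vE); apply: connect0.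
have ci : inner Z (face a (b + m%:Z)) by apply: hin; lia.
have cw : corner (face a (b + m%:Z)) (vlo a (b + m%:Z)).
  by rewrite corner_lo !eq_face; lia.
have [w wE] := embeds_corner ci cw.
apply: (@connect_trans _ _ w); first by apply: IH => // b' hb; apply: hin; lia.
by apply: connect_face ci _ _; rewrite ?wE ?vE ?corner_lo ?eq_face; lia.
Qed.

Lemma cvertex_embeds k : exists x, pos x = z k.
Proof.
apply/(embeds_vertex emb); split; last by left; apply: cvertex_in.
by have /and3P[] := cvertex_step Zcyc k.
Qed.

Lemma connect_cycle k u v : pos u = z 0 -> pos v = z k -> connect e u v.
Proof.
move=> uE; elim: k v => [|k IH] v vE.
  by rewrite (embeds_inj emb (etrans vE (esym uE))); apply: connect0.
have [w wE] := cvertex_embeds k; apply: connect_trans (IH w wE) _; apply: connect1.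
apply/(embeds_edge emb); rewrite wE vE; split; first exact: cvertex_step.
by left; apply: cycle_edge_cvertex.
Qed.

Lemma embeds_connected u v : connect e u v.
Proof.
have csym : connect_sym e by apply: sym_connect_sym => x y; apply: embeds_sym.
have [x0 x0E] := cvertex_embeds 0.
suff h w : connect e x0 w by apply: connect_trans (h v); rewrite csym.
have [|c cw ci] := iffLR (vertex_inner Zcyc (pos w)).
  by apply/(embeds_vertex emb); exists w.
have /andP[hc /eqP wc] := ci; move: cw ci wc; rewrite (hfaceE hc).
move: (coordx c) (coordy c) => a b {hc} cw ci wc.
have e0 := orientation_cases Zcyc.
have [no|[b' [bb' xb' no]]] := next_xedge Z a b.
  by move: wc; rewrite winding_far //; lia.
have hin b'' : b <= b'' < b + (absz (b' - b)%R)%:Z -> inner Z (face a b'').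
  move=> hb; rewrite /inner hface_face -wc /=; apply/eqP/esym.
  apply: (conn_winding Zcyc); apply: conn_run => [|d hd]; first lia.
  by apply: no; lia.
have c0 : corner (face a b) (vlo a b) by rewrite corner_lo !eq_face; lia.
have [x xE] := embeds_corner ci c0.
have [y yE] : exists y, pos y = vlo a b'.
  by apply/(embeds_vertex emb); split; [apply/hvertexP; exists a, b'; left|left];
    case/and3P: xb'.
have xw : connect e x w by apply: connect_face ci _ cw; rewrite xE.
have xy : connect e x y.
  by apply: (connect_row hin xE); rewrite yE; congr vlo; lia.
have [k _ kE] : exists2 k, (k < n)%N & z k = vlo a b'.
  by apply/(cvertexP Zcyc); case/and3P: xb'.
apply: connect_trans xw; rewrite csym; apply: connect_trans xy _; rewrite csym.
by apply: (@connect_cycle k) x0E _; rewrite yE kE.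
Qed.

Lemma walk_lower_bound x p : path e x p ->
  `|coordy (pos (last x p)) - coordy (pos x)|
  + `|coordz (pos (last x p)) - coordz (pos x)| <= (size p)%:Z.
Proof.
elim: p x => [|y p IH] x /=; first by rewrite !subrr.
case/andP=> /(embeds_edge emb)[xy _] /IH {IH}.
move/hadjP: xy; case E: _ _ / => [a b|a b|a b|a b|a b|a b];
  rewrite /coordy /coordz /=; lia.
Qed.

Section CutMetric.
Variables (i j : nat) (a b1 b2 : int).
Hypothesis C : cut Z i j a b1 b2.
Local Notation S := (arc_side Z i j a b1 b2).
Local Notation sd := (side Z S).

Lemma cut_inner b : b1 <= b < b2 -> inner Z (face a b).
Proof. by move=> hb; rewrite /inner hface_face (cut_winding Zcyc C) ?eqxx. Qed.

Lemma dist_cut_step t b u v : b1 <= b < b2 ->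
  pos u = xend t a b -> pos v = xend t a (b + 1) ->
  (dist e u v <= 2)%N /\ (dist e v u <= 2)%N.
Proof.
move=> hb uE vE; have ci := cut_inner hb.
pose m := if t then vlo (a + 1) b else vhi a (b + 1).
have cm : corner (face a b) m.
  by rewrite /m; case: (t); rewrite ?corner_lo ?corner_hi !eq_face; lia.
have [w wE] := embeds_corner ci cm.
have cu : corner (face a b) (pos u).
  by rewrite uE /xend; case: (t); rewrite ?corner_lo ?corner_hi !eq_face; lia.
have cv : corner (face a b) (pos v).
  by rewrite vE /xend; case: (t); rewrite ?corner_lo ?corner_hi !eq_face; lia.
have uw : e u w.
  apply: (embeds_face ci); rewrite ?wE // uE /m /xend.
  by case: (t); rewrite ?hadj_lo ?hadj_hi !eq_vertex; lia.
have wv : e w v.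
  apply: (embeds_face ci); rewrite ?wE // vE /m /xend.
  by case: (t); rewrite ?hadj_lo ?hadj_hi !eq_vertex; lia.
split.
- have /= := @dist_leq _ e u [:: w; v]; apply; by rewrite uw wv.
- have /= := @dist_leq _ e v [:: w; u]; apply; by rewrite embeds_sym wv embeds_sym uw.
Qed.

Lemma dist_cut_run t b (m : nat) u v : b1 <= b -> b + m%:Z <= b2 ->
  pos u = xend t a b -> pos v = xend t a (b + m%:Z) ->
  (dist e u v <= 2 * m)%N /\ (dist e v u <= 2 * m)%N.
Proof.
move=> hb; elim: m v => [|m IH] v hm uE vE.
  rewrite addr0 -uE in vE; rewrite (embeds_inj emb vE).
  by have := @dist_leq _ e u [::] isT.
have hbm : b1 <= b + m%:Z < b2 by lia.
have cw : corner (face a (b + m%:Z)) (xend t a (b + m%:Z)).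
  by have /andP[] := corner_xend t a (b + m%:Z).
have [w wE] := embeds_corner (cut_inner hbm) cw.
have [h1 h2] := IH w ltac:(lia) uE wE.
have [h3 h4] : (dist e w v <= 2)%N /\ (dist e v w <= 2)%N.
  by apply: dist_cut_step hbm wE _; rewrite vE; congr xend; lia.
have := dist_triangle (embeds_connected u w) (embeds_connected w v).
have := dist_triangle (embeds_connected v w) (embeds_connected w u).
by split; lia.
Qed.

Lemma dist_cut t b b' u v : b1 <= b <= b2 -> b1 <= b' <= b2 ->
  pos u = xend t a b -> pos v = xend t a b' ->
  (dist e u v <= 2 * absz (b - b')%R)%N.
Proof.
move=> hb hb' uE vE; case: (leP b b') => bb.
  have vE' : pos v = xend t a (b + (absz (b - b')%R)%:Z) by rewrite vE; congr xend; lia.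
  have h1 : b1 <= b by lia.
  have h2 : b + (absz (b - b')%R)%:Z <= b2 by lia.
  by have [] := dist_cut_run h1 h2 uE vE'.
have uE' : pos u = xend t a (b' + (absz (b - b')%R)%:Z) by rewrite uE; congr xend; lia.
have h1 : b1 <= b' by lia.
have h2 : b' + (absz (b - b')%R)%:Z <= b2 by lia.
by have [] := dist_cut_run h1 h2 vE uE'.
Qed.

(* A shortest walk from x to v leaves the side of x across some edge of the cut;
   the rest of it is at least as long as the zigzag along the cut to u. *)
Lemma closer_side t b u v x : b1 <= b <= b2 ->
  pos u = xend t a b -> pos v = xend (~~ t) a b ->
  sd (pos x) = (t == tau) -> (dist e x u < dist e x v)%N.
Proof.
move=> hb uE vE sx.
have [p [ep lp <-]] := dist_walk (embeds_connected x v).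
have tt : (~~ t == tau) = ~~ (t == tau) by case: (t); case: tau.
have sv : sd (pos v) = ~~ (t == tau) by rewrite vE (side_cut emb C).
have [||q [y [r [pE hq hy]]]] := @path_exit _ e (fun w => sd (pos w) == (t == tau)) x p ep.
- by rewrite sx.
- by rewrite /= lp sv; case: (t == tau).
subst p; move: ep; rewrite cat_path /= => /and3P[eq eqy er].
set w := last x q in hq eqy.
have [b' [hb' wE yE]] : exists b', [/\ b1 <= b' <= b2, pos w = xend t a b'
    & pos y = xend (~~ t) a b'].
  have ne : sd (pos w) != sd (pos y) by rewrite (eqP hq) eq_sym.
  have h0 : forall b', b1 <= b' <= b2 -> pos w = vlo a b' -> pos y = vhi (a + 1) b' ->
      pos w = xend t a b' /\ pos y = xend (~~ t) a b'.
    move=> b' hb' e1 e2; move: hq; have /= := side_cut emb C false hb'.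
    by rewrite e1 e2 => -> ; case: (t); case: tau.
  have h1 : forall b', b1 <= b' <= b2 -> pos y = vlo a b' -> pos w = vhi (a + 1) b' ->
      pos w = xend t a b' /\ pos y = xend (~~ t) a b'.
    move=> b' hb' e1 e2; move: hq; have /= := side_cut emb C true hb'.
    by rewrite e1 e2 => -> ; case: (t); case: tau.
  have ewy := iffLR (embeds_edge emb _ _) eqy.
  case: (boolP [exists k : 'I_(absz (b2 - b1)%R).+1,
      ((pos w == vlo a (b1 + k%:Z)) && (pos y == vhi (a + 1) (b1 + k%:Z))) ||
      ((pos y == vlo a (b1 + k%:Z)) && (pos w == vhi (a + 1) (b1 + k%:Z)))]).
    case/existsP=> k hk; have hk' : b1 <= b1 + k%:Z <= b2.
      by move: (ltn_ord k) (cut_lt C); clear; lia.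
    exists (b1 + k%:Z); case/orP: hk => /andP[/eqP e1 /eqP e2].
    - by have [] := h0 _ hk' e1 e2.
    - by have [] := h1 _ hk' e1 e2.
  rewrite negb_exists => /forallP nk; case/negP: ne; apply/eqP.
  apply: (side_noncut emb C ewy) => b' hb'.
  have kP : (absz (b' - b1)%R < (absz (b2 - b1)%R).+1)%N by lia.
  have := nk (Ordinal kP); rewrite /= negb_or.
  have -> : b1 + (absz (b' - b1)%R)%:Z = b' by lia.
  by case/andP=> n1 n2; split=> -[e1 e2]; [move: n1|move: n2]; rewrite e1 e2 !eqxx.
have d1 : (dist e x w <= size q)%N by apply: dist_leq.
have d2 : (dist e w u <= 2 * absz (b' - b)%R)%N by apply: dist_cut wE uE.
have d3 : (2 * absz (b' - b)%R <= size r)%N.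
  have := walk_lower_bound er; move: lp; rewrite last_cat /= => ->; rewrite vE yE.
  by rewrite /xend; case: (~~ t); rewrite /coordy /coordz /=; lia.
have := dist_triangle (embeds_connected x w) (embeds_connected w u).
by rewrite size_cat /=; lia.
Qed.

Lemma closerE t b u v : b1 <= b <= b2 ->
  pos u = xend t a b -> pos v = xend (~~ t) a b ->
  closer e u v = [set x | sd (pos x) == (t == tau)].
Proof.
move=> hb uE vE; apply/setP => x; rewrite !inE.
case: (eqVneq (sd (pos x)) (t == tau)) => h; first exact: closer_side hb uE vE h.
apply/negbTE; rewrite -leqNgt ltnW //; apply: (@closer_side (~~ t) b) => //.
  by rewrite negbK.
by move: h; case: (sd (pos x)); case: (t); case: tau.
Qed.

Lemma closer_cut b u v : b1 <= b <= b2 ->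
  pos u = vlo a b -> pos v = vhi (a + 1) b ->
  2 * `|#|closer e u v|%:Z - #|closer e v u|%:Z|
  = `| \sum_(0 <= k < n) (1 + eps * vweight (z k) (z k.+1) (z k.+2))
       - 2 * \sum_(i <= k < j) (1 + eps * vweight (z k) (z k.+1) (z k.+2))|.
Proof.
move=> hb uE vE; rewrite -(card_vertices emb) -(card_arc_side emb C).
rewrite (@closerE false b u v) // (@closerE true b v u) //.
rewrite (eq_sym false) (eq_sym true) eqb_id eqbF_neg.
have := cardsC [set x | sd (pos x)].
have -> : ~: [set x | sd (pos x)] = [set x | sd (pos x) == false].
  by apply/setP => x; rewrite !inE; case: (sd _).
have -> : [set x | sd (pos x)] = [set x | sd (pos x) == true].
  by apply/setP => x; rewrite !inE; case: (sd _).
by case: tau => /=; lia.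
Qed.

Lemma card_arc_side_le :
  \sum_(i <= k < j) (1 + eps * vweight (z k) (z k.+1) (z k.+2))
  <= \sum_(0 <= k < n) (1 + eps * vweight (z k) (z k.+1) (z k.+2)).
Proof.
rewrite -(card_vertices emb) -(card_arc_side emb C).
by have := max_card [set x | sd (pos x)]; lia.
Qed.
End CutMetric.
End Metric.

(** * The Mostar index as a sum over cuts *)

Definition xdiff (Z : seq point) (k : nat) : int :=
  coordx (cvertex Z k.+1) - coordx (cvertex Z k).

(* Twice the row of the cut plus one, on a step that changes the first coordinate. *)
Definition xkey (Z : seq point) (k : nat) : int :=
  coordx (cvertex Z k) + coordx (cvertex Z k.+1).

Definition yval (Z : seq point) (k : nat) : int := coordy (cvertex Z k).

Definition prefix_weight (Z : seq point) (k : nat) : int :=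
  \sum_(0 <= m < k) vweight (cvertex Z m) (cvertex Z m.+1) (cvertex Z m.+2).

Definition cut_term (Z : seq point) (eps : int) (i j : nat) : int :=
  (yval Z j - yval Z i + 1) *
  `|(size Z)%:Z + eps * prefix_weight Z (size Z)
    - 2 * `|j%:Z - i%:Z + eps * (prefix_weight Z j - prefix_weight Z i)| |.

Definition left_partner (Z : seq point) (i j : nat) : Prop :=
  [/\ (i < size Z)%N, xdiff Z i != 0, xkey Z i = xkey Z j, yval Z i < yval Z j
    & forall m, (m < size Z)%N -> xdiff Z m != 0 -> xkey Z m = xkey Z j ->
        ~~ (yval Z i < yval Z m < yval Z j)].

Definition xpair (T : finType) (e : rel T) (pos : T -> point) (uv : T * T) : bool :=
  [&& e uv.1 uv.2, coord_sum (pos uv.1) == 0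
    & coordx (pos uv.2) == coordx (pos uv.1) + 1].

Definition imbalance (T : finType) (e : rel T) (uv : T * T) : int :=
  `|#|closer e uv.1 uv.2|%:Z - #|closer e uv.2 uv.1|%:Z|.

Section CutSum.
Variables (Z : seq point) (T : finType) (e : rel T) (pos : T -> point).
Hypothesis emb : embeds Z e pos.
Local Notation n := (size Z).
Local Notation z := (cvertex Z).
Local Notation wind := (winding Z).
Local Notation eps := (orientation Z).
Local Notation dx := (xdiff Z).
Local Notation key := (xkey Z).
Local Notation y := (yval Z).

Let Zcyc : lattice_cycle Z := embeds_cycle emb.

Lemma xstepP k : dx k != 0 -> exists a, key k = 2 * a + 1 /\
  ((dx k = 1 /\ (z k = vlo a (y k) /\ z k.+1 = vhi (a + 1) (y k))) \/
   (dx k = - 1 /\ (z k = vhi (a + 1) (y k) /\ z k.+1 = vlo a (y k)))).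
Proof.
rewrite /xdiff /xkey /yval.
by case/hadjP: (cvertex_step Zcyc k) => a b; rewrite /coordx /coordy /= => h;
  try lia; exists a; (split; first by lia); [left|right]; split=> //; lia.
Qed.

Lemma xstep_inj k l : dx k != 0 -> dx l != 0 -> key k = key l -> y k = y l ->
  (k < n)%N -> (l < n)%N -> k = l.
Proof.
move=> dk dl kl yy kn ln; have : k == l %[mod n].
  apply: (cvertex_edge_inj Zcyc); have [a1 [k1 c1]] := xstepP dk.
  have [a2 [k2 c2]] := xstepP dl.
  move: c1 c2; have -> : a2 = a1 by lia.
  rewrite yy; case=> -[_ [-> ->]]; case=> -[_ [-> ->]]; auto.
by rewrite !modn_small // => /eqP.
Qed.

Lemma xstep_winding k a : dx k != 0 -> key k = 2 * a + 1 ->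
  if dx k == eps then wind (face a (y k - 1)) = eps /\ wind (face a (y k)) = 0
  else wind (face a (y k - 1)) = 0 /\ wind (face a (y k)) = eps.
Proof.
move=> /xstepP[a' [-> h]] aa; have {aa} aE : a' = a by lia.
subst a'; have := orientation_lface Zcyc k; have := orientation_rface Zcyc k.
by case: h => -[-> [-> ->]]; rewrite !lfaceE;
  case: (orientation_cases Zcyc) => -> /=; lia.
Qed.

Lemma xstep_xedge k a : dx k != 0 -> key k = 2 * a + 1 -> xedge Z a (y k).
Proof.
move=> /xstepP[a' [-> h]] aa; have {aa} aE : a' = a by lia.
subst a'; have := cycle_edge_cvertex Zcyc k; rewrite /xedge.
by case: h => -[_ [-> ->]]; rewrite // cycle_edge_sym.
Qed.

Lemma xedge_xstep a b : xedge Z a b ->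
  exists k, [/\ (k < n)%N, dx k != 0, key k = 2 * a + 1 & y k = b].
Proof.
case/(xedge_index Zcyc)=> k kn hk; exists k; split=> //; rewrite /xdiff /xkey /yval;
  by case: hk => -[h1 h2]; rewrite ?h1 ?h2 /coordx /coordy /=; lia.
Qed.

Lemma orientation_neq0 : eps != 0.
Proof. by case: (orientation_cases Zcyc) => ->. Qed.

Lemma left_end_exists j : dx j = eps ->
  exists m, [/\ (m < n)%N, dx m != 0, key m = key j & y m < y j].
Proof.
move=> dj; have d0 : dx j != 0 by rewrite dj orientation_neq0.
have [a [ka _]] := xstepP d0.
have := xstep_winding d0 ka; rewrite dj eqxx => -[w _].
have [N N0 hN] := seq_bounded Z.
have zN k : `|coordy (z k)| <= N by have /and3P[] := hN _ (cvertex_in Zcyc k).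
have yj : `|y j| <= N by exact: zN.
case: (boolP (has (fun m => [&& dx m != 0, key m == key j & y m < y j]) (iota 0 n))).
  case/hasP=> m; rewrite mem_iota => mn /and3P[? /eqP ? ?]; by exists m.
move=> /hasPn no; case/eqP: orientation_neq0; rewrite -w.
have <- : wind (face a (- N - 1)) = 0.
  by apply: (winding_left Zcyc) => k; have := zN k; lia.
apply/esym/(conn_winding Zcyc)/conn_run; first lia.
move=> b hb; apply/negP => /xedge_xstep[k [kn dk kk yk]].
have := no k; rewrite mem_iota => /(_ kn); rewrite dk kk ka eqxx yk /=.
by lia.
Qed.

Lemma left_partner_cut i j a : (j < n)%N -> dx j = eps -> key j = 2 * a + 1 ->
  left_partner Z i j -> dx i = - eps /\
  cut Z i (if (i < j)%N then j else (j + n)%N) a (y i) (y j).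
Proof.
move=> jn dj ka [i_n di ki yij nob].
have d0 : dx j != 0 by rewrite dj orientation_neq0.
have := xstep_winding d0 ka; rewrite dj eqxx => -[wj _].
rewrite ka in ki nob.
have free b : y i < b < y j -> ~~ xedge Z a b.
  move=> hb; apply/negP => /xedge_xstep[k [kn dk kk yk]].
  by have := nob k kn dk kk; rewrite yk hb.
have wi : wind (face a (y i)) = eps.
  rewrite -wj; apply/(conn_winding Zcyc)/conn_run; first lia.
  by move=> b hb; apply: free; lia.
have e0 := orientation_neq0.
have die : dx i = - eps.
  have := xstep_winding di ki; case: eqP => [_ [_ w0]|ne _].
    by move: e0; rewrite -wi w0.
  by have [a' [_ []]] := xstepP di => -[d1 _]; have := orientation_cases Zcyc; lia.
split=> //.
have [a1 [k1 h1]] := xstepP di; have [a2 [k2 h2]] := xstepP d0.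
have a1E : a1 = a by lia.
have a2E : a2 = a by lia.
subst a1 a2.
have zj : z (if (i < j)%N then j else (j + n)%N) = z j by case: ifP; rewrite ?cvertexD.
have zj1 : z (if (i < j)%N then j else (j + n)%N).+1 = z j.+1.
  by case: ifP; rewrite // -addSn cvertexD.
have ij : i != j by apply: contraTneq yij => ->; rewrite ltxx.
split=> //; rewrite ?zj ?zj1.
- by case: ifP; lia.
- by case: h1 => -[d1 [-> _]]; case: (orientation_cases Zcyc) => eE; rewrite eE /xend //=; lia.
- by case: h1 => -[d1 [_ ->]]; case: (orientation_cases Zcyc) => eE; rewrite eE /xend //=; lia.
- by case: h2 => -[d1 [-> _]]; case: (orientation_cases Zcyc) => eE; rewrite eE /xend //=; lia.
- by case: h2 => -[d1 [_ ->]]; case: (orientation_cases Zcyc) => eE; rewrite eE /xend //=; lia.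
Qed.

Lemma sum_prefix i j : (i <= j)%N ->
  \sum_(i <= k < j) (1 + eps * vweight (z k) (z k.+1) (z k.+2))
  = j%:Z - i%:Z + eps * (prefix_weight Z j - prefix_weight Z i).
Proof.
move=> ij; rewrite big_split /= -mulr_sumr; congr (_ + _ * _).
  by rewrite sumr_const_nat natz; lia.
have -> : prefix_weight Z j = prefix_weight Z i
    + \sum_(i <= k < j) vweight (z k) (z k.+1) (z k.+2).
  by rewrite /prefix_weight -big_cat_nat.
by rewrite addrC addKr.
Qed.

Lemma cut_imbalance i j a u v b : (j < n)%N -> dx j = eps -> key j = 2 * a + 1 ->
  left_partner Z i j -> y i <= b <= y j -> pos u = vlo a b -> pos v = vhi (a + 1) b ->
  2 * imbalance e (u, v) =
  `|n%:Z + eps * prefix_weight Z n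
    - 2 * `|j%:Z - i%:Z + eps * (prefix_weight Z j - prefix_weight Z i)| |.
Proof.
move=> jn dj ka lp hb uE vE; have [_ C] := left_partner_cut jn dj ka lp.
rewrite /imbalance /= (closer_cut emb C hb uE vE).
have tot := sum_prefix (leq0n n).
have le := card_arc_side_le emb C; have Oij := cut_order C.
have ge0 := card_arc_side emb C.
have p0 : prefix_weight Z 0 = 0 by rewrite /prefix_weight big_geq.
rewrite p0 !subr0 in tot.
move: C le ge0 Oij; case: ifP => ij C le ge0 Oij.
  rewrite tot in le *; rewrite sum_prefix in le ge0 *; [|lia..]; lia.
have ji : (j < i)%N by case: ltngtP ij (Oij) => // ->; lia.
have per : forall k, 1 + eps * vweight (z (k + n)) (z (k + n).+1) (z (k + n).+2)
    = 1 + eps * vweight (z k) (z k.+1) (z k.+2).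
  by move=> k; rewrite -!addSn !cvertexD.
have cyc := sum_period j per.
rewrite (big_cat_nat (n := i)) /= in cyc; [|lia..].
rewrite tot in le cyc *; rewrite (sum_prefix (i := j)) in cyc; last lia.
have E (x t d : int) : x <= t -> - d + x = t -> `|t - 2 * x| = `|t - 2 * `|d| | by lia.
apply: E le _; rewrite -[RHS]cyc; congr (_ + _).
by rewrite -(opprB (prefix_weight Z i)) mulrN; lia.
Qed.

Lemma xpairP uv : xpair e pos uv -> exists a b, [/\ pos uv.1 = vlo a b,
  pos uv.2 = vhi (a + 1) b & inner Z (face a (b - 1)) || inner Z (face a b)].
Proof.
case/and3P=> /(embeds_edge emb)/(edge_inner Zcyc)[uv1 hin] s0 s1.
move: uv1 hin s0 s1 => /hadjP[] a b; rewrite !lfaceE ?vlo_sum ?vhi_sum //.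
- by move=> hin _ _; exists a, b.
- by rewrite /coordx /=; lia.
- by rewrite /coordx /=; lia.
Qed.

Section Partners.
Variable partner : nat -> nat.
Hypothesis partnerP : forall j, (j < n)%N -> dx j = eps -> left_partner Z (partner j) j.

Definition in_cut (j : nat) (uv : T * T) : bool :=
  (2 * coordx (pos uv.1) + 1 == key j)
  && (y (partner j) <= coordy (pos uv.1) <= y j).

Lemma in_cut_unique uv : xpair e pos uv ->
  \sum_(j < n | dx j == eps) Posz (in_cut j uv) = 1.
Proof.
case/xpairP=> a [b [uE vE hin]].
have inE j : in_cut j uv = (2 * a + 1 == key j) && (y (partner j) <= b <= y j).
  by rewrite /in_cut uE.
have e0 := orientation_neq0.
have [j0 [jn dj kj yj fr]] : exists j0, [/\ (j0 < n)%N, dx j0 = eps, key j0 = 2 * a + 1,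
    b <= y j0 & forall b', b < b' < y j0 -> ~~ xedge Z a b'].
  case: (boolP (inner Z (face a b))) => ib.
    have /andP[_ /eqP wb] := ib.
    have [no|[b' [bb' xb' no]]] := next_xedge Z a b.
      by move: e0; rewrite -wb winding_far.
    have [k [kn dk kk yk]] := xedge_xstep xb'.
    exists k; rewrite yk; split=> //; last lia.
    have := xstep_winding dk kk; case: eqP => // _ [w0 _]; move: e0.
    have wE : wind (face a b) = wind (face a (b' - 1)).
      apply/(conn_winding Zcyc)/conn_run; first lia.
      by move=> b'' hb; apply: no; lia.
    by rewrite -wb wE -yk w0 eqxx.
  rewrite (negbTE ib) orbF in hin; have /andP[_ /eqP w1] := hin.
  have w0 := inner_neg Zcyc (hface_face a b) ib.
  have xb : xedge Z a b.
    apply: contraT => nx; have := conn_winding Zcyc (conn_right nx).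
    by rewrite w0 w1 => /eqP; rewrite (negbTE e0).
  have [k [kn dk kk yk]] := xedge_xstep xb.
  exists k; rewrite yk; split=> //; last by move=> b'; lia.
  have := xstep_winding dk kk; case: eqP => // _ [w2 _]; move: e0.
  by rewrite -w1 -w2 yk eqxx.
have inj0 : in_cut j0 uv.
  rewrite inE kj eqxx /=; have [pn dp kp yp nob] := partnerP jn dj.
  rewrite yj andbT leNgt; apply/negP => h.
  have := fr (y (partner j0)); rewrite h yp => /(_ isT)/negP; apply.
  by apply: xstep_xedge; rewrite // kp.
rewrite (bigD1 (Ordinal jn)) /=; last by rewrite dj.
rewrite inj0 big1 ?addr0 // => j /andP[/eqP dj' nj]; apply/eqP.
rewrite eqz_nat eqb0; apply/negP => inj.
have jn' := ltn_ord j.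
move: inj0 inj; rewrite !inE => /andP[/eqP k0 h0] /andP[/eqP kj' h1].
have [pn dp kp yp nob] := partnerP jn dj.
have [pn' dp' kp' yp' nob'] := partnerP jn' dj'.
have d0 : dx j0 != 0 by rewrite dj.
have d0' : dx j != 0 by rewrite dj'.
have same k l : dx k != 0 -> dx l != 0 -> key k = 2 * a + 1 -> key l = 2 * a + 1 ->
    y k = y l -> (k < n)%N -> (l < n)%N -> k = l.
  by move=> dk dl kk kl yy kn ln; apply: xstep_inj => //; rewrite kk kl.
case: (ltgtP (y j) (y j0)) => [lt|gt|eq].
- case: (ltgtP (y (partner j0)) (y j)) => [l1|l1|eq1]; first 2 last.
  + have e1 : partner j0 = j by apply: same => //; rewrite ?kp.
    have [di _] := left_partner_cut jn dj (esym k0) (partnerP jn dj).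
    by move: di; rewrite e1 dj'; have := orientation_cases Zcyc; lia.
  + by have := nob j jn' d0'; rewrite -kj' k0 => /(_ erefl); rewrite l1 lt.
  + by lia.
- case: (ltgtP (y (partner j)) (y j0)) => [l1|l1|eq1]; first 2 last.
  + have e1 : partner j = j0 by apply: same => //; rewrite ?kp' -?kj'.
    have [di _] := left_partner_cut jn' dj' (esym kj') (partnerP jn' dj').
    by move: di; rewrite e1 dj; have := orientation_cases Zcyc; lia.
  + by have := nob' j0 jn d0; rewrite -k0 kj' => /(_ erefl); rewrite l1 gt.
  + by lia.
- have e1 : nat_of_ord j = j0 by apply: same => //; rewrite -?kj'.
  by case/eqP: nj; apply: val_inj.
Qed.

Lemma count_in_cut j : (j < n)%N -> dx j = eps ->
  \sum_(uv | xpair e pos uv) Posz (in_cut j uv) = y j - y (partner j) + 1.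
Proof.
move=> jn dj; have lp := partnerP jn dj.
have d0 : dx j != 0 by rewrite dj orientation_neq0.
have [a [ka _]] := xstepP d0; have [_ C] := left_partner_cut jn dj ka lp.
have yij := cut_lt C.
have -> : \sum_(uv | xpair e pos uv) Posz (in_cut j uv)
    = Posz #|[set uv | xpair e pos uv && in_cut j uv]|.
  rewrite -natz -sum1dep_card natr_sum [RHS]big_mkcondr /=; apply: eq_bigr => uv _.
  by case: (in_cut j uv).
pose A := [set uv | xpair e pos uv && in_cut j uv].
pose m := absz (y j - y (partner j) + 1)%R.
have AP uv : uv \in A -> exists b, [/\ pos uv.1 = vlo a b, pos uv.2 = vhi (a + 1) b
    & y (partner j) <= b <= y j].
  rewrite inE => /andP[/xpairP[a' [b [uE vE _]]]]; rewrite /in_cut uE ka => h.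
  have aE : a' = a by move: h; rewrite /coordx /=; lia.
  by subst a'; exists b; split=> //; move: h; rewrite /coordy /=; lia.
have -> : #|A| = m.
  rewrite cardE -(size_map (fun uv : T * T => coordy (pos uv.1))) -(size_iota 0 m).
  rewrite -(size_map (fun k : nat => y (partner j) + k%:Z) (iota 0 m)).
  apply: perm_size; apply: uniq_perm.
  - rewrite map_inj_in_uniq ?enum_uniq // => -[u v] [u' v']; rewrite !mem_enum.
    move=> /AP[b [/= uE vE _]] /AP[b' [/= uE' vE' _]]; rewrite uE uE' /coordy /= => bb.
    by subst b'; rewrite -uE in uE'; rewrite -vE in vE';
       rewrite (embeds_inj emb uE') (embeds_inj emb vE').
  - by rewrite map_inj_uniq ?iota_uniq // => k l; lia.
  move=> b; apply/mapP/mapP => [[uv]|[k]].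
    rewrite mem_enum => /AP[b' [uE vE hb]]; rewrite uE /coordy /= => ->.
    by exists (absz (b' - y (partner j))%R); [rewrite mem_iota /m|]; lia.
  rewrite mem_iota => hk bE; have hb : y (partner j) <= b <= y j by rewrite /m in hk; lia.
  have [c ci cE] : exists2 c, inner Z c & c = face a (b - 1) \/ c = face a b.
    case: (ltP b (y j)) => hbj.
      by exists (face a b); [apply: (cut_inner emb C); lia|right].
    by exists (face a (b - 1)); [apply: (cut_inner emb C); lia|left].
  have cu : corner c (vlo a b) by case: cE => ->; rewrite corner_lo !eq_face; lia.
  have cv : corner c (vhi (a + 1) b) by case: cE => ->; rewrite corner_hi !eq_face; lia.
  have [u uE] := embeds_corner emb ci cu; have [v vE] := embeds_corner emb ci cv.
  exists (u, v); last by rewrite /= uE.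
  rewrite mem_enum inE /xpair /in_cut /= uE vE vlo_sum eqxx ka /coordx /coordy /=.
  rewrite !eqxx hb !andbT; apply: (embeds_face emb ci); rewrite ?uE ?vE //.
  exact: hadj_xedge.
by rewrite /m; lia.
Qed.

Theorem cut_sum : 2 * \sum_(uv | xpair e pos uv) imbalance e uv
  = \sum_(j < n | dx j == eps) cut_term Z eps (partner j) j.
Proof.
rewrite (eq_bigr (fun uv => \sum_(j < n | dx j == eps)
    Posz (in_cut j uv) * imbalance e uv)); last first.
  by move=> uv /in_cut_unique h; rewrite -mulr_suml h mul1r.
rewrite exchange_big /= mulr_sumr; apply: eq_bigr => j /eqP dj.
have jn := ltn_ord j; have lp := partnerP jn dj.
have d0 : dx j != 0 by rewrite dj orientation_neq0.
have [a [ka _]] := xstepP d0.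
rewrite mulr_sumr /cut_term -(count_in_cut jn dj) mulr_suml.
apply: eq_bigr => uv /xpairP[a' [b [uE vE _]]].
case: (boolP (in_cut j uv)); last by rewrite !mul0r mulr0.
rewrite /in_cut uE ka => h; rewrite !mul1r.
have aE : a' = a by move: h; rewrite /coordx /=; lia.
subst a'; case: uv uE vE h => u v /= uE vE h.
rewrite (@cut_imbalance (partner j) j a u v b) //.
by move: h; rewrite /coordy /=; lia.
Qed.
End Partners.
End CutSum.

Lemma orientation_prefix (Z : seq point) (T : finType) (e : rel T) (pos : T -> point) :
  embeds Z e pos -> 0 < orientation Z * prefix_weight Z (size Z).
Proof.
move=> emb; have Zcyc := embeds_cycle emb.
have := card_vertices emb; rewrite (sum_prefix Z (leq0n _)).
have -> : prefix_weight Z 0 = 0 by rewrite /prefix_weight big_geq.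
have : (size Z <= #|T|)%N.
  rewrite cardT -(size_map pos); apply: uniq_leq_size; first exact: cycle_uniq.
  move=> p /(cvertexP Zcyc)[k _ <-]; have [x <-] := cvertex_embeds emb k.
  by rewrite map_f ?mem_enum.
by have := size_gt0 Zcyc; rewrite !subr0; lia.
Qed.

Definition rotate (p : point) : point := (coordy p, coordz p, coordx p).

Lemma rotate3 p : rotate (rotate (rotate p)) = p.
Proof. by case: p => [[]]. Qed.

Lemma rotate_inj : injective rotate.
Proof. exact: (@can_inj _ _ rotate (rotate \o rotate) rotate3). Qed.

Lemma hvertex_rotate p : hvertex (rotate p) = hvertex p.
Proof. by case: p => [[a b] c]; rewrite /rotate; unfold_lattice; lia. Qed.

Lemma hadj_rotate u v : hadj (rotate u) (rotate v) = hadj u v.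
Proof.
by case: u v => [[a b] c] [[a' b'] c']; rewrite /rotate; unfold_lattice; lia.
Qed.

Lemma corner_rotate u v : corner (rotate u) (rotate v) = corner u v.
Proof.
by case: u v => [[a b] c] [[a' b'] c']; rewrite /rotate; unfold_lattice; lia.
Qed.

Lemma hface_rotate c : hface (rotate c) = hface c.
Proof. by case: c => [[a b] c]; rewrite /rotate; unfold_lattice; lia. Qed.

Lemma next_rotate Z p : next (map rotate Z) (rotate p) = rotate (next Z p).
Proof.
rewrite !next_nth (mem_map rotate_inj) (index_map rotate_inj); case: ifP => // _.
case: Z => //= q s; case: (ltnP (index p (q :: s)) (size s)) => h.
  by rewrite (nth_map q).
by rewrite !nth_default ?size_map.
Qed.

Lemma cycle_edge_rotate Z u v :
  cycle_edge (map rotate Z) (rotate u) (rotate v) = cycle_edge Z u v.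
Proof.
rewrite /cycle_edge !(mem_map rotate_inj) !next_rotate.
by rewrite !(inj_eq rotate_inj).
Qed.

Lemma map_rotate3 Z : map rotate (map rotate (map rotate Z)) = Z.
Proof. by rewrite -!map_comp -[RHS]map_id; apply: eq_map => p; apply: rotate3. Qed.

Lemma lattice_cycle_rotate Z : lattice_cycle Z -> lattice_cycle (map rotate Z).
Proof.
case=> /andP[cZ uZ] sZ; rewrite /lattice_cycle size_map; split=> //.
rewrite /ucycle (map_inj_uniq rotate_inj) uZ andbT cycle_map.
by rewrite (eq_cycle (e' := hadj)) // => u v /=; rewrite hadj_rotate.
Qed.

Lemma face_step_rotate Z c d : face_step Z c d ->
  face_step (map rotate Z) (rotate c) (rotate d).
Proof.
case=> u [v [uv nc hc hd]]; exists (rotate u), (rotate v).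
by rewrite hadj_rotate cycle_edge_rotate !corner_rotate.
Qed.

Lemma face_conn_rotate Z c d : face_conn Z c d ->
  face_conn (map rotate Z) (rotate c) (rotate d).
Proof.
elim=> [x y /face_step_rotate h|x|x y w _ h1 _ h2]; [exact: rt_step|exact: rt_refl|].
exact: rt_trans h1 h2.
Qed.

Lemma interior_rotate Z c : interior_face Z c ->
  interior_face (map rotate Z) (rotate c).
Proof.
case=> hc [N hN]; split; first by rewrite hface_rotate.
exists N => d cd; have := face_conn_rotate (face_conn_rotate cd).
by rewrite map_rotate3 rotate3 => /hN[] *.
Qed.

Lemma interior_rotateE Z c : interior_face (map rotate Z) (rotate c) <-> interior_face Z c.
Proof.
split; last exact: interior_rotate.
by move/interior_rotate/interior_rotate; rewrite map_rotate3 rotate3.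
Qed.

Lemma all_rotate (P : point -> Prop) : (forall c, P (rotate c)) -> forall c, P c.
Proof. by move=> h c; rewrite -(rotate3 c). Qed.

Lemma vertex_rotate Z p :
  vertex_on_or_inside (map rotate Z) (rotate p) <-> vertex_on_or_inside Z p.
Proof.
rewrite /vertex_on_or_inside hvertex_rotate (mem_map rotate_inj).
split=> -[hp [|h]]; split=> //; [by left|right|by left|right].
- by move=> c cp; apply/interior_rotateE/h; rewrite corner_rotate.
- by apply: all_rotate => c; rewrite corner_rotate => cp; apply/interior_rotateE/h.
Qed.

Lemma edge_rotate Z u v :
  edge_on_or_inside (map rotate Z) (rotate u) (rotate v) <-> edge_on_or_inside Z u v.
Proof.
rewrite /edge_on_or_inside hadj_rotate cycle_edge_rotate.
split=> -[hp [|h]]; split=> //; [by left|right|by left|right].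
- by move=> c cu cv; apply/interior_rotateE/h; rewrite corner_rotate.
- by apply: all_rotate => c; rewrite !corner_rotate => cu cv; apply/interior_rotateE/h.
Qed.

Lemma embeds_rotate Z (T : finType) (e : rel T) (pos : T -> point) :
  embeds Z e pos -> embeds (map rotate Z) e (rotate \o pos).
Proof.
case=> c i v d; split.
- exact: lattice_cycle_rotate.
- exact: inj_comp rotate_inj i.
- apply: all_rotate => p; rewrite vertex_rotate v.
  by split=> -[x] => [<-|/rotate_inj]; exists x.
- by move=> x y; rewrite d edge_rotate.
Qed.

Lemma mostar_xpairs Z (T : finType) (e : rel T) (pos : T -> point) : embeds Z e pos ->
  Posz (mostar e) = \sum_(uv | xpair e pos uv) imbalance e uv
    + \sum_(uv | xpair e (rotate \o pos) uv) imbalance e uv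
    + \sum_(uv | xpair e (rotate \o (rotate \o pos)) uv) imbalance e uv.
Proof.
move=> emb; have es := embeds_sym emb.
have hs uv : imbalance e (uv.2, uv.1) = imbalance e uv by rewrite /imbalance distrC.
pose s (uv : T * T) := coord_sum (pos uv.1) == 0.
have sC uv : e uv.1 uv.2 -> s (uv.2, uv.1) = ~~ s uv.
  move=> /(embeds_edge emb)[/hadjP + _]; rewrite /s /=.
  by case=> a b; rewrite vlo_sum vhi_sum.
pose r (uv : T * T) := (enum_rank uv.1 < enum_rank uv.2)%N.
have rC uv : e uv.1 uv.2 -> r (uv.2, uv.1) = ~~ r uv.
  move=> euv; rewrite /r /= -leqNgt ltn_neqAle.
  suff -> : nat_of_ord (enum_rank uv.2) != enum_rank uv.1 by [].
  apply: contraTneq euv => /ord_inj/enum_rank_inj ->; apply/negP => euu.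
  by have := sC (uv.1, uv.1) euu; case: (s _).
have -> : Posz (mostar e) = \sum_(uv | e uv.1 uv.2 && r uv) imbalance e uv.
  rewrite /mostar (big_morph Posz PoszD (erefl (Posz 0))); apply: eq_bigr => uv _.
  by rewrite abszE.
have -> : \sum_(uv | e uv.1 uv.2 && r uv) imbalance e uv
    = \sum_(uv | e uv.1 uv.2 && s uv) imbalance e uv.
  rewrite (bigID s) /= [RHS](bigID r) /=; congr (_ + _).
    by apply: eq_bigl => uv; rewrite andbAC.
  rewrite (reindex_inj (h := fun uv : T * T => (uv.2, uv.1))) /=; last first.
    by move=> [u v] [u' v'] [-> ->].
  apply: eq_big => uv; last by rewrite hs.
  rewrite es; case: (boolP (e uv.1 uv.2)) => //= euv.
  by rewrite sC // rC // negbK andbC.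
rewrite [LHS]big_mkcond [X in _ = X + _ + _]big_mkcond.
rewrite [X in _ = _ + X + _]big_mkcond [X in _ = _ + X]big_mkcond -!big_split /=.
apply: eq_bigr => uv _; rewrite /xpair /s.
case: (boolP (e uv.1 uv.2)) => //= /(embeds_edge emb)[/hadjP uvE _].
have rs p : coord_sum (rotate p) = coord_sum p.
  by case: p => [[a b] c]; rewrite /rotate; unfold_lattice; lia.
rewrite !rs; case: uvE => a b; rewrite ?vlo_sum ?vhi_sum //= /rotate /coordx /coordy /coordz /=;
  by repeat case: ifP; lia.
Qed.

(** * The program *)

Fixpoint loop_free (c : cmd) : bool :=
  match c with
  | Skip | Assign _ _ | Write _ _ => true
  | Seq c1 c2 | If _ c1 c2 => loop_free c1 && loop_free c2
  | While _ _ => false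
  end.

Fixpoint run (c : cmd) (s : state) : state :=
  match c with
  | Skip | While _ _ => s
  | Assign r a => set_reg s r (eval a s)
  | Write a b => set_memory s (eval a s) (eval b s)
  | Seq c1 c2 => run c2 (run c1 s)
  | If b c1 c2 => if eval b s == 0 then run c2 s else run c1 s
  end.

Fixpoint max_cost (c : cmd) : nat :=
  match c with
  | Skip | While _ _ => 1
  | Assign _ a => (ecost a).+1
  | Write a b => (ecost a + ecost b).+1
  | Seq c1 c2 => max_cost c1 + max_cost c2
  | If b c1 c2 => (ecost b + (max_cost c1 + max_cost c2)).+1
  end.

Lemma exec_run c s : loop_free c ->
  exists2 t, (t <= max_cost c)%N & exec c s t (run c s).
Proof.
elim: c s => [|r a|a b|c1 IH1 c2 IH2|b c1 IH1 c2 IH2|//] s /=.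
- by exists 1%N => //; constructor.
- by exists (ecost a).+1 => //; constructor.
- by exists (ecost a + ecost b).+1 => //; constructor.
- case/andP=> /(IH1 s)[t1 h1 e1] /(IH2 (run c1 s))[t2 h2 e2].
  by exists (t1 + t2)%N; [apply: leq_add|apply: ExecSeq e1 e2].
- case/andP=> /(IH1 s)[t1 h1 e1] /(IH2 s)[t2 h2 e2].
  case: eqP => [b0|/eqP b0].
  + by exists (ecost b + t2).+1; [lia|apply: ExecIfFalse].
  + by exists (ecost b + t1).+1; [lia|apply: ExecIfTrue].
Qed.

Lemma exec_while (b : expr) (c : cmd) (I : nat -> state -> Prop) (B : nat -> nat) m :
  (forall k s, (k < m)%N -> I k s -> eval b s != 0 /\
     exists t s', [/\ exec c s t s', (t <= B k)%N & I k.+1 s']) ->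
  (forall s, I m s -> eval b s = 0) ->
  forall s, I 0%N s -> exists t s',
    [/\ exec (While b c) s t s', I m s' &
        (t <= \sum_(0 <= k < m) (B k + (ecost b).+1) + (ecost b).+1)%N].
Proof.
move=> step stop s I0.
suff h d k s1 : (k + d = m)%N -> I k s1 -> exists t s',
    [/\ exec (While b c) s1 t s', I m s' &
        (t <= \sum_(k <= l < m) (B l + (ecost b).+1) + (ecost b).+1)%N].
  by apply: (h m) => //.
elim: d k s1 => [|d IH] k s1 kd Ik.
  rewrite addn0 in kd; subst k; exists (ecost b).+1, s1; split=> //.
    by apply: ExecWhileFalse; apply: stop.
  by rewrite big_geq.
have km : (k < m)%N by lia.
have [b1 [t1 [s2 [e1 h1 I1]]]] := step k s1 km Ik.
have [||t2 [s3 [e2 I2 h2]]] := IH k.+1 s2; [lia|done|].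
exists (ecost b + t1 + t2).+1, s3; split=> //; first exact: ExecWhileTrue e1 e2.
by rewrite big_ltn //; lia.
Qed.

Definition addr (arr : nat) (i : int) : int := - 1 - (12 * i + arr%:Z).

Lemma addr_eq arr arr' i i' : (arr < 12)%N -> (arr' < 12)%N ->
  (addr arr i == addr arr' i') = (arr == arr') && (i == i').
Proof. by rewrite /addr; lia. Qed.

Lemma addr_Posz arr i (k : nat) : 0 <= i -> (Posz k == addr arr i) = false.
Proof. by rewrite /addr; lia. Qed.

Definition eAdd := Bin OpAdd.
Definition eSub := Bin OpSub.
Definition eMul := Bin OpMul.
Definition eDiv := Bin OpDiv.
Definition eEq := Bin OpEq.
Definition eLt := Bin OpLt.
Definition num (k : nat) : expr := Const k%:Z.

Definition eMod (a : expr) : expr := eSub a (eMul (Reg 0) (eDiv a (Reg 0))).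

Definition eAbs (r : nat) : expr :=
  eMul (Reg r) (eSub (num 1) (eMul (num 2) (eLt (Reg r) (num 0)))).

(* Coordinate c of vertex number a, modulo |Z|, of the cycle whose coordinates have
   been rotated d times. *)
Definition eCoord (d c : nat) (a : expr) : expr :=
  Read (eAdd (eMul (num 3) (eMod a)) (num ((c + d) %% 3))).

Definition eAddr (arr : nat) (i : expr) : expr :=
  eSub (Const (- 1)) (eAdd (eMul (num 12) i) (num arr)).

Definition eWeight (d : nat) (a : expr) : expr :=
  let b := eAdd a (num 1) in let c := eAdd a (num 2) in
  let D := eSub (eCoord d 0 c) (eCoord d 0 a) in
  eAdd (eMul (eMul (num 2) D) (eCoord d 1 b))
    (eAdd D
      (eMul (eMul (eSub (num 1) (eMul D D)) (eSub (eCoord d 1 c) (eCoord d 1 a)))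
         (eSub (eMul (num 2) (eAdd (eAdd (eCoord d 0 b) (eCoord d 1 b)) (eCoord d 2 b)))
               (num 1)))).

Definition rotated (d : nat) (Z : seq point) : seq point := iter d (map rotate) Z.

Definition input_ok (Z : seq point) (s : state) : Prop :=
  regs s 0 = (size Z)%:Z /\ forall k : nat, memory s (Posz k) = nth 0 (encode Z) k.

Lemma input_ok_reg Z s r v : r != 0%N -> input_ok Z s -> input_ok Z (set_reg s r v).
Proof. by move=> r0 [h1 h2]; split=> //=; rewrite eq_sym (negbTE r0). Qed.

Lemma input_ok_memory Z s arr i v : 0 <= i -> input_ok Z s ->
  input_ok Z (set_memory s (addr arr i) v).
Proof. by move=> i0 [h1 h2]; split=> //= k; rewrite addr_Posz. Qed.

Lemma size_rotated d Z : size (rotated d Z) = size Z.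
Proof. by elim: d => //= d IH; rewrite size_map IH. Qed.

Lemma cvertex_rotate Z k : cvertex (map rotate Z) k = rotate (cvertex Z k).
Proof.
rewrite /cvertex size_map; move: (k %% _)%N => i.
case: (ltnP i (size Z)) => h; first by rewrite (nth_map (0, 0, 0)).
by rewrite !nth_default ?size_map.
Qed.

Lemma nth_encode Z k c : (k < size Z)%N -> (c < 3)%N ->
  nth 0 (encode Z) (3 * k + c)
  = let p := nth (0, 0, 0) Z k in nth 0 [:: coordx p; coordy p; coordz p] c.
Proof.
rewrite /encode; elim: Z k => //= p Z IH [|k] kn cn.
  by rewrite muln0 add0n; move: cn; case: (c) => [|[|[|]]].
by rewrite mulnS -addnA /= IH.
Qed.

Lemma eval_eMod Z s a k : (0 < size Z)%N -> input_ok Z s -> eval a s = Posz k ->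
  eval (eMod a) s = Posz (k %% size Z).
Proof.
move=> n0 [h _] ak; rewrite /= h ak divz_nat {1}(divn_eq k (size Z)); lia.
Qed.

Lemma eval_eCoord Z s d c a k : (0 < size Z)%N -> (d < 3)%N -> (c < 3)%N ->
  input_ok Z s -> eval a s = Posz k ->
  eval (eCoord d c a) s =
  let p := cvertex (rotated d Z) k in nth 0 [:: coordx p; coordy p; coordz p] c.
Proof.
move=> n0 d3 c3 ok ak; have := eval_eMod n0 ok ak; case: (ok) => _ hm.
rewrite /eCoord /= => ->.
have -> : 3%:Z * Posz (k %% size Z) + Posz ((c + d) %% 3)
    = Posz (3 * (k %% size Z) + (c + d) %% 3) by lia.
rewrite hm nth_encode ?ltn_mod //.
case: d d3 => [|[|[|]]] // _; case: c c3 => [|[|[|]]] // _;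
by rewrite /rotated /= ?cvertex_rotate.
Qed.

Lemma eval_eWeight Z s d a k : (0 < size Z)%N -> (d < 3)%N ->
  input_ok Z s -> eval a s = Posz k ->
  eval (eWeight d a) s = vweight (cvertex (rotated d Z) k)
    (cvertex (rotated d Z) k.+1) (cvertex (rotated d Z) k.+2).
Proof.
move=> n0 d3 ok ak.
have ak1 : eval (eAdd a (num 1)) s = Posz k.+1 by rewrite /= ak; lia.
have ak2 : eval (eAdd a (num 2)) s = Posz k.+2 by rewrite /= ak; lia.
have E c b l := @eval_eCoord Z s d c b l n0 d3.
have evA x y : eval (eAdd x y) s = eval x s + eval y s by [].
have evM x y : eval (eMul x y) s = eval x s * eval y s by [].
have evS x y : eval (eSub x y) s = eval x s - eval y s by [].
have evN m : eval (num m) s = m%:Z by [].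
rewrite /eWeight; cbv zeta; move: ak1 ak2.
set b := eAdd a (num 1); set c := eAdd a (num 2) => ak1 ak2.
have E0 b' l := E 0%N b' l isT ok; have E1 b' l := E 1%N b' l isT ok.
have E2 b' l := E 2%N b' l isT ok.
rewrite !(evA, evM, evS) !(E0 _ _ ak, E1 _ _ ak, E0 _ _ ak1, E1 _ _ ak1, E2 _ _ ak1).
rewrite !(E0 _ _ ak2, E1 _ _ ak2) !evN.
by rewrite /vweight /turn /coord_sum /=.
Qed.

Section Order.
Variables (Z : seq point) (T : finType) (e : rel T) (pos : T -> point).
Hypothesis emb : embeds Z e pos.
Local Notation n := (size Z).
Local Notation z := (cvertex Z).
Local Notation eps := (orientation Z).
Local Notation dx := (xdiff Z).
Local Notation key := (xkey Z).
Local Notation y := (yval Z).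

Let Zcyc : lattice_cycle Z := embeds_cycle emb.

Lemma cvertex_lipschitz k :
  `|coordx (z k) - coordx (z 0)| <= k%:Z /\ `|coordy (z k) - coordy (z 0)| <= k%:Z.
Proof.
elim: k => [|k [IH1 IH2]]; first by rewrite !subrr.
move: IH1 IH2; case/hadjP: (cvertex_step Zcyc k) => a b; rewrite /coordx /coordy /=; lia.
Qed.

Definition yindex (m : nat) : int := y m - y 0 + n%:Z.
Definition kindex (kappa : int) : int := kappa - key 0 + (2 * n)%:Z.

Lemma yindex_bound m : (m < n)%N -> 0 <= yindex m < (2 * n).+1%:Z.
Proof.
by rewrite /yindex /yval => mn; have [_] := cvertex_lipschitz m; lia.
Qed.

Lemma kindex_ge0 m : (m < n)%N -> 0 <= kindex (key m).
Proof.
rewrite /kindex /xkey => mn; have [h1 _] := cvertex_lipschitz m.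
have [h2 _] := cvertex_lipschitz m.+1; have [h3 _] := cvertex_lipschitz 1; lia.
Qed.

Definition bucket (k : nat) (b : int) : seq nat :=
  [seq m <- rev (iota 0 k) | (dx m != 0) && (yindex m == b)].

Lemma bucketS k b : bucket k.+1 b =
  if (dx k != 0) && (yindex k == b) then k :: bucket k b else bucket k b.
Proof. by rewrite /bucket -addn1 iotaD rev_cat /= add0n. Qed.

Lemma mem_bucket k b m :
  (m \in bucket k b) = [&& (m < k)%N, dx m != 0 & yindex m == b].
Proof. by rewrite mem_filter mem_rev mem_iota add0n andbC. Qed.

Lemma bucket_uniq k b : uniq (bucket k b).
Proof. by rewrite filter_uniq // rev_uniq iota_uniq. Qed.

Definition before (b : nat) : seq nat := flatten [seq bucket n c%:Z | c <- iota 0 b].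

Lemma beforeS b : before b.+1 = before b ++ bucket n b%:Z.
Proof. by rewrite /before -addn1 iotaD map_cat flatten_cat /= cats0. Qed.

Lemma mem_before b m :
  (m \in before b) = [&& (m < n)%N, dx m != 0 & yindex m < b%:Z].
Proof.
elim: b => [|b IH].
  rewrite /before in_nil; apply/esym/negbTE/negP => /and3P[mn _].
  by have := yindex_bound mn; lia.
rewrite beforeS mem_cat IH mem_bucket; case: (m < n)%N; case: (dx m != 0) => //=; lia.
Qed.

Lemma before_uniq b : uniq (before b).
Proof.
elim: b => // b IH; rewrite beforeS cat_uniq IH bucket_uniq andbT /=.
apply/hasPn => m; rewrite mem_bucket /= mem_before => /and3P[_ _ /eqP->].
by rewrite ltxx !andbF.
Qed.

Lemma before_pairwise b : pairwise (fun k m => y k <= y m) (before b).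
Proof.
elim: b => // b IH; rewrite beforeS pairwise_cat IH /=; apply/andP; split.
  apply/allrelP => k m; rewrite mem_before mem_bucket /yindex.
  by case/and3P=> _ _ + /and3P[_ _]; lia.
have : {in bucket n b%:Z &, forall k m, y k <= y m}.
  move=> k m; rewrite !mem_bucket /yindex => /and3P[_ _ h1] /and3P[_ _ h2]; lia.
elim: (bucket n b%:Z) => //= k s IHs h; apply/andP; split.
  by apply/allP => m ms; apply: h; rewrite inE ?eqxx ?ms ?orbT.
by apply: IHs => k' m hk hm; apply: h; rewrite inE ?hk ?hm orbT.
Qed.

Definition processed (j : nat) : seq nat :=
  before (absz (yindex j)) ++
  take (index j (bucket n (yindex j))) (bucket n (yindex j)).

Definition last_same_key (l : seq nat) (kappa : int) : nat :=
  last 0%N [seq m <- l | key m == kappa].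

Lemma processed_partner j : (j < n)%N -> dx j = eps ->
  has (fun m => key m == key j) (processed j) /\
  left_partner Z (last_same_key (processed j) (key j)) j.
Proof.
move=> jn dj; have d0 : dx j != 0 by rewrite dj (orientation_neq0 emb).
have yb := yindex_bound jn; have yE : (absz (yindex j))%:Z = yindex j by lia.
have mem_early m : (m < n)%N -> dx m != 0 -> y m < y j -> m \in processed j.
  move=> mn dm ym; rewrite mem_cat mem_before mn dm yE /=; apply/orP; left.
  by rewrite /yindex; lia.
have memP m : m \in processed j -> [/\ (m < n)%N, dx m != 0, y m <= y j & m != j].
  rewrite mem_cat mem_before yE => /orP[/and3P[mn dm ym]|mt].
    split=> //; first by move: ym; rewrite /yindex; lia.
    by apply: contraTneq ym => ->; rewrite ltxx.
  have := mem_take mt; rewrite mem_bucket => /and3P[mn dm /eqP ym].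
  split=> //; first by move: ym; rewrite /yindex; lia.
  apply: contraTneq mt => ->; apply/negP => jt.
  by have := index_ltn jt; rewrite ltnn.
have pw : pairwise (fun k m => y k <= y m) (processed j).
  have jb : (index j (bucket n (yindex j)) < size (bucket n (yindex j)))%N.
    by rewrite index_mem mem_bucket jn d0 eqxx.
  have := before_pairwise (absz (yindex j)).+1; rewrite beforeS yE.
  by rewrite -{1}(cat_take_drop (index j (bucket n (yindex j))) (bucket n (yindex j)))
     catA pairwise_cat => /and3P[].
have [m [mn dm km ym]] := left_end_exists emb dj.
have mp := mem_early m mn dm ym.
have hs : has (fun m => key m == key j) (processed j).
  by apply/hasP; exists m => //; apply/eqP.
split=> //; rewrite /last_same_key.
set f := [seq m <- processed j | key m == key j].
have fP k : k \in f -> [/\ (k < n)%N, dx k != 0, y k <= y j & k != j] /\ key k = key j.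
  by rewrite mem_filter => /andP[/eqP kk /memP].
have : pairwise (fun k m => y k <= y m) f.
  by apply: subseq_pairwise pw; apply: filter_subseq.
have mf : m \in f by rewrite mem_filter km eqxx.
have inf k : (k < n)%N -> dx k != 0 -> key k = key j -> y k < y j -> k \in f.
  by move=> kn dk kk yk; rewrite mem_filter kk eqxx mem_early.
move: fP inf mf; case/lastP: f => // f i fP inf _.
rewrite last_rcons pairwise_rcons => /andP[/allP hi _].
have [[i_n di yi ij] ki] : [/\ (i < n)%N, dx i != 0, y i <= y j & i != j] /\ key i = key j.
  by apply: fP; rewrite mem_rcons mem_head.
have yij : y i < y j.
  rewrite lt_neqAle yi andbT; apply: contra ij => /eqP yy; apply/eqP.
  exact: (xstep_inj emb di d0 ki yy i_n jn).
split=> // k kn dk kk; apply/negP => /andP[h1 h2].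
have := inf k kn dk kk h2; rewrite mem_rcons inE => /orP[/eqP kE|/hi].
  by move: h1; rewrite kE ltxx.
by rewrite leNgt h1.
Qed.

Lemma perm_before : perm_eq (before (2 * n).+1) [seq m <- iota 0 n | dx m != 0].
Proof.
apply: uniq_perm; [exact: before_uniq|by rewrite filter_uniq ?iota_uniq|].
move=> m; rewrite mem_before mem_filter mem_iota add0n.
case: (boolP (m < n)%N) => mn; last by rewrite /= !andbF.
by have := yindex_bound mn; case: (dx m != 0) => //=; lia.
Qed.

Lemma size_before : (size (before (2 * n).+1) <= n)%N.
Proof.
rewrite (perm_size perm_before) size_filter.
by apply: leq_trans (count_size _ _) _; rewrite size_iota.
Qed.

Definition direction_sum : int :=
  \sum_(j <- before (2 * n).+1 | dx j == eps)
    cut_term Z eps (last_same_key (processed j) (key j)) j.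

Lemma direction_sumE :
  direction_sum = 2 * \sum_(uv | xpair e pos uv) imbalance e uv.
Proof.
pose p j := last_same_key (processed j) (key j).
rewrite (@cut_sum _ _ _ _ emb p) => [|j jn dj]; last by case: (processed_partner jn dj).
rewrite /direction_sum (perm_big _ perm_before) /= big_filter_cond /=.
rewrite -(big_mkord (fun j => dx j == eps) (fun j => cut_term Z eps (p j) j)).
rewrite /index_iota subn0; apply: eq_bigl => j.
by case: (dx j =P eps) => [->|_]; rewrite ?andbF // (orientation_neq0 emb).
Qed.
End Order.

(* Array 4 * d holds the prefix weights, 4 * d + 1 and 4 * d + 2 the heads and links of
   the lists of steps with a given second coordinate (shifted by one: 0 ends a list),
   and 4 * d + 3 the last step seen in each row. *)
Definition bucket_insert (d : nat) : cmd :=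
  Seq (Write (eAddr (4 * d + 2) (Reg 2)) (Read (eAddr (4 * d + 1) (Reg 7))))
      (Write (eAddr (4 * d + 1) (Reg 7)) (eAdd (Reg 2) (num 1))).

Definition scan_body (d : nat) : cmd :=
  Seq (Write (eAddr (4 * d) (Reg 2)) (Reg 4))
  (Seq (Assign 4 (eAdd (Reg 4) (eWeight d (Reg 2))))
  (Seq (Assign 7 (eAdd (eSub (eCoord d 1 (Reg 2)) (eCoord d 1 (num 0))) (Reg 0)))
  (Seq (If (eEq (eCoord d 0 (Reg 2)) (eCoord d 0 (eAdd (Reg 2) (num 1)))) Skip
           (bucket_insert d))
       (Assign 2 (eAdd (Reg 2) (num 1)))))).

Definition cur : expr := eSub (Reg 6) (num 1).

Definition add_term (d : nat) : cmd :=
  Seq (Assign 8 (Read (eAddr (4 * d + 3) (Reg 7))))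
  (Seq (Assign 9 (eAdd (eSub cur (Reg 8))
     (eMul (Reg 3) (eSub (Read (eAddr (4 * d) cur)) (Read (eAddr (4 * d) (Reg 8)))))))
  (Seq (Assign 9 (eAbs 9))
  (Seq (Assign 9 (eSub (eAdd (Reg 0) (eMul (Reg 3) (Reg 4))) (eMul (num 2) (Reg 9))))
  (Seq (Assign 9 (eAbs 9))
       (Assign 1 (eAdd (Reg 1)
          (eMul (eAdd (eSub (eCoord d 1 cur) (eCoord d 1 (Reg 8))) (num 1)) (Reg 9)))))))).

Definition eKey (d : nat) (a : expr) : expr :=
  eAdd (eCoord d 0 a) (eCoord d 0 (eAdd a (num 1))).

Definition sweep_body (d : nat) : cmd :=
  Seq (Assign 7 (eAdd (eSub (eKey d cur) (eKey d (num 0))) (eMul (num 2) (Reg 0))))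
  (Seq (If (eEq (eSub (eCoord d 0 (eAdd cur (num 1))) (eCoord d 0 cur)) (Reg 3))
           (add_term d) Skip)
  (Seq (Write (eAddr (4 * d + 3) (Reg 7)) cur)
       (Assign 6 (Read (eAddr (4 * d + 2) cur))))).

Definition scan_init : cmd := Seq (Assign 2 (num 0)) (Assign 4 (num 0)).

Definition sweep_init : cmd :=
  Seq (Assign 3 (eSub (eLt (num 0) (Reg 4)) (eLt (Reg 4) (num 0)))) (Assign 5 (num 0)).

Definition scan_loop (d : nat) : cmd := While (eLt (Reg 2) (Reg 0)) (scan_body d).

Definition list_loop (d : nat) : cmd := While (Reg 6) (sweep_body d).

Definition sweep_loop (d : nat) : cmd :=
  While (eLt (Reg 5) (eAdd (eMul (num 2) (Reg 0)) (num 1)))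
    (Seq (Assign 6 (Read (eAddr (4 * d + 1) (Reg 5))))
    (Seq (list_loop d) (Assign 5 (eAdd (Reg 5) (num 1))))).

Definition direction (d : nat) : cmd :=
  Seq scan_init (Seq (scan_loop d) (Seq sweep_init (sweep_loop d))).

Definition mostar_program : cmd :=
  Seq (direction 0) (Seq (direction 1) (Seq (direction 2)
    (Assign 0 (eDiv (Reg 1) (num 2))))).

Lemma eval_eAddr arr a s : eval (eAddr arr a) s = addr arr (eval a s).
Proof. by []. Qed.

Lemma eval_eAbs r s : eval (eAbs r) s = `|regs s r|.
Proof. by rewrite /=; case: ifP; lia. Qed.

Fixpoint chain (next : int -> int) (h : int) (l : seq nat) : Prop :=
  match l with
  | [::] => h = 0
  | j :: l' => h = j.+1%:Z /\ chain next (next j%:Z) l'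
  end.

Lemma chain_eq next next' h l : (forall j, j \in l -> next j%:Z = next' j%:Z) ->
  chain next h l -> chain next' h l.
Proof.
elim: l h => //= j l IH h eqn [-> c]; split=> //; rewrite -eqn ?mem_head //.
by apply: IH c => k kl; apply: eqn; rewrite inE kl orbT.
Qed.

Section Direction.
Variables (Z : seq point) (d : nat) (T : finType) (e : rel T) (pos : T -> point).
Hypotheses (d3 : (d < 3)%N) (emb : embeds (rotated d Z) e pos).
Local Notation Zd := (rotated d Z).
Local Notation n := (size Z).
Local Notation z := (cvertex Zd).
Local Notation eps := (orientation Zd).
Local Notation dx := (xdiff Zd).
Local Notation key := (xkey Zd).
Local Notation y := (yval Zd).

Let Zcyc : lattice_cycle Zd := embeds_cycle emb.

Let n0 : (0 < n)%N.
Proof. by have := size_gt0 Zcyc; rewrite size_rotated. Qed.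

Let sz : size Zd = n := size_rotated d Z.

Definition next_link (s : state) (i : int) : int := memory s (addr (4 * d + 2) i).

Definition other_heads (s0 s : state) : Prop :=
  forall d' i, (d' < 3)%N -> d' != d -> 0 <= i ->
    memory s (addr (4 * d' + 1) i) = memory s0 (addr (4 * d' + 1) i).

Record scan_inv (s0 : state) (k : nat) (s : state) : Prop := ScanInv {
  scan_input : input_ok Z s;
  scan_acc : regs s 1 = regs s0 1;
  scan_k : regs s 2 = k%:Z;
  scan_weight : regs s 4 = prefix_weight Zd k;
  scan_prefix : forall m, (m < k)%N -> memory s (addr (4 * d) m%:Z) = prefix_weight Zd m;
  scan_chain : forall b : int, 0 <= b ->
    chain (next_link s) (memory s (addr (4 * d + 1) b)) (bucket Zd k b);
  scan_other : other_heads s0 s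
}.

Lemma eval_x s a k : input_ok Z s -> eval a s = Posz k ->
  eval (eCoord d 0 a) s = coordx (z k).
Proof. by move=> ok ak; rewrite (eval_eCoord n0 d3 _ ok ak). Qed.

Lemma eval_y s a k : input_ok Z s -> eval a s = Posz k ->
  eval (eCoord d 1 a) s = coordy (z k).
Proof. by move=> ok ak; rewrite (eval_eCoord n0 d3 _ ok ak). Qed.

Definition scan_state (k : nat) (s : state) : state :=
  let s3 := set_reg (set_reg (set_memory s (addr (4 * d) k%:Z) (prefix_weight Zd k))
              4 (prefix_weight Zd k.+1)) 7 (yindex Zd k) in
  let s4 := if dx k == 0 then s3 else
    set_memory (set_memory s3 (addr (4 * d + 2) k%:Z)
                  (memory s3 (addr (4 * d + 1) (yindex Zd k))))
      (addr (4 * d + 1) (yindex Zd k)) k.+1%:Z in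
  set_reg s4 2 k.+1%:Z.

Lemma run_Seq c1 c2 s : run (Seq c1 c2) s = run c2 (run c1 s). Proof. by []. Qed.

Lemma run_Assign r a s : run (Assign r a) s = set_reg s r (eval a s). Proof. by []. Qed.

Lemma run_Write a b s : run (Write a b) s = set_memory s (eval a s) (eval b s).
Proof. by []. Qed.

Lemma run_If b c1 c2 s :
  run (If b c1 c2) s = if eval b s == 0 then run c2 s else run c1 s.
Proof. by []. Qed.

Lemma run_scan_body s0 k s : scan_inv s0 k s -> run (scan_body d) s = scan_state k s.
Proof.
case=> ok _ sk sw _ _ _; rewrite /scan_body run_Seq run_Write eval_eAddr.
have -> : eval (Reg 2) s = k%:Z by [].
have -> : eval (Reg 4) s = prefix_weight Zd k by [].
set s1 := set_memory _ _ _.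
have ok1 : input_ok Z s1 by apply: input_ok_memory.
have k1 : eval (Reg 2) s1 = Posz k by [].
rewrite run_Seq run_Assign.
have -> : eval (eAdd (Reg 4) (eWeight d (Reg 2))) s1 = prefix_weight Zd k.+1.
  rewrite (_ : eval (eAdd _ _) s1 = eval (Reg 4) s1 + eval (eWeight d (Reg 2)) s1) //.
  rewrite (eval_eWeight n0 d3 ok1 k1) /prefix_weight big_nat_recr //=; congr (_ + _).
  exact: sw.
set s2 := set_reg s1 _ _.
have ok2 : input_ok Z s2 by apply: input_ok_reg.
have k2 : eval (Reg 2) s2 = Posz k by [].
rewrite run_Seq run_Assign.
have -> : eval (eAdd (eSub (eCoord d 1 (Reg 2)) (eCoord d 1 (num 0))) (Reg 0)) s2 = yindex Zd k.
  rewrite (_ : eval (eAdd _ _) s2 = eval (eCoord d 1 (Reg 2)) s2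
     - eval (eCoord d 1 (num 0)) s2 + eval (Reg 0) s2) //.
  by rewrite (eval_y ok2 k2) (@eval_y s2 (num 0) 0 ok2 erefl) (ok2.1 : eval (Reg 0) s2 = _)
     /yindex /yval sz.
set s3 := set_reg s2 _ _.
have ok3 : input_ok Z s3 by apply: input_ok_reg.
have k3 : eval (Reg 2) s3 = Posz k by [].
have k3' : eval (eAdd (Reg 2) (num 1)) s3 = Posz k.+1 by rewrite /= sk; lia.
rewrite run_Seq run_If.
have -> : eval (eEq (eCoord d 0 (Reg 2)) (eCoord d 0 (eAdd (Reg 2) (num 1)))) s3
    = if dx k == 0 then 1 else 0.
  rewrite (_ : eval (eEq _ _) s3 = if eval (eCoord d 0 (Reg 2)) s3 ==
    eval (eCoord d 0 (eAdd (Reg 2) (num 1))) s3 then 1 else 0) //.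
  by rewrite (eval_x ok3 k3) (eval_x ok3 k3') /xdiff subr_eq0 eq_sym.
rewrite /scan_state -/s1 -/s2 -/s3; cbv zeta.
case: (dx k == 0) => /=.
  by rewrite sk; congr set_reg; lia.
rewrite !sk /addr; congr set_reg; last lia.
congr set_memory; lia.
Qed.

Lemma scan_step s0 k s : (k < n)%N -> scan_inv s0 k s -> scan_inv s0 k.+1 (scan_state k s).
Proof.
move=> kn [ok sa sk sw sp sc so].
have yb : 0 <= yindex Zd k by have := @yindex_bound Zd _ _ _ emb k; rewrite sz => /(_ kn); lia.
have d12 i : (i < 4)%N -> (4 * d + i < 12)%N by lia.
have d12' : (4 * d < 12)%N by lia.
have a01 : (4 * d == 4 * d + 1)%N = false by lia.
have a02 : (4 * d == 4 * d + 2)%N = false by lia.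
have a10 : (4 * d + 1 == 4 * d)%N = false by lia.
have a12 : (4 * d + 1 == 4 * d + 2)%N = false by lia.
have a20 : (4 * d + 2 == 4 * d)%N = false by lia.
have a21 : (4 * d + 2 == 4 * d + 1)%N = false by lia.
pose arrE := (a01, a02, a10, a12, a20, a21).
have rE r : r \notin [:: 2; 4; 7]%N -> regs (scan_state k s) r = regs s r.
  rewrite !inE !negb_or => /and3P[/negbTE r2 /negbTE r4 /negbTE r7].
  by rewrite /scan_state /= r2; case: (dx k == 0) => /=; rewrite r4 r7.
have mE arr i : (arr < 12)%N -> arr != (4 * d)%N -> arr != (4 * d + 1)%N ->
    arr != (4 * d + 2)%N -> memory (scan_state k s) (addr arr i) = memory s (addr arr i).
  move=> arr12 h0 h1 h2; rewrite /scan_state /=.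
  by case: (dx k == 0) => /=; rewrite !addr_eq ?d12 // ?(negbTE h0) ?(negbTE h1) ?(negbTE h2).
split.
- rewrite /scan_state; apply: input_ok_reg => //.
  have ok3 : input_ok Z (set_reg (set_reg (set_memory s (addr (4 * d) k%:Z) (prefix_weight Zd k))
     4 (prefix_weight Zd k.+1)) 7 (yindex Zd k)).
    by do 2 apply: input_ok_reg => //; apply: input_ok_memory.
  by case: (dx k == 0) => //; do 2 apply: input_ok_memory => //.
- by rewrite rE.
- by [].
- by rewrite /scan_state /=; case: (dx k == 0).
- move=> m mk; rewrite /scan_state /=.
  have -> : memory (if dx k == 0 then
       set_reg (set_reg (set_memory s (addr (4 * d) k) (prefix_weight Zd k)) 4
         (prefix_weight Zd k.+1)) 7 (yindex Zd k)
     else set_memory (set_memory (set_reg (set_reg (set_memory s (addr (4 * d) k)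
         (prefix_weight Zd k)) 4 (prefix_weight Zd k.+1)) 7 (yindex Zd k))
         (addr (4 * d + 2) k)
         (if addr (4 * d + 1) (yindex Zd k) == addr (4 * d) k then prefix_weight Zd k
          else memory s (addr (4 * d + 1) (yindex Zd k))))
       (addr (4 * d + 1) (yindex Zd k)) k.+1) (addr (4 * d) m)
     = if m == k then prefix_weight Zd k else memory s (addr (4 * d) m%:Z).
    by case: (dx k == 0) => /=; rewrite !addr_eq ?d12 // ?eqxx ?eqz_nat // ?arrE.
  case: (eqVneq m k) => [-> //|mk']; apply: sp; lia.
- move=> b b0; rewrite bucketS.
  have nE (j : nat) : (j < k)%N -> next_link s j%:Z = next_link (scan_state k s) j%:Z.
    move=> jk; rewrite /next_link /scan_state /=.
    have jE : (j%:Z == k%:Z) = false by lia.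
    by case: (dx k == 0) => /=; rewrite !addr_eq ?d12 // ?arrE //= jE andbF.
  have cE h : chain (next_link s) h (bucket Zd k b) ->
      chain (next_link (scan_state k s)) h (bucket Zd k b).
    by apply: chain_eq => j; rewrite mem_bucket => /and3P[/nE].
  have hE : memory (scan_state k s) (addr (4 * d + 1) b)
      = if (dx k != 0) && (yindex Zd k == b) then k.+1%:Z else memory s (addr (4 * d + 1) b).
    rewrite /scan_state /=; case: (dx k == 0) => /=; rewrite !addr_eq ?d12 //.
      by rewrite ?arrE.
    by rewrite eqxx /= (eq_sym b); case: (yindex Zd k == b) => //; rewrite ?arrE.
  rewrite hE; case: ifP => [/andP[dk /eqP yk]|_]; last exact: cE (sc b b0).
  split=> //; have -> : next_link (scan_state k s) k%:Z = memory s (addr (4 * d + 1) b).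
    rewrite /next_link /scan_state /= (negbTE dk) /= !addr_eq ?d12 // yk.
    by rewrite ?arrE !eqxx.
  exact: cE (sc b b0).
- move=> d' i d3' dd i0; rewrite mE ?so //; lia.
Qed.

Lemma run_add_term s i j : input_ok Z s -> regs s 6 = j.+1%:Z -> regs s 3 = eps ->
  regs s 4 = prefix_weight Zd n -> memory s (addr (4 * d + 3) (regs s 7)) = i%:Z ->
  memory s (addr (4 * d) i%:Z) = prefix_weight Zd i ->
  memory s (addr (4 * d) j%:Z) = prefix_weight Zd j ->
  [/\ memory (run (add_term d) s) = memory s,
      forall r, r \notin [:: 1; 8; 9]%N -> regs (run (add_term d) s) r = regs s r
    & regs (run (add_term d) s) 1 = regs s 1 + cut_term Zd eps i j].
Proof.
move=> ok r6 r3 r4 hi pi pj.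
have cj : eval cur s = j%:Z by rewrite /= r6; lia.
rewrite /add_term run_Seq run_Assign.
have -> : eval (Read (eAddr (4 * d + 3) (Reg 7))) s = i%:Z by [].
set s1 := set_reg s 8 _; rewrite run_Seq run_Assign.
pose D := j%:Z - i%:Z + eps * (prefix_weight Zd j - prefix_weight Zd i).
have -> : eval (eAdd (eSub cur (Reg 8)) (eMul (Reg 3)
    (eSub (Read (eAddr (4 * d) cur)) (Read (eAddr (4 * d) (Reg 8)))))) s1 = D.
  rewrite (_ : eval _ s1 = eval cur s - i%:Z + regs s 3 *
    (memory s (addr (4 * d) (eval cur s)) - memory s (addr (4 * d) i%:Z))) //.
  by rewrite cj r3 pi pj.
set s2 := set_reg s1 9 _; rewrite run_Seq run_Assign (eval_eAbs 9 s2).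
rewrite (_ : regs s2 9 = D) //; set s3 := set_reg s2 9 _; rewrite run_Seq run_Assign.
have -> : eval (eSub (eAdd (Reg 0) (eMul (Reg 3) (Reg 4))) (eMul (num 2) (Reg 9))) s3
   = n%:Z + eps * prefix_weight Zd n - 2 * `|D|.
  rewrite (_ : eval _ s3 = regs s 0 + regs s 3 * regs s 4 - 2 * `|D|) //.
  by rewrite ok.1 r3 r4.
set s4 := set_reg s3 9 _; rewrite run_Seq [run (Assign 9 _) s4]run_Assign.
rewrite (eval_eAbs 9 s4).
rewrite (_ : regs s4 9 = n%:Z + eps * prefix_weight Zd n - 2 * `|D|) //.
set s5 := set_reg s4 9 _; rewrite run_Assign.
have ok5 : input_ok Z s5 by do 5 apply: input_ok_reg => //.
have c5 : eval cur s5 = j%:Z by [].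
have i5 : eval (Reg 8) s5 = i%:Z by [].
have -> : eval (eAdd (Reg 1) (eMul (eAdd (eSub (eCoord d 1 cur) (eCoord d 1 (Reg 8))) (num 1))
    (Reg 9))) s5 = regs s 1 + cut_term Zd eps i j.
  rewrite (_ : eval _ s5 = regs s 1 + (eval (eCoord d 1 cur) s5
     - eval (eCoord d 1 (Reg 8)) s5 + 1) * `|n%:Z + eps * prefix_weight Zd n - 2 * `|D| |) //.
  by rewrite (eval_y ok5 c5) (eval_y ok5 i5) /cut_term sz.
split=> // r; rewrite !inE !negb_or => /and3P[/negbTE r1 /negbTE r8 /negbTE r9] /=.
by rewrite r1 r9 r8.
Qed.

Definition partner (j : nat) : nat := last_same_key Zd (processed Zd j) (key j).

Record sweep_inv (s0 s1 : state) (l : seq nat) (s : state) : Prop := SweepInv {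
  sweep_input : input_ok Z s;
  sweep_eps : regs s 3 = eps;
  sweep_weight : regs s 4 = prefix_weight Zd n;
  sweep_acc : regs s 1 = regs s0 1
    + \sum_(j <- l | dx j == eps) cut_term Zd eps (partner j) j;
  sweep_prefix : forall m, (m < n)%N -> memory s (addr (4 * d) m%:Z) = prefix_weight Zd m;
  sweep_head : forall i, memory s (addr (4 * d + 1) i) = memory s1 (addr (4 * d + 1) i);
  sweep_link : forall i, next_link s i = next_link s1 i;
  sweep_last : forall kappa, has (fun m => key m == kappa) l ->
    memory s (addr (4 * d + 3) (kindex Zd kappa)) = (last_same_key Zd l kappa)%:Z;
  sweep_other : other_heads s0 s
}.

Lemma sweep_step s0 s1 j s : (j < n)%N -> dx j != 0 ->
  sweep_inv s0 s1 (processed Zd j) s -> regs s 6 = j.+1%:Z ->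
  let s' := run (sweep_body d) s in
  [/\ sweep_inv s0 s1 (rcons (processed Zd j) j) s', regs s' 5 = regs s 5
    & regs s' 6 = next_link s1 j%:Z].
Proof.
move=> jn dj [ok r3 r4 r1 sp sh sl sla so] r6 s'; rewrite {}/s'.
have d12 i : (i < 4)%N -> (4 * d + i < 12)%N by lia.
have d12' : (4 * d < 12)%N by lia.
have a03 : (4 * d == 4 * d + 3)%N = false by lia.
have a13 : (4 * d + 1 == 4 * d + 3)%N = false by lia.
have a23 : (4 * d + 2 == 4 * d + 3)%N = false by lia.
have jn' : (j < size Zd)%N by rewrite sz.
have k0 : 0 <= kindex Zd (key j) by apply: kindex_ge0 emb _ jn'.
have cE t : regs t 6 = j.+1%:Z -> eval cur t = Posz j by rewrite /= => ->; lia.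
have c1E t : regs t 6 = j.+1%:Z -> eval (eAdd cur (num 1)) t = Posz j.+1.
  by rewrite /= => ->; lia.
rewrite /sweep_body run_Seq run_Assign.
have -> : eval (eAdd (eSub (eKey d cur) (eKey d (num 0))) (eMul (num 2) (Reg 0))) s
   = kindex Zd (key j).
  rewrite (_ : eval _ s = eval (eCoord d 0 cur) s + eval (eCoord d 0 (eAdd cur (num 1))) s
    - (eval (eCoord d 0 (num 0)) s + eval (eCoord d 0 (eAdd (num 0) (num 1))) s)
    + 2 * regs s 0) //.
  rewrite (eval_x ok (cE s r6)) (eval_x ok (c1E s r6)) (@eval_x s (num 0) 0 ok erefl).
  by rewrite (@eval_x s (eAdd (num 0) (num 1)) 1 ok erefl) ok.1 /kindex /xkey sz PoszM.
set t1 := set_reg s 7 _.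
have ok1 : input_ok Z t1 by apply: input_ok_reg.
rewrite run_Seq run_If.
have -> : eval (eEq (eSub (eCoord d 0 (eAdd cur (num 1))) (eCoord d 0 cur)) (Reg 3)) t1
   = if dx j == eps then 1 else 0.
  rewrite (_ : eval _ t1 = if eval (eCoord d 0 (eAdd cur (num 1))) t1
     - eval (eCoord d 0 cur) t1 == regs s 3 then 1 else 0) //.
  by rewrite (eval_x ok1 (cE t1 r6)) (eval_x ok1 (c1E t1 r6)) r3.
set t2 := if _ then _ else _.
have [m2 g2 h2] : [/\ memory t2 = memory s,
    forall r, r \notin [:: 1; 7; 8; 9]%N -> regs t2 r = regs s r
  & regs t2 1 = regs s0 1 + \sum_(k <- rcons (processed Zd j) j | dx k == eps)
      cut_term Zd eps (partner k) k /\ regs t2 7 = kindex Zd (key j)].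
  have -> : \sum_(k <- rcons (processed Zd j) j | dx k == eps) cut_term Zd eps (partner k) k
    = \sum_(k <- processed Zd j | dx k == eps) cut_term Zd eps (partner k) k
      + (if dx j == eps then cut_term Zd eps (partner j) j else 0).
    by rewrite -cats1 big_cat /= big_cons big_nil; case: ifP; rewrite ?addr0.
  have -> : t2 = if dx j == eps then run (add_term d) t1 else t1.
    by rewrite /t2; case: (dx j == eps).
  case: (eqVneq (dx j) eps) => [dje|_]; last first.
    split=> // [r|]; last by rewrite addr0 /=; split.
    by rewrite !inE !negb_or => /and4P[_ /negbTE r7 _ _]; rewrite /= r7.
  have [hs lp] := processed_partner emb jn' dje.
  have [pn _ _ _ _] := lp; rewrite sz in pn.
  have [|||||||m2 g2 h2] := @run_add_term t1 (partner j) j.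
  - exact: ok1.
  - exact: r6.
  - exact: r3.
  - exact: r4.
  - exact: sla hs.
  - exact: sp pn.
  - exact: sp.
  split=> // [r|]; last by rewrite h2 g2 //= r1 addrA.
  rewrite !inE !negb_or => /and4P[q1 q7 q8 q9]; rewrite g2 /= ?(negbTE q7) //.
  by rewrite !inE !negb_or q1 q8 q9.
case: h2 => h2 h7.
have r62 : regs t2 6 = j.+1%:Z by rewrite g2.
have ok2 : input_ok Z t2 by split; [rewrite g2 // ok.1|rewrite m2; exact: ok.2].
rewrite run_Seq run_Write eval_eAddr (cE t2 r62) (_ : eval (Reg 7) t2 = kindex Zd (key j)) //.
set t3 := set_memory t2 _ _; rewrite run_Assign.
have -> : eval (Read (eAddr (4 * d + 2) cur)) t3 = next_link s1 j%:Z.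
  rewrite (_ : eval _ t3 = memory t3 (addr (4 * d + 2) (eval cur t3))) //.
  rewrite (cE t3 r62) /= addr_eq ?d12 // a23 /= m2; exact: sl.
split=> //; last by rewrite /= g2.
split.
- by apply: input_ok_reg => //; apply: input_ok_memory.
- by rewrite /= g2.
- by rewrite /= g2.
- exact: h2.
- by move=> m mn; rewrite /= addr_eq ?d12 // a03 /= m2 sp.
- by move=> i; rewrite /= addr_eq ?d12 // a13 /= m2 sh.
- by move=> i; rewrite /next_link /= addr_eq ?d12 // a23 /= m2; exact: sl.
- move=> kappa; rewrite has_rcons /= addr_eq ?d12 // eqxx /= /last_same_key filter_rcons.
  have -> : (kindex Zd kappa == kindex Zd (key j)) = (key j == kappa).
    by rewrite /kindex; lia.
  by case: (key j == kappa) => /=; rewrite ?last_rcons // m2; apply: sla.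
- move=> d' i d3' dd i0; rewrite /= addr_eq ?d12 //; last lia.
  have -> : (4 * d' + 1 == 4 * d + 3)%N = false by lia.
  by rewrite /= m2 so.
Qed.

Lemma list_loop_exec s0 s1 (b : nat) s : sweep_inv s0 s1 (before Zd b) s ->
  regs s 5 = b%:Z -> chain (next_link s1) (regs s 6) (bucket Zd n b%:Z) ->
  exists t s', [/\ exec (list_loop d) s t s',
    sweep_inv s0 s1 (before Zd b.+1) s', regs s' 5 = b%:Z
  & (t <= size (bucket Zd n b%:Z) * (max_cost (sweep_body d) + 2) + 2)%N].
Proof.
move=> inv r5 ch; pose B := bucket Zd n b%:Z.
pose I k s := [/\ sweep_inv s0 s1 (before Zd b ++ take k B) s, regs s 5 = b%:Z
  & chain (next_link s1) (regs s 6) (drop k B)].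
have [|||t [s' [ex [inv' r5' _] ht]]] :=
  @exec_while (Reg 6) (sweep_body d) I (fun=> max_cost (sweep_body d)) (size B) _ _ s.
- move=> k u kB [iu u5 cu]; rewrite (drop_nth 0%N kB) /= in cu; case: cu => u6 cu.
  split; first by rewrite /= u6.
  set j := nth 0%N B k in u6 cu.
  have := mem_nth 0%N kB; rewrite -/j mem_bucket => /and3P[jn dj /eqP yj].
  have pE : processed Zd j = before Zd b ++ take k B.
    by rewrite /processed yj sz -/B index_uniq // bucket_uniq.
  rewrite -pE in iu; have [i1 i2 i3] := sweep_step jn dj iu u6.
  have [t ht ex] := @exec_run (sweep_body d) u isT.
  exists t, (run (sweep_body d) u); split=> //; split.
  + by rewrite (take_nth 0%N kB) -rcons_cat -pE.
  + by rewrite i2.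
  + by rewrite i3.
- by move=> u [_ _]; rewrite drop_size.
- by split=> //; rewrite ?take0 ?cats0 ?drop0.
exists t, s'; split=> //.
  by rewrite take_size in inv'; rewrite beforeS sz.
apply: leq_trans ht _; rewrite sum_nat_const_nat subn0 /= leq_add2r leq_mul //.
Qed.

Lemma size_before_sum m : size (before Zd m) = (\sum_(0 <= b < m) size (bucket Zd n b%:Z))%N.
Proof.
elim: m => [|m IH]; first by rewrite big_geq.
by rewrite beforeS size_cat IH big_nat_recr //= sz.
Qed.

Definition direction_cost : nat :=
  max_cost scan_init + (max_cost (scan_body d) + 8) + max_cost sweep_init
  + (max_cost (sweep_body d) + 2) + 3 * (max_cost (Assign 6 (Read (eAddr (4 * d + 1) (Reg 5))))
  + 2 + max_cost (Assign 5 (eAdd (Reg 5) (num 1))) + 8) + 8.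

Lemma direction_exec s0 : input_ok Z s0 ->
  (forall i, 0 <= i -> memory s0 (addr (4 * d + 1) i) = 0) ->
  exists t s, [/\ exec (direction d) s0 t s, (t <= direction_cost * n)%N,
    input_ok Z s, regs s 1 = regs s0 1 + direction_sum Zd & other_heads s0 s].
Proof.
move=> ok0 h0.
have [ta hta ea] := @exec_run scan_init s0 isT.
set sa := run scan_init s0 in ea.
have [|||tb [sb [eb ib htb]]] := @exec_while (eLt (Reg 2) (Reg 0)) (scan_body d)
    (scan_inv s0) (fun=> max_cost (scan_body d)) n _ _ sa.
- move=> k s kn iv; split.
    rewrite (_ : eval _ s = if regs s 2 < regs s 0 then 1 else 0) //.
    by rewrite (scan_k iv) (scan_input iv).1 ltz_nat kn.
  have [t ht ex] := @exec_run (scan_body d) s isT.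
  exists t, (run (scan_body d) s); split=> //.
  by rewrite (run_scan_body iv); apply: scan_step.
- move=> s iv; rewrite (_ : eval _ s = if regs s 2 < regs s 0 then 1 else 0) //.
  by rewrite (scan_k iv) (scan_input iv).1 ltxx.
- rewrite (_ : sa = set_reg (set_reg s0 2 0) 4 0) //; split=> //.
  + by rewrite /prefix_weight big_geq.
have [tc htc ec] := @exec_run sweep_init sb isT.
set sc := run sweep_init sb in ec.
have sgn : (if 0 < prefix_weight Zd n then 1 else 0)
    - (if prefix_weight Zd n < 0 then 1 else 0) = eps.
  have := orientation_prefix emb; rewrite sz.
  case: (orientation_cases Zcyc) => ->; case: ifP; case: ifP; lia.
pose I b s := sweep_inv s0 sb (before Zd b) s /\ regs s 5 = b%:Z.
pose B b := (max_cost (Assign 6 (Read (eAddr (4 * d + 1) (Reg 5))))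
  + (size (bucket Zd n (Posz b)) * (max_cost (sweep_body d) + 2) + 2
     + max_cost (Assign 5 (eAdd (Reg 5) (num 1)))))%N.
have [|||td [sd [ed [id rd] htd]]] := @exec_while
   (eLt (Reg 5) (eAdd (eMul (num 2) (Reg 0)) (num 1)))
   (Seq (Assign 6 (Read (eAddr (4 * d + 1) (Reg 5))))
    (Seq (list_loop d) (Assign 5 (eAdd (Reg 5) (num 1))))) I B (2 * n).+1 _ _ sc.
- move=> b s bn [iv r5]; split.
    rewrite (_ : eval _ s = if regs s 5 < 2 * regs s 0 + 1 then 1 else 0) //.
    by rewrite r5 (sweep_input iv).1; case: ifP; lia.
  set u := set_reg s 6 (memory s (addr (4 * d + 1) b%:Z)).
  have eu : exec (Assign 6 (Read (eAddr (4 * d + 1) (Reg 5)))) s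
      (max_cost (Assign 6 (Read (eAddr (4 * d + 1) (Reg 5))))) u.
    have -> : u = set_reg s 6 (eval (Read (eAddr (4 * d + 1) (Reg 5))) s).
      by rewrite /u -r5.
    exact: ExecAssign.
  have iu : sweep_inv s0 sb (before Zd b) u.
    by case: iv => *; split=> //; apply: input_ok_reg.
  have cu : chain (next_link sb) (regs u 6) (bucket Zd n b%:Z).
    by rewrite /= (sweep_head iv); apply: (scan_chain ib).
  have [t [s' [ex iv' r5' ht]]] := list_loop_exec iu r5 cu.
  exists (max_cost (Assign 6 (Read (eAddr (4 * d + 1) (Reg 5))))
     + (t + max_cost (Assign 5 (eAdd (Reg 5) (num 1)))))%N,
     (set_reg s' 5 (eval (eAdd (Reg 5) (num 1)) s')); split.
  + by apply: ExecSeq eu _; apply: ExecSeq ex _; apply: ExecAssign.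
  + by rewrite /B leq_add2l leq_add2r.
  + split; last by rewrite /= r5'; lia.
    by case: iv' => *; split=> //; apply: input_ok_reg.
- move=> s [iv r5]; rewrite (_ : eval _ s = if regs s 5 < 2 * regs s 0 + 1 then 1 else 0) //.
  by rewrite r5 (sweep_input iv).1; case: ifP; lia.
- have r4 := scan_weight ib.
  have -> : sc = set_reg (set_reg sb 3 eps) 5 0 by rewrite /sc /sweep_init /= r4 sgn.
  split=> //; split=> //.
  + by do 2 apply: input_ok_reg => //; apply: (scan_input ib).
  + by rewrite big_nil addr0; apply: (scan_acc ib).
  + exact: (scan_prefix ib).
  + exact: (scan_other ib).
exists (ta + (tb + (tc + td)))%N, sd; split.
- apply: ExecSeq ea _; apply: ExecSeq eb _; exact: ExecSeq ec ed.
- rewrite sum_nat_const_nat subn0 in htb.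
  have sB : (\sum_(0 <= b < (2 * n).+1)
       (B b + (ecost (eLt (Reg 5) (eAdd (eMul (num 2) (Reg 0)) (num 1)))).+1)
     <= n * (max_cost (sweep_body d) + 2) + (2 * n).+1 *
       (max_cost (Assign 6 (Read (eAddr (4 * d + 1) (Reg 5))))
        + 2 + max_cost (Assign 5 (eAdd (Reg 5) (num 1))) + 8))%N.
    apply: (@leq_trans (\sum_(0 <= b < (2 * n).+1)
       (size (bucket Zd n (Posz b)) * (max_cost (sweep_body d) + 2)
       + (max_cost (Assign 6 (Read (eAddr (4 * d + 1) (Reg 5))))
        + 2 + max_cost (Assign 5 (eAdd (Reg 5) (num 1))) + 8)))%N).
      apply: leq_sum => b _; rewrite /B /=.
      move: (size _ * _)%N => q; lia.
    rewrite big_split /= sum_nat_const_nat subn0 leq_add2r -big_distrl /= leq_mul2r.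
    by apply/orP; right; rewrite -size_before_sum -[X in (_ <= X)%N]sz -{1}sz (size_before emb).
  have {}htd := leq_trans htd (leq_add sB (leqnn _)).
  move: hta htb htc htd; rewrite /direction_cost.
  rewrite [ecost (eLt (Reg 2) _)]/= [ecost (eLt (Reg 5) _)]/=.
  move: (max_cost scan_init) (max_cost (scan_body d)) (max_cost sweep_init)
    (max_cost (sweep_body d)) (max_cost (Assign 6 _)) (max_cost (Assign 5 _)).
  move=> c1 c2 c3 c4 c5 c6 h1 h2 h3 h4; have := n0; move: (size Z) h2 h4 => q h2 h4 q0.
  by nia.
- exact: (sweep_input id).
- by rewrite (sweep_acc id) /direction_sum sz.
- exact: (sweep_other id).
Qed.
End Direction.

Lemma benzenoid_embeds Z (V : {fset point}) (e : rel V) :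
  benzenoid Z e -> embeds Z e (fun v : V => val v).
Proof.
case=> c v d; split=> //; first exact: val_inj.
move=> p; split=> [/v pV|[x <-]]; first by exists [` pV]%fset.
by apply/v; apply: valP.
Qed.

Lemma input_state_heads Z arr i : 0 <= i -> memory (input_state Z) (addr arr i) = 0.
Proof.
by move=> i0; have : addr arr i < 0; [rewrite /addr; lia|case: (addr arr i)].
Qed.

Theorem theorem4p4 :
  exists (prog : cmd) (C : nat),
    forall (Z : seq point) (V : {fset point}) (e : rel V),
      benzenoid Z e ->
      exists (t : nat) (s : state),
        [/\ exec prog (input_state Z) t s,
            (t <= C * size Z)%N
          & output s = Posz (mostar e)].
Proof.
exists mostar_program, (direction_cost 0 + direction_cost 1 + direction_cost 2 + 4)%N.
move=> Z V e bz; have emb0 := benzenoid_embeds bz.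
have emb1 := embeds_rotate emb0; have emb2 := embeds_rotate emb1.
have ok0 : input_ok Z (input_state Z) by [].
have [t0 [s0 [e0 h0 ok1 r0 o0]]] := @direction_exec Z 0 _ _ _ isT emb0 _ ok0
  (fun i => @input_state_heads Z _ i).
have hd1 i : 0 <= i -> memory s0 (addr (4 * 1 + 1) i) = 0.
  by move=> i0; rewrite (o0 1%N) // input_state_heads.
have [t1 [s1 [e1 h1 ok2 r1 o1]]] := @direction_exec Z 1 _ _ _ isT emb1 _ ok1 hd1.
have hd2 i : 0 <= i -> memory s1 (addr (4 * 2 + 1) i) = 0.
  by move=> i0; rewrite (o1 2%N) // (o0 2%N) // input_state_heads.
have [t2 [s2 [e2 h2 _ r2 _]]] := @direction_exec Z 2 _ _ _ isT emb2 _ ok2 hd2.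
exists (t0 + (t1 + (t2 + 4)))%N, (set_reg s2 0 (eval (eDiv (Reg 1) (num 2)) s2)); split.
- apply: ExecSeq e0 _; apply: ExecSeq e1 _; apply: ExecSeq e2 _; exact: ExecAssign.
- have := size_gt0 (embeds_cycle emb0); nia.
rewrite /output /= r2 r1 r0 /= add0r.
rewrite (direction_sumE emb0) (direction_sumE emb1) (direction_sumE emb2).
by rewrite -!mulrDr -(mostar_xpairs emb0) mulKz.
Qed.
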